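(* For all integers $m\geq 2$ and $n_1,\ldots,n_m\geq 1$, $$\left(\frac{\sqrt{\pi}}{2}\right)^{m-1}\leq\frac{G_{n_{1}\ldots n_{m}}^{(1)}}{\sqrt{n_{1}\cdots n_{m}}\,\max\{\sqrt{n_{1}},\ldots,\sqrt{n_{m}}\}}\leq 1 .$$ Moreover, the universal upper bound $1$ cannot be improved: there is no constant $C<1$ such that the quotient above is at most $C$ for all integers $m\geq 2$ and all $n_1,\ldots,n_m\geq 1$.
   Context: An $n_1\times\cdots\times n_m$ pattern is an array $\Theta=(a_{j_1\ldots j_m})$, $1\le j_k\le n_k$ for $k=1,\dots,m$, of unit vectors of the Euclidean plane $\mathbb{R}^2$. For each $k\in\{1,\ldots,m\}$ there are $n_k$ knobs $x^{(k)}_1,\ldots,x^{(k)}_{n_k}$; when the knob $x^{(k)}_{j_k}$ is rotated by an angle $\theta^{(k)}_{j_k}\in\mathbb{R}$, all vectors $a_{j_1\ldots j_m}$ with that value of $j_k$ fixed are rotated by the same angle. Let $s(\Theta)$ be the supremum of the Euclidean norms of the sum of all $n_1\cdots n_m$ vectors achievable by rotating knobs. Identifying $\mathbb{R}^2$ with $\mathbb{C}$ (so $|a_{j_1\ldots j_m}|=1$), this is $$s(\Theta)=\sup\left\{\left|\sum_{j_1=1}^{n_1}\cdots\sum_{j_m=1}^{n_m}a_{j_1\ldots j_m}x^{(1)}_{j_1}\cdots x^{(m)}_{j_m}\right| : x^{(k)}_{j_k}\in\mathbb{C},\ |x^{(k)}_{j_k}|=1 \text{ for all } k, j_k\right\}.$$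 Define $$G^{(1)}_{n_1\ldots n_m}:=\min\{s(\Theta):\Theta \text{ an } n_1\times\cdots\times n_m \text{ pattern}\}.$$ *)

(* Defs.v *)
From HB Require Import structures.
From mathcomp Require Import all_boot all_order all_algebra.
From mathcomp Require Import complex.
From mathcomp Require Import all_classical all_reals all_analysis.
Set Implicit Arguments.
Unset Strict Implicit.
Unset Printing Implicit Defensive.
Import Order.TTheory GRing.Theory Num.Theory.
Import numFieldNormedType.Exports.
Import complex.ComplexField.Normc.
Local Open Scope classical_set_scope.
Local Open Scope ring_scope.

Definition multi_index (m : nat) (n : 'I_m -> nat) : finType :=
  {dffun forall k : 'I_m, 'I_(n k)}.

Definition is_pattern (R : realType) (m : nat) (n : 'I_m -> nat)
    (a : multi_index n -> R[i]) : Prop :=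
  forall j, normc (a j) = 1.

Definition knob_setting (R : realType) (m : nat) (n : 'I_m -> nat) : Type :=
  forall k : 'I_m, 'I_(n k) -> R[i].

Definition unimodular (R : realType) (m : nat) (n : 'I_m -> nat)
    (x : knob_setting R n) : Prop :=
  forall (k : 'I_m) (l : 'I_(n k)), normc (x k l) = 1.

Definition rotated_sum (R : realType) (m : nat) (n : 'I_m -> nat)
    (a : multi_index n -> R[i]) (x : knob_setting R n) : R[i] :=
  \sum_(j : multi_index n) a j * \prod_(k < m) x k (j k).

Definition knob_sup (R : realType) (m : nat) (n : 'I_m -> nat)
    (a : multi_index n -> R[i]) : R :=
  sup [set normc (rotated_sum a x) | x in @unimodular R m n].

(* The infimum is attained, hence a minimum: see [G1_attained]. *)
Definition G1 (R : realType) (m : nat) (n : 'I_m -> nat) : R :=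
  inf [set knob_sup a | a in @is_pattern R m n].

(* The square roots are nonnegative, so 0 is a neutral start for the maximum. *)
Definition G1_quotient (R : realType) (m : nat) (n : 'I_m -> nat) : R :=
  G1 R n / (Num.sqrt (\prod_(k < m) (n k)%:R) *
            \big[Num.max/0]_(k < m) Num.sqrt (n k)%:R).

Section Attained.
Variables (R : realType) (m : nat) (n : 'I_m -> nat).
Implicit Types (a b : multi_index n -> R[i]) (x : knob_setting R n).

Lemma normc_sum (I : finType) (F : I -> R[i]) :
  normc (\sum_i F i) <= \sum_i normc (F i).
Proof.
elim/big_ind2: _ => [|x1 x2 y1 y2 h1 h2|//]; first by rewrite normc0.
by apply: le_trans (le_normcD _ _) _; apply: lerD.
Qed.

Lemma normc_prod (I : finType) (F : I -> R[i]) :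
  normc (\prod_i F i) = \prod_i normc (F i).
Proof. by elim/big_ind2: _ => [|x1 x2 y1 y2 <- <-|//]; rewrite ?normc1 ?normcM. Qed.

Lemma normc_rotated_sum a x : unimodular x ->
  normc (rotated_sum a x) <= \sum_j normc (a j).
Proof.
move=> xU; apply: le_trans (normc_sum _) _; apply: ler_sum => j _.
by rewrite normcM normc_prod big1 ?mulr1// => k _; exact: xU.
Qed.

Lemma unimodular1 : @unimodular R m n (fun _ _ => 1).
Proof. by move=> k l; exact: normc1. Qed.

Lemma knob_sup_ub a x : unimodular x ->
  normc (rotated_sum a x) <= knob_sup a.
Proof.
move=> xU; apply: ub_le_sup; last by exists x.
by exists (\sum_j normc (a j)) => _ [y yU <-]; exact: normc_rotated_sum.
Qed.

Lemma knob_sup_lip a b :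
  knob_sup a <= knob_sup b + \sum_j normc (a j - b j).
Proof.
apply: ge_sup => [|_ [x xU <-]].
  by eexists; exists (fun _ _ => 1); first exact: unimodular1.
have -> : rotated_sum a x = rotated_sum b x + rotated_sum (fun j => a j - b j) x.
  by rewrite /rotated_sum -big_split; apply: eq_bigr => j _; rewrite /= -mulrDl subrKC.
apply: le_trans (le_normcD _ _) _; apply: lerD; first exact: knob_sup_ub.
exact: normc_rotated_sum.
Qed.

Definition phase_pattern (t : multi_index n -> R) (j : multi_index n) : R[i] :=
  (cos (t j) +i* sin (t j))%C.

Lemma phase_patternP t : is_pattern (phase_pattern t).
Proof. by move=> j; rewrite /normc /phase_pattern cos2Dsin2 sqrtr1. Qed.

Lemma pattern_phase a : is_pattern a ->
  exists2 t, (forall j, `[- pi, pi]%classic (t j)) & phase_pattern t = a.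
Proof.
move=> aP.
have H j : exists u : R, `[- pi, pi]%classic u /\ (cos u +i* sin u)%C = a j.
  move: (aP j); rewrite /normc; case: (a j) => u v /= uv.
  have {}uv : u ^+ 2 + v ^+ 2 = 1.
    by rewrite -[LHS]sqr_sqrtr ?uv ?expr1n// addr_ge0// sqr_ge0.
  have u1 : -1 <= u <= 1.
    by rewrite -ler_norml -(@expr_le1 _ 2)// real_normK ?num_real// -uv lerDl sqr_ge0.
  have sv : sin (acos u) = `|v|.
    by rewrite sin_acos// -uv addrAC subrr add0r sqrtr_sqr.
  have a0 : 0 <= acos u by apply: acos_ge0.
  have api : acos u <= pi by apply: acos_lepi.
  have [v0|v0] := leP 0 v.
    exists (acos u); split; last by rewrite acosK// sv ger0_norm.
    by rewrite /= in_itv /= api andbT (le_trans _ a0)// oppr_le0 pi_ge0.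
  exists (- acos u); split; last by rewrite cosN sinN acosK// sv ltr0_norm// opprK.
  by rewrite /= in_itv /= lerN2 api (le_trans _ (pi_ge0 R))// oppr_le0.
have [t tP] := choice H; exists t => [j|]; first by have [] := tP j.
by apply/funext => j; have [_] := tP j.
Qed.

Lemma cvg_dist_squeeze (T : Type) (F : set_system T) (f D : T -> R) (l : R) :
  Filter F -> (forall u, `|l - f u| <= D u) -> D @ F --> (0 : R) -> f @ F --> l.
Proof.
move=> FF fD D0; apply/cvgrPdist_lt => e e0.
apply: (filterS _ (cvgr0_norm_lt _ D0 e e0)) => u h.
exact: le_lt_trans (fD u) (le_lt_trans (ler_norm _) h).
Qed.

Lemma knob_sup_phase_continuous :
  continuous (fun t : prod_topology (fun _ : multi_index n => R) =>
    knob_sup (phase_pattern t)).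
Proof.
move=> t.
pose D (u : prod_topology (fun _ : multi_index n => R)) : R := \sum_j (`|cos (t j) - cos (u j)| + `|sin (t j) - sin (u j)|).
have D0 : D t = 0 by apply: big1 => j _; rewrite !subrr normr0 addr0.
have cD : D u @[u --> t] --> (0 : R).
  suff : D u @[u --> t] --> D t by rewrite D0.
  apply: (@cvg_big R _ +%R 0 predT (@add_continuous R) _ (nbhs t)) => j _.
  have pj : (fun u : prod_topology (fun _ : multi_index n => R) => u j) @ t --> t j.
    exact: (@proj_continuous _ (fun _ => R) j t).
  apply: cvgD; apply: cvg_norm; apply: cvgB; try exact: cvg_cst.
    exact: (cvg_comp _ _ pj (@continuous_cos R (t j))).
  exact: (cvg_comp _ _ pj (@continuous_sin R (t j))).
have nD (a b : R) : normc (a +i* b)%C <= `|a| + `|b|.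
  rewrite /normc /= -(@ler_pXn2r _ 2) ?nnegrE ?sqrtr_ge0 ?addr_ge0//.
  rewrite sqr_sqrtr ?addr_ge0 ?sqr_ge0// sqrrD !real_normK ?num_real//.
  by rewrite addrAC lerDl mulrn_wge0// mulr_ge0.
have bD u : `|knob_sup (phase_pattern t) - knob_sup (phase_pattern u)| <= D u.
  rewrite ler_norml lerBlDr lerNl opprB lerBlDr ![D u + _]addrC; apply/andP; split.
    apply: le_trans (knob_sup_lip _ (phase_pattern t)) _; rewrite lerD2l.
    apply: ler_sum => j _; apply: le_trans (nD _ _) _.
    by rewrite [`|cos (t j) - _|]distrC [`|sin (t j) - _|]distrC.
  apply: le_trans (knob_sup_lip _ (phase_pattern u)) _; rewrite lerD2l.
  by apply: ler_sum => j _; apply: nD.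
exact: (cvg_dist_squeeze (nbhs_filter t) bD cD).
Qed.

Lemma G1_attained : exists2 a : multi_index n -> R[i],
  is_pattern a & knob_sup a = G1 R n /\
    forall b, is_pattern b -> knob_sup a <= knob_sup b.
Proof.
pose K : set (prod_topology (fun _ : multi_index n => R)) :=
  [set t | forall j, `[- pi, pi]%classic (t j)].
have cK : compact K.
  apply: (@tychonoff _ (fun=> R) (fun=> `[- pi, pi]%classic)) => j.
  exact: segment_compact.
have [||t tK tmin] := @compact_EVT_min _ R
    (fun t : prod_topology (fun _ : multi_index n => R) =>
       knob_sup (phase_pattern t)) K _ cK.
- by exists (fun=> 0) => j; rewrite /= in_itv /= oppr_le0 pi_ge0.
- by apply: continuous_subspaceT; exact: knob_sup_phase_continuous.
have amin b : is_pattern b -> knob_sup (phase_pattern t) <= knob_sup b.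
  by move=> /pattern_phase[u uK <-]; apply: tmin; rewrite inE.
exists (phase_pattern t); first exact: phase_patternP.
split=> //; apply/eqP; rewrite eq_le; apply/andP; split.
  apply: lb_le_inf => [|_ [b bP <-]]; last exact: amin.
  by eexists; exists (phase_pattern t); first exact: phase_patternP.
apply: ge_inf; last by exists (phase_pattern t) => //; exact: phase_patternP.
by exists (knob_sup (phase_pattern t)) => _ [b bP <-]; exact: amin.
Qed.

End Attained.

(* Main.v *)
Require Import Defs.
From mathcomp Require Import all_boot all_order all_algebra.
From mathcomp Require Import complex ring lra.
From mathcomp Require Import all_classical all_reals all_analysis.
Import Order.TTheory GRing.Theory Num.Theory.
Import numFieldNormedType.Exports.
Import complex.ComplexField.Normc.
Set Implicit Arguments.
Unset Strict Implicit.
Unset Printing Implicit Defensive.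
Local Open Scope ring_scope.

(** Both bounds come from contracting the array of coefficients one coordinate
at a time.

Lower bound. For complex numbers [b_1, ..., b_n] there is a choice of unimodular
[x_j] that turns their sum into a number of modulus about
[sqrt pi / 2 * n^(-1/2) * (|b_1| + ... + |b_n|)], and one choice serves a whole
finite family of rows [b] at once, when the moduli of the results are added up
([khinchin_choice]). Using it for all coordinates except one, and aligning the
phases for the last one, gives the bound ([knob_sup_ge_const]); the last
coordinate is the one with the largest [n_k].

The choice is made at random, the [x_j] being independent and uniform among the
[N]-th roots of unity, [N] large. By convexity equal moduli are the worst case
([equal_weights_worst]), so that all rests on the mean distance [e_n] from the
origin of a random walk with [n] unit steps in the plane:
[e_n >= sqrt (pi * n) / 2] ([mean_dist_ge]). The right hand side is the value for
a Gaussian vector of the same variance, and [e_n / sqrt n] tends to [sqrt pi / 2],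
so no room is left. Since [|X| * (pi / 2)] is the integral of
[(1 - cos (X * t)) / t^2] over the half-line, [e_n] is the integral of
[(1 - J^n) / t^2], where [J] is the Bessel function [J0], the characteristic
function of one step; the Gaussian value is the integral of [(1 - A^n) / t^2]
with [A t = exp (- t^2 / 4)]. One has [0 <= J <= A] and [A >= q] for [t <= c],
and [|J| <= q] for [t >= c], with [c = 183/100] and [q = 43/100]
([bessel_near], [bessel_far]; the latter because the energy [J^2 + J'^2]
decreases). Hence [A^n - J^n >= q^(n-2) * (A^2 - J^2 - A^2 * 1_(t >= c))], and
the inequality for [n] steps follows from the one for two steps, whose mean
distance [4 / pi] is explicit and exceeds [sqrt (2 * pi) / 2] by more than the
integral of [A^2 / t^2] beyond [c] ([transfer], [slack_gt0]).

Averages over the roots of unity are finite sums, so they commute with the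
integral over [t]; the price is that [J] is replaced by a quadrature of [J0],
which satisfies the same Taylor bounds exactly and Bessel's equation up to an
error that vanishes as [N] grows.

Upper bound. Sort the coordinates by increasing [n_k] and couple consecutive ones
[k], [k'] by the entries [exp (2 * pi * i * j_k * j_k' / n_k')] of a finite Fourier
matrix. Contracting along this order, each step multiplies the l2-norm by at most
[sqrt n_k'], and the Cauchy-Schwarz inequality handles the last sum
([chain_prefix], [chain_bound]). The quotient equals 1 when all [n_k] are 1, so
the bound 1 is sharp. *)

(** * Derivatives, Taylor bounds and a bound on pi *)

Section Derivation.
Variable R : realType.
Implicit Types (f g : R -> R) (a b x y t : R).

(** A plain copy of [is_derive]: the latter is a type class, and instance
search would interfere with the syntax-directed rules below. *)
Definition drv f x (a : R) : Prop := is_derive x 1 f a.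

Lemma drv_eq f x (a b : R) : drv f x a -> a = b -> drv f x b.
Proof. by move=> h <-. Qed.

Lemma drv_derivable f x (a : R) : drv f x a -> derivable f x 1.
Proof. by case. Qed.

Lemma drv_cst c x : drv (fun=> c) x 0.
Proof. exact: is_derive_cst. Qed.

Lemma drv_id x : drv (fun t => t) x 1.
Proof. exact: is_derive_id. Qed.

Lemma drvD f g x (a b : R) : drv f x a -> drv g x b ->
  drv (fun t => f t + g t) x (a + b).
Proof. by move=> hf hg; exact: (@is_deriveD _ _ _ f g). Qed.

Lemma drvN f x (a : R) : drv f x a -> drv (fun t => - f t) x (- a).
Proof. by move=> hf; exact: (@is_deriveN _ _ _ f). Qed.

Lemma drvM f g x (a b : R) : drv f x a -> drv g x b ->
  drv (fun t => f t * g t) x (f x * b + g x * a).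
Proof. by move=> hf hg; exact: (@is_deriveM _ _ f g). Qed.

Lemma drvX f n x (a : R) : drv f x a ->
  drv (fun t => f t ^+ n) x (n%:R * f x ^+ n.-1 * a).
Proof.
move=> h; rewrite /drv.
have -> : (fun t => f t ^+ n) = f ^+ n by apply/funext => t; rewrite !fctE.
exact: is_deriveX.
Qed.

Lemma drvV f x (a : R) : f x != 0 -> drv f x a ->
  drv (fun t => (f t)^-1) x (- f x ^- 2 * a).
Proof. by move=> f0 hf; exact: is_deriveV. Qed.

Lemma drv_comp f g x (a b : R) : drv f (g x) b -> drv g x a ->
  drv (fun t => f (g t)) x (b * a).
Proof. by move=> hf hg; exact: is_derive1_comp. Qed.

Lemma drv_sin f x (a : R) : drv f x a -> drv (fun t => sin (f t)) x (cos (f x) * a).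
Proof. by apply: drv_comp; exact: is_derive_sin. Qed.

Lemma drv_cos f x (a : R) : drv f x a -> drv (fun t => cos (f t)) x (- sin (f x) * a).
Proof. by apply: drv_comp; exact: is_derive_cos. Qed.

Lemma drv_expR f x (a : R) : drv f x a -> drv (fun t => expR (f t)) x (expR (f x) * a).
Proof. by apply: drv_comp; exact: is_derive_expR. Qed.

Lemma drv_sum (I : Type) (r : seq I) (F : I -> R -> R) (dF : I -> R) x :
  (forall i, drv (F i) x (dF i)) ->
  drv (fun y => \sum_(i <- r) F i y) x (\sum_(i <- r) dF i).
Proof.
move=> h; elim: r => [|i r IH].
  rewrite /drv big_nil (_ : (fun y => _) = cst 0); first exact: is_derive_cst.
  by apply/funext => y; rewrite big_nil.
rewrite /drv big_cons (_ : (fun y => _) = (fun y => F i y + \sum_(i <- r) F i y)).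
  exact: drvD.
by apply/funext => y; rewrite big_cons.
Qed.

End Derivation.

(** Computes a derivative from the syntax of the function. *)
Ltac drv := repeat first [ apply: drv_cst | apply: drv_id | eassumption
  | apply: drv_sin | apply: drv_cos | apply: drv_expR | apply: drvX | apply: drvV
  | apply: drvN | apply: drvM | apply: drvD | apply: drv_sum => ? ].

Section Taylor.
Variable R : realType.
Implicit Types (f g : R -> R) (a b x y t : R).

Lemma ler_of_derive f g (f' g' : R -> R) a b :
  a <= b ->
  (forall x, a <= x <= b -> drv f x (f' x)) ->
  (forall x, a <= x <= b -> drv g x (g' x)) ->
  (forall x, a <= x <= b -> f' x <= g' x) ->
  f b - f a <= g b - g a.
Proof.
move=> ab df dg fg.
have dh x : a <= x <= b -> is_derive x 1 (g - f) (g' x - f' x).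
  by move=> xab; have hf := df x xab; have hg := dg x xab; exact: is_deriveB.
have : exists2 c, c \in `[a, b] & (g - f) b - (g - f) a = (g' c - f' c) * (b - a).
  apply: (@MVT_segment R (g - f) (fun x => g' x - f' x)) => //.
    by move=> x; rewrite in_itv/= => /andP[ax xb]; apply: dh; rewrite !ltW.
  apply: derivable_within_continuous => x; rewrite in_itv/= => xab.
  by have [] := dh x xab.
case=> c; rewrite in_itv/= => cab /= e.
have : 0 <= (g' c - f' c) * (b - a) by rewrite mulr_ge0// subr_ge0// fg.
by rewrite -e !fctE; lra.
Qed.

Definition cos_taylor m y : R := \sum_(k <- iota 0 m) (-1) ^+ k / (k.*2)`!%:R * y ^+ k.*2.
Definition sin_taylor m y : R := \sum_(k <- iota 0 m) (-1) ^+ k / (k.*2.+1)`!%:R * y ^+ k.*2.+1.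

Lemma drv_sin_taylor m x : drv (sin_taylor m) x (cos_taylor m x).
Proof.
apply: drv_eq; first by rewrite /sin_taylor; drv.
apply: eq_bigr => k _; rewrite factS natrM /=.
have ? : (k.*2)`!%:R != 0 :> R by rewrite pnatr_eq0 -lt0n fact_gt0.
have ? : (k.*2.+1)%:R != 0 :> R by rewrite pnatr_eq0.
by rewrite mulr0 addr0 mulr1; field; apply/andP.
Qed.

Lemma cos_taylorS m y :
  cos_taylor m.+1 y = 1 - \sum_(k <- iota 0 m) (-1) ^+ k / (k.*2.+2)`!%:R * y ^+ k.*2.+2.
Proof.
rewrite /cos_taylor /= big_cons /= fact0 expr0 divr1 mul1r; congr (_ + _).
rewrite (iotaDl 1 0 m) big_map -sumrN; apply: eq_bigr => k _.
by rewrite add1n exprS doubleS !mulN1r !mulNr.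
Qed.

Lemma cos_taylor0 m : cos_taylor m.+1 0 = 1.
Proof. by rewrite cos_taylorS big1 ?subr0// => k _; rewrite expr0n mulr0. Qed.

Lemma sin_taylor0 m : sin_taylor m 0 = 0.
Proof. by rewrite /sin_taylor big1// => k _; rewrite expr0n mulr0. Qed.

Lemma drv_cos_taylor m x : drv (cos_taylor m.+1) x (- sin_taylor m x).
Proof.
have -> : cos_taylor m.+1 = (fun y => 1 -
    \sum_(k <- iota 0 m) (-1) ^+ k / (k.*2.+2)`!%:R * y ^+ k.*2.+2).
  by apply/funext => y; rewrite cos_taylorS.
apply: drv_eq; first by drv.
rewrite add0r; congr (- _); apply: eq_bigr => k _; rewrite (factS k.*2.+1) natrM /=.
have ? : (k.*2.+1)`!%:R != 0 :> R by rewrite pnatr_eq0 -lt0n fact_gt0.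
have ? : (k.*2.+2)%:R != 0 :> R by rewrite pnatr_eq0.
by rewrite mulr0 addr0 mulr1; field; apply/andP.
Qed.

Lemma ge0_of_derive f (f' : R -> R) y : 0 <= y -> f 0 = 0 ->
  (forall x, 0 <= x <= y -> drv f x (f' x)) ->
  (forall x, 0 <= x <= y -> 0 <= f' x) -> 0 <= f y.
Proof.
move=> y0 f0 df f'0.
have := @ler_of_derive (cst 0) f (fun=> 0) f' 0 y y0.
by rewrite f0 !subr0; apply => // x _; exact: drv_cst.
Qed.

(** The partial sums of the Taylor series of [cos] and [sin] lie alternately above
and below: each sign follows from the previous one by integrating from 0. *)
Lemma cos_sin_taylor_sign m y : 0 <= y ->
  (0 <= (-1) ^+ m.+1 * (cos y - cos_taylor m.+1 y)) /\
  (0 <= (-1) ^+ m.+1 * (sin y - sin_taylor m.+1 y)).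
Proof.
have hs k z : 0 <= z ->
    (forall x, 0 <= x -> 0 <= (-1) ^+ k * (cos x - cos_taylor k x)) ->
    0 <= (-1) ^+ k * (sin z - sin_taylor k z).
  move=> z0 hc.
  apply: (@ge0_of_derive (fun z => (-1) ^+ k * (sin z - sin_taylor k z))
    (fun z => (-1) ^+ k * (cos z - cos_taylor k z))) => // [|x _|x /andP[x0 _]].
  - by rewrite sin0 sin_taylor0 subrr mulr0.
  - have ? := drv_sin_taylor k x.
    by apply: drv_eq; [drv|rewrite mulr0 addr0 mulr1].
  - exact: hc.
elim: m y => [|m IH] y y0.
  have hc x : 0 <= (-1) ^+ 1 * (cos x - cos_taylor 1 x).
    by rewrite expr1 mulN1r oppr_ge0 cos_taylorS big_nil subr0 subr_le0 cos_le1.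
  by split=> //; apply: hs.
have hc z : 0 <= z -> 0 <= (-1) ^+ m.+2 * (cos z - cos_taylor m.+2 z).
  move=> z0.
  apply: (@ge0_of_derive (fun z => (-1) ^+ m.+2 * (cos z - cos_taylor m.+2 z))
    (fun z => (-1) ^+ m.+2 * (- sin z - - sin_taylor m.+1 z))) => // [|x _|x /andP[x0 _]].
  - by rewrite cos0 cos_taylor0 subrr mulr0.
  - have ? := drv_cos_taylor m.+1 x.
    by apply: drv_eq; [drv|rewrite mulr0 addr0 mulr1].
  - have [_] := IH x x0; rewrite (exprS _ m.+1) mulN1r => h.
    by rewrite mulNr -mulrN opprB opprK addrC.
by split; [exact: hc | exact: hs].
Qed.

Lemma cos_taylorN m y : cos_taylor m (- y) = cos_taylor m y.
Proof. by apply: eq_bigr => k _; rewrite -!muln2 mulnC !exprM sqrrN. Qed.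

Lemma cos_taylor_sign m y : 0 <= (-1) ^+ m.+1 * (cos y - cos_taylor m.+1 y).
Proof.
have [y0|y0] := leP 0 y; first by have [] := cos_sin_taylor_sign m y0.
have [] := @cos_sin_taylor_sign m (- y); first by rewrite oppr_ge0 ltW.
by rewrite cosN cos_taylorN.
Qed.

Lemma mul_sin_taylor_sign m y :
  0 <= (-1) ^+ m.+1 * (y * sin y - y * sin_taylor m.+1 y).
Proof.
suff h z : 0 <= z -> 0 <= (-1) ^+ m.+1 * (z * sin z - z * sin_taylor m.+1 z).
  have [y0|y0] := leP 0 y; first exact: h.
  have := h (- y); rewrite oppr_ge0 => /(_ (ltW y0)).
  rewrite sinN (_ : sin_taylor m.+1 (- y) = - sin_taylor m.+1 y) ?mulrNN//.
  rewrite -sumrN; apply: eq_bigr => k _.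
  by rewrite !exprS mulNr mulrN -!muln2 mulnC !exprM sqrrN.
move=> z0; rewrite -mulrBr mulrCA mulr_ge0//.
by have [] := cos_sin_taylor_sign m z0.
Qed.

Lemma cos_le4 y : cos y <= 1 - y ^+ 2 / 2 + y ^+ 4 / 24.
Proof.
have := cos_taylor_sign 2 y; rewrite /cos_taylor /= !big_cons big_nil /= !factS fact0 !natrM.
by rewrite !mulr1n; lra.
Qed.

Lemma cos_ge6 y : 1 - y ^+ 2 / 2 + y ^+ 4 / 24 - y ^+ 6 / 720 <= cos y.
Proof.
have := cos_taylor_sign 3 y; rewrite /cos_taylor /= !big_cons big_nil /= !factS fact0 !natrM.
by rewrite !mulr1n; lra.
Qed.

Lemma cos_ge10 y : 1 - y ^+ 2 / 2 + y ^+ 4 / 24 - y ^+ 6 / 720 + y ^+ 8 / (56 * 720)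
   - y ^+ 10 / (90 * 56 * 720) <= cos y.
Proof.
have := cos_taylor_sign 5 y; rewrite /cos_taylor /= !big_cons big_nil /= !factS fact0 !natrM.
by rewrite !mulr1n; lra.
Qed.

Lemma cos_le8 y : cos y <= 1 - y ^+ 2 / 2 + y ^+ 4 / 24 - y ^+ 6 / 720 + y ^+ 8 / (56 * 720).
Proof.
have := cos_taylor_sign 4 y; rewrite /cos_taylor /= !big_cons big_nil /= !factS fact0 !natrM.
by rewrite !mulr1n; lra.
Qed.

Lemma mul_sin_le10 y : y * sin y <=
  y ^+ 2 - y ^+ 4 / 6 + y ^+ 6 / 120 - y ^+ 8 / (7 * 720) + y ^+ 10 / (504 * 720).
Proof.
have := mul_sin_taylor_sign 4 y.
have -> : y * sin_taylor 5 y =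
    y ^+ 2 - y ^+ 4 / 6 + y ^+ 6 / 120 - y ^+ 8 / (7 * 720) + y ^+ 10 / (504 * 720).
  set rhs := RHS.
  rewrite /sin_taylor /= !big_cons big_nil -[0.*2]/0%N -[1.*2]/2%N -[2.*2]/4%N.
  rewrite -[3.*2]/6%N -[4.*2]/8%N !factS fact0 !natrM /rhs.
  by field.
by lra.
Qed.

Lemma mul_sin_ge8 y :
  y ^+ 2 - y ^+ 4 / 6 + y ^+ 6 / 120 - y ^+ 8 / (7 * 720) <= y * sin y.
Proof.
have := mul_sin_taylor_sign 3 y.
have -> : y * sin_taylor 4 y =
    y ^+ 2 - y ^+ 4 / 6 + y ^+ 6 / 120 - y ^+ 8 / (7 * 720).
  set rhs := RHS.
  rewrite /sin_taylor /= !big_cons big_nil -[0.*2]/0%N -[1.*2]/2%N -[2.*2]/4%N.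
  rewrite -[3.*2]/6%N !factS fact0 !natrM /rhs.
  by field.
by lra.
Qed.

Lemma sin_le y : 0 <= y -> sin y <= y.
Proof.
move=> y0; have [_] := cos_sin_taylor_sign 0 y0.
rewrite /sin_taylor /= !big_cons big_nil -[0.*2]/0%N !factS fact0 mulr1n.
by rewrite expr0 !expr1; lra.
Qed.

Lemma sin_ge y : 0 <= y -> y - y ^+ 3 / 6 <= sin y.
Proof.
move=> y0; have [_] := cos_sin_taylor_sign 1 y0.
rewrite /sin_taylor /= !big_cons big_nil -[0.*2]/0%N -[1.*2]/2%N !factS fact0 !natrM.
by rewrite expr0 !expr1; lra.
Qed.

(** At [11 / 7] the Taylor polynomial of degree 8, hence the cosine, is negative. *)
Lemma pi_lt : pi < 22 / 7 :> R.
Proof.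
have h : cos (11 / 7 : R) < 0 by apply: le_lt_trans (cos_le8 _) _; lra.
rewrite ltNge; apply/negP => h2.
have : 0 <= cos (11 / 7 : R) by apply: cos_ge0_pihalf; lra.
by rewrite leNgt h.
Qed.

Lemma expRN_ge3 y : 0 <= y -> 1 - y + y ^+ 2 / 2 - y ^+ 3 / 6 <= expR (- y) :> R.
Proof.
move=> y0.
have h1 (z : R) : 0 <= z -> 0 <= expR (- z) - 1 + z.
  by move=> z0; have := expR_ge1Dx (- z); lra.
have h2 (z : R) : 0 <= z -> 0 <= 1 - z + z ^+ 2 / 2 - expR (- z).
  move=> z0; have := @ge0_of_derive (fun z => 1 - z + z ^+ 2 / 2 - expR (- z))
    (fun z => expR (- z) - 1 + z) z; apply => //.
  - by rewrite oppr0 expR0; lra.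
  - by move=> x _; apply: drv_eq; [drv|rewrite /=; field].
  - by move=> x /andP[x0 _]; exact: h1.
rewrite -subr_ge0; have := @ge0_of_derive
   (fun y => expR (- y) - (1 - y + y ^+ 2 / 2 - y ^+ 3 / 6))
   (fun z => 1 - z + z ^+ 2 / 2 - expR (- z)) y; apply => //.
- by rewrite oppr0 expR0; lra.
- by move=> x _; apply: drv_eq; [drv|rewrite /=; field].
- by move=> x /andP[x0 _]; exact: h2.
Qed.

Lemma expRN_le4 y : 0 <= y ->
  expR (- y) <= 1 - y + y ^+ 2 / 2 - y ^+ 3 / 6 + y ^+ 4 / 24 :> R.
Proof.
move=> y0; rewrite -subr_ge0; have := @ge0_of_derive
   (fun y => 1 - y + y ^+ 2 / 2 - y ^+ 3 / 6 + y ^+ 4 / 24 - expR (- y))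
   (fun y => expR (- y) - (1 - y + y ^+ 2 / 2 - y ^+ 3 / 6)) y; apply => //.
- by rewrite oppr0 expR0; lra.
- by move=> x _; apply: drv_eq; [drv|rewrite /=; field].
- by move=> x /andP[x0 _]; rewrite subr_ge0; exact: expRN_ge3.
Qed.

End Taylor.

(** * Fejer kernels and the integral of (1 - cos) / t^2 *)

Section Integral.
Local Open Scope classical_set_scope.
Variable R : realType.
Implicit Types (f g F : R -> R) (a b c x y t v w X : R).

Definition derivable_on a b f := forall x, a <= x <= b -> derivable f x 1.

Definition integ a b f : R := \int[lebesgue_measure]_(x in `[a, b]) f x.

Lemma derivable_on_integrable a b f : derivable_on a b f ->
  lebesgue_measure.-integrable `[a, b] (EFin \o f).
Proof.
move=> df; apply: continuous_compact_integrable; first exact: segment_compact.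
by apply: derivable_within_continuous => x; rewrite in_itv/=; exact: df.
Qed.

Lemma integD a b f g : derivable_on a b f -> derivable_on a b g ->
  integ a b (fun x => f x + g x) = integ a b f + integ a b g.
Proof. by move=> df dg; rewrite /integ RintegralD//; exact: derivable_on_integrable. Qed.

Lemma integB a b f g : derivable_on a b f -> derivable_on a b g ->
  integ a b (fun x => f x - g x) = integ a b f - integ a b g.
Proof. by move=> df dg; rewrite /integ RintegralB//; exact: derivable_on_integrable. Qed.

Lemma integZ a b f c : derivable_on a b f ->
  integ a b (fun x => c * f x) = c * integ a b f.
Proof. by move=> df; rewrite /integ RintegralZl//; exact: derivable_on_integrable. Qed.

Lemma le_integ a b f g : derivable_on a b f -> derivable_on a b g ->
  (forall x, a <= x <= b -> f x <= g x) -> integ a b f <= integ a b g.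
Proof.
move=> df dg fg; apply: le_Rintegral => //; try exact: derivable_on_integrable.
Qed.

Lemma integ_ge0 a b f : (forall x, a <= x <= b -> 0 <= f x) -> 0 <= integ a b f.
Proof. by move=> f0; apply: Rintegral_ge0 => x /=; rewrite in_itv/=; exact: f0. Qed.

Lemma eq_integ a b f g : (forall x, a <= x <= b -> f x = g x) -> integ a b f = integ a b g.
Proof.
by move=> fg; apply: eq_Rintegral => x; rewrite inE/= in_itv/=; exact: fg.
Qed.

Lemma integ_split a b c f : a <= b <= c -> derivable_on a c f ->
  integ a c f = integ a b f + integ b c f.
Proof.
move=> /andP[ab bc] df; apply/eqP; rewrite addrC -subr_eq; apply/eqP.
have H := derivable_on_integrable df.
rewrite /integ (Rintegral_itvB H) ?bnd_simp//.
rewrite Rintegral_itv_obnd_cbnd//; apply: integrableS H => //.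
by apply: subset_itvr; rewrite bnd_simp.
Qed.

Lemma integ_sum (I : Type) (r : seq I) (F : I -> R -> R) a b :
  (forall i, derivable_on a b (F i)) ->
  derivable_on a b (fun x => \sum_(i <- r) F i x) /\
  integ a b (fun x => \sum_(i <- r) F i x) = \sum_(i <- r) integ a b (F i).
Proof.
move=> dF.
have dS s : derivable_on a b (fun x => \sum_(i <- s) F i x).
  move=> x xab.
  have := @drv_sum R I s F (fun i => 'D_1 (F i) x) x.
  by case=> // i; apply: derivableP; exact: dF.
split=> //; elim: r => [|i r IH].
  rewrite big_nil /integ (@eq_Rintegral _ _ _ _ _ (fun=> 0)) ?Rintegral_cst ?mul0r//.
  by move=> x _; rewrite big_nil.
rewrite big_cons -IH -integD//; apply: eq_integ => x _; by rewrite big_cons.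
Qed.

Lemma FTC a b f F : a <= b -> derivable_on a b f ->
  (forall x, a <= x <= b -> drv F x (f x)) ->
  integ a b f = F b - F a.
Proof.
rewrite le_eqVlt => /predU1P[<-|ab] df dF.
  by rewrite subrr /integ set_itv1 Rintegral_set1.
have cF x : a <= x <= b -> {for x, continuous F}.
  by move=> /dF[dx _]; apply: differentiable_continuous; apply/derivable1_diffP.
rewrite /integ /Rintegral (@continuous_FTC2 _ f F)//.
- by apply: derivable_within_continuous => x; rewrite in_itv/=; exact: df.
- split; first by move=> x; rewrite in_itv/= => /andP[ax xb]; have [] := dF x; rewrite ?ltW.
    by apply: cvg_at_right_filter; apply: cF; rewrite lexx ltW.
  by apply: cvg_at_left_filter; apply: cF; rewrite lexx ltW.
- move=> x; rewrite in_itv/= => /andP[ax xb]; rewrite derive1E.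
  have xab : a <= x <= b by rewrite !ltW.
  by have [_ ->] := dF x xab.
Qed.

(** The quotients [sin ((2 * p + 1) * v) / sin v] and [sin (p * v)^2 / sin v^2],
written as trigonometric polynomials: this makes sense at 0 and gives explicit
primitives. *)
Fixpoint dirichlet p v : R :=
  if p is p'.+1 then dirichlet p' v + 2 * cos (2 * p'.+1%:R * v) else 1.

Fixpoint fejer p v : R :=
  if p is p'.+1 then fejer p' v + dirichlet p' v else 0.

Fixpoint prim_dirichlet p v : R :=
  if p is p'.+1 then prim_dirichlet p' v + sin (2 * p'.+1%:R * v) / p'.+1%:R else v.

Fixpoint prim_fejer p v : R :=
  if p is p'.+1 then prim_fejer p' v + prim_dirichlet p' v else 0.

Lemma sin_dirichlet p v : sin v * dirichlet p v = sin ((2 * p%:R + 1) * v).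
Proof.
elim: p => [|p IH] /=; first by rewrite mulr1 mulr0 add0r mul1r.
rewrite mulrDr IH -[p.+1%:R]natr1.
have -> : (2 * p%:R + 1) * v = 2 * (p%:R + 1) * v - v by ring.
have -> : (2 * (p%:R + 1) + 1) * v = 2 * (p%:R + 1) * v + v by ring.
by rewrite sinB sinD; ring.
Qed.

Lemma sin_fejer p v : sin v ^+ 2 * fejer p v = sin (p%:R * v) ^+ 2.
Proof.
elim: p => [|p IH] /=; first by rewrite mulr0 mul0r sin0 expr0n.
rewrite mulrDr IH expr2 -(mulrA (sin v)) sin_dirichlet -[p.+1%:R]natr1.
have -> : (2 * p%:R + 1) * v = p%:R * v + (p%:R * v + v) by ring.
rewrite (_ : (p%:R + 1) * v = p%:R * v + v); last by ring.
set x := p%:R * v.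
have hv := cos2Dsin2 v.
rewrite sinD sinD cosD.
have ev : cos v ^+ 2 = 1 - sin v ^+ 2 by rewrite -hv addrK.
have -> : sin x ^+ 2 +
    sin v * (sin x * (cos x * cos v - sin x * sin v) +
    cos x * (sin x * cos v + cos x * sin v)) =
  sin x ^+ 2 + 2 * sin v * sin x * cos x * cos v - sin x ^+ 2 * sin v ^+ 2 + cos x ^+ 2 * sin v ^+ 2.
  by ring.
have -> : (sin x * cos v + cos x * sin v) ^+ 2 =
   sin x ^+ 2 * cos v ^+ 2 + 2 * sin v * sin x * cos x * cos v + cos x ^+ 2 * sin v ^+ 2 by ring.
by rewrite ev; ring.
Qed.

Lemma drv_prim_dirichlet p v : drv (prim_dirichlet p) v (dirichlet p v).
Proof.
elim: p => [|p IH]; first exact: drv_id.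
have p0 : p.+1%:R != 0 :> R by rewrite pnatr_eq0.
by apply: drv_eq => /=; [drv | rewrite /=; field].
Qed.

Lemma drv_prim_fejer p v : drv (prim_fejer p) v (fejer p v).
Proof.
elim: p => [|p IH]; first exact: drv_cst.
by have h := drv_prim_dirichlet p v; apply: drvD.
Qed.

Lemma drv_dirichlet p v : exists d, drv (dirichlet p) v d.
Proof.
elim: p => [|p [d IH]]; first by exists 0; exact: drv_cst.
by eexists; rewrite /=; drv.
Qed.

Lemma drv_fejer p v : exists d, drv (fejer p) v d.
Proof.
elim: p => [|p [d IH]]; first by exists 0; exact: drv_cst.
by have [e h] := drv_dirichlet p v; eexists; apply: drvD; eassumption.
Qed.

Lemma sin_pi_nat k : sin (k%:R * pi) = 0 :> R.
Proof.
elim: k => [|k IH]; first by rewrite mul0r sin0.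
by rewrite -natr1 mulrDl mul1r sinDpi IH oppr0.
Qed.

Lemma prim_fejer_pihalf p : prim_fejer p (pi / 2) = p%:R * (pi / 2).
Proof.
have hD k : prim_dirichlet k (pi / 2) = pi / 2.
  elim: k => //= k ->; rewrite (_ : 2 * _ * _ = k.+1%:R * pi); last by field.
  by rewrite sin_pi_nat mul0r addr0.
elim: p => [|p IH] /=; first by rewrite mul0r.
by rewrite IH hD -[p.+1%:R]natr1; ring.
Qed.

Lemma prim_fejer0 p : prim_fejer p 0 = 0.
Proof.
have hD k : prim_dirichlet k 0 = 0.
  by elim: k => //= k ->; rewrite mulr0 sin0 mul0r addr0.
by elim: p => //= p ->; rewrite hD addr0.
Qed.

Lemma fejer_le p v : fejer p v <= p%:R ^+ 2.
Proof.
have hD k : dirichlet k v <= 2 * k%:R + 1.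
  elim: k => /= [|k IH]; first by rewrite mulr0 add0r.
  by have := cos_le1 (2 * k.+1%:R * v); rewrite -[k.+1%:R]natr1; lra.
elim: p => [|p IH] /=; first by rewrite expr0n.
have -> : p.+1%:R ^+ 2 = p%:R ^+ 2 + (2 * p%:R + 1) :> R by rewrite -[p.+1%:R]natr1; ring.
exact: lerD.
Qed.

Lemma fejer_ge0 p v : 0 <= v <= pi / 2 -> 0 <= fejer p v.
Proof.
have pi0 := @pi_gt0 R.
move=> /andP[]; rewrite le_eqVlt => /predU1P[<- _|v0 vpi].
  have hD k : 0 <= dirichlet k 0.
    by elim: k => //= k IH; rewrite mulr0 cos0; lra.
  by elim: p => //= p IH; rewrite addr_ge0.
have s0 : 0 < sin v by apply: sin_gt0_pi; apply/andP; split; lra.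
by rewrite -(pmulr_rge0 _ (exprn_gt0 2 s0)) sin_fejer sqr_ge0.
Qed.

Lemma mul_cos_le_sin v : 0 <= v <= pi / 2 -> v * cos v <= sin v.
Proof.
move=> /andP[v0 vpi]; rewrite -subr_ge0.
have := @ge0_of_derive R (fun v : R => sin v - v * cos v) (fun v : R => v * sin v) v.
apply => //.
- by rewrite sin0 mul0r subr0.
- by move=> x _; apply: drv_eq; [drv|rewrite /=; ring].
- move=> x /andP[x0 xv]; rewrite mulr_ge0//; apply: sin_ge0_pi.
  have ? := @pi_gt0 R; apply/andP; split; lra.
Qed.

Lemma prim_fejer_homo p v w : 0 <= v -> v <= w -> w <= pi / 2 ->
  prim_fejer p v <= prim_fejer p w.
Proof.
move=> v0 vw wpi; rewrite -subr_ge0.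
have := @ler_of_derive R (fun=> 0) (prim_fejer p) (fun=> 0) (fejer p) v w vw.
rewrite subrr; apply=> x /andP[vx xw]; first exact: drv_cst.
  exact: drv_prim_fejer.
by apply: fejer_ge0; rewrite (le_trans v0 vx) (le_trans xw wpi).
Qed.

Lemma prim_fejer_le p v : 0 <= v -> prim_fejer p v <= p%:R ^+ 2 * v.
Proof.
move=> v0.
have := @ler_of_derive R (prim_fejer p) (fun x : R => p%:R ^+ 2 * x) (fejer p) (fun=> p%:R ^+ 2) 0 v v0.
rewrite prim_fejer0 mulr0 !subr0; apply=> x _; first exact: drv_prim_fejer.
  by apply: drv_eq; [drv|rewrite /=; ring].
exact: fejer_le.
Qed.

(** [fejer p] is below [1 / sin^2], whose primitive is minus the cotangent. *)
Lemma prim_fejer_ge p v : 0 < v <= pi / 2 -> p%:R * (pi / 2) - v^-1 <= prim_fejer p v.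
Proof.
move=> /andP[v0 vpi].
have pi0 := @pi_gt0 R.
have s0 x : v <= x <= pi / 2 -> 0 < sin x.
  by move=> /andP[vx xpi]; apply: sin_gt0_pi; apply/andP; split; lra.
have := @ler_of_derive R (prim_fejer p) (fun x : R => - (cos x / sin x))
  (fejer p) (fun x : R => (sin x ^+ 2)^-1) v (pi / 2) vpi.
rewrite prim_fejer_pihalf cos_pihalf mul0r oppr0 sub0r opprK => H.
have {}H : p%:R * (pi / 2) - prim_fejer p v <= cos v / sin v.
  apply: H => x /s0 sx; first exact: drv_prim_fejer.
    have hx := cos2Dsin2 x; have sx0 := lt0r_neq0 sx.
    apply: drv_eq; first by drv.
    rewrite [RHS](_ : _ = (cos x ^+ 2 + sin x ^+ 2) / sin x ^+ 2); last first.
      by rewrite hx mul1r.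
    by rewrite /=; field.
  rewrite -(ler_pM2l (exprn_gt0 2 sx)) sin_fejer divff ?expf_neq0 ?lt0r_neq0//.
have sv : 0 < sin v by apply: s0; rewrite lexx.
have : cos v / sin v <= v^-1.
  rewrite ler_pdivrMr// -(ler_pM2l v0) mulrA divff ?mul1r ?lt0r_neq0//.
  by apply: mul_cos_le_sin; rewrite ltW.
lra.
Qed.

Definition cos_kernel X t : R := (1 - cos (X * t)) / t ^+ 2.

Lemma sqr_half_sin x : 1 - cos (2 * x) = 2 * sin x ^+ 2.
Proof.
by rewrite mulr_natl cos_mulr2n; have := cos2Dsin2 x; rewrite mulr2n; lra.
Qed.

Lemma derivable_cos_kernel X a b : 0 < a -> derivable_on a b (cos_kernel X).
Proof.
move=> a0 x /andP[ax _]; have x0 : x != 0 by rewrite gt_eqF// (lt_le_trans a0).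
by apply: drv_derivable; rewrite /cos_kernel; drv; rewrite expf_neq0.
Qed.

(** As [sin v <= v], the integrand is below a Fejer kernel rescaled so that [b]
stays left of a quarter period, over which the integral of the kernel is known. *)
Lemma le_integ_cos_kernel X a b : 0 <= X -> 0 < a <= b ->
  integ a b (cos_kernel X) <= X * (pi / 2).
Proof.
have pi0 := @pi_gt0 R.
move=> X0 /andP[a0 ab].
have b0 : 0 < b by apply: lt_le_trans ab.
have [p p0 pX] : exists2 p : nat, (0 < p)%N & X * b <= p%:R * pi.
  exists (Num.truncn (X * b / pi)).+1 => //.
  by rewrite -ler_pdivrMr// ltW// truncnS_gt.
have pr0 : 0 < p%:R :> R by rewrite ltr0n.
pose c := X / (2 * p%:R).
have c0 : 0 <= c by rewrite divr_ge0// mulr_ge0// ltW.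
have cb : c * b <= pi / 2.
  rewrite /c mulrAC ler_pdivrMr ?mulr_gt0//.
  by rewrite (_ : _ * (2 * _) = p%:R * pi)//; field.
have e : X = 2 * (p%:R * c) by rewrite /c; field; rewrite lt0r_neq0.
clearbody c.
pose g t : R := 2 * c ^+ 2 * fejer p (c * t).
have dg : derivable_on a b g.
  by move=> x _; have [d hd] := drv_fejer p (c * x); apply: drv_derivable; rewrite /g; drv;
   apply: drv_comp; drv.
apply: (@le_trans _ _ (integ a b g)).
  apply: le_integ => //; first exact: derivable_cos_kernel.
  move=> x /andP[ax xb]; have x0 : 0 < x by apply: lt_le_trans ax.
  rewrite /cos_kernel /g [X in cos (X * _)]e -!mulrA sqr_half_sin.
  rewrite ler_pdivrMr ?exprn_gt0//.
  rewrite -sin_fejer.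
  have cx : 0 <= c * x <= pi / 2.
    by rewrite mulr_ge0 ?(ltW x0)//= (le_trans _ cb)// ler_wpM2l.
  have f0 := fejer_ge0 p cx.
  have : sin (c * x) ^+ 2 <= (c * x) ^+ 2.
    rewrite ler_sqr ?nnegrE; last 2 first.
    - by apply: sin_ge0_pi; apply/andP; split; lra.
    - by case/andP: cx.
    by apply: sin_le; case/andP: cx.
  move=> /(ler_wpM2r f0); rewrite exprMn; lra.
rewrite (@FTC a b g (fun t => 2 * c * prim_fejer p (c * t)))//; last first.
  move=> x _; have h := drv_prim_fejer p (c * x); apply: drv_eq.
    by drv; apply: drv_comp; drv.
  by rewrite /g /=; ring.
rewrite -mulrBr e.
rewrite (_ : 2 * (p%:R * c) * (pi / 2) = 2 * c * (p%:R * (pi / 2))); last by ring.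
rewrite -prim_fejer_pihalf ler_wpM2l ?mulr_ge0//.
have h1 : prim_fejer p (c * b) <= prim_fejer p (pi / 2).
  by apply: prim_fejer_homo => //; rewrite mulr_ge0// ltW.
have h2 : 0 <= prim_fejer p (c * a).
  rewrite -(prim_fejer0 p); apply: prim_fejer_homo => //.
    by rewrite mulr_ge0// ltW.
  by apply: le_trans cb; rewrite ler_wpM2l.
by lra.
Qed.

(** The same Fejer kernel is a minorant up to a constant, because
[1 / v^2 >= 1 / sin v^2 - 1]; the error terms account for the two missing ends
of the quarter period and for this constant. *)
Lemma ge_integ_cos_kernel X a b : 0 < X -> 0 < a <= b ->
  X * (pi / 2) - X ^+ 2 * a / 2 - 3 / b <= integ a b (cos_kernel X).
Proof.
have pi0 := @pi_gt0 R.
move=> X0 /andP[a0 ab].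
have b0 : 0 < b by apply: lt_le_trans ab.
have [p p0 pX] : exists2 p : nat, (0 < p)%N & X * b <= p%:R.
  exists (Num.truncn (X * b)).+1 => //; by rewrite ltW// truncnS_gt.
have pr0 : 0 < p%:R :> R by rewrite ltr0n.
pose c := X / (2 * p%:R).
have c0 : 0 < c by rewrite divr_gt0// mulr_gt0.
have pi2 := @pi_ge2 R.
have cb2 : c * b <= 1 / 2.
  rewrite /c mulrAC ler_pdivrMr ?mulr_gt0//; lra.
have cb : c * b <= pi / 2 by lra.
have e : X = 2 * (p%:R * c) by rewrite /c; field; rewrite lt0r_neq0.
clearbody c.
pose g t : R := 2 * c ^+ 2 * fejer p (c * t) - 2 * c ^+ 2.
have dg : derivable_on a b g.
  by move=> x _; have [d hd] := drv_fejer p (c * x); apply: drv_derivable; rewrite /g; drv;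
   apply: drv_comp; drv.
apply: (@le_trans _ _ (integ a b g)); last first.
  apply: le_integ => //; first exact: derivable_cos_kernel.
  move=> x /andP[ax xb]; have x0 : 0 < x by apply: lt_le_trans ax.
  rewrite /cos_kernel /g [X in cos (X * _)]e -!mulrA sqr_half_sin.
  rewrite ler_pdivlMr ?exprn_gt0//.
  have cx : 0 <= c * x <= pi / 2.
    by rewrite mulr_ge0 ?(ltW x0) ?(ltW c0)//= (le_trans _ cb)// ler_wpM2l// ltW.
  have f0 := fejer_ge0 p cx.
  have sv : 0 <= sin (c * x) by case/andP: (cx) => ? ?; apply: sin_ge0_pi; apply/andP; split; lra.
  have h : (c * x) ^+ 2 * (1 - sin (c * x) ^+ 2) <= sin (c * x) ^+ 2.
    rewrite -cos2sin2 -exprMn ler_sqr ?nnegrE//; first exact: mul_cos_le_sin.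
    apply: mulr_ge0; first by case/andP: cx.
    by apply: cos_ge0_pihalf; case/andP: cx => ? ?; apply/andP; split; lra.
  have s1 : sin (p%:R * (c * x)) ^+ 2 <= 1.
    by have := cos2Dsin2 (p%:R * (c * x)); have := sqr_ge0 (cos (p%:R * (c * x))); lra.
  move: h => /(ler_wpM2r f0).
  rewrite mulrBr mulr1 mulrBl -(mulrA _ (sin _ ^+ 2)) sin_fejer exprMn => h.
  have := ler_wpM2l (sqr_ge0 (c * x)) s1; rewrite exprMn; lra.
rewrite (@FTC a b g (fun t => 2 * c * prim_fejer p (c * t) - 2 * c ^+ 2 * t))//; last first.
  move=> x _; have h := drv_prim_fejer p (c * x); apply: drv_eq.
    by drv; apply: drv_comp; drv.
  by rewrite /g /=; ring.
have h1 : p%:R * (pi / 2) - (c * b)^-1 <= prim_fejer p (c * b).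
  by apply: prim_fejer_ge; rewrite mulr_gt0.
have h2 : prim_fejer p (c * a) <= p%:R ^+ 2 * (c * a).
  by apply: prim_fejer_le; rewrite mulr_ge0// ltW.
have h3 : 2 * c ^+ 2 * b <= b^-1.
  rewrite -(ler_pM2r b0) mulVf ?lt0r_neq0//.
  have : (c * b) ^+ 2 <= (1 / 2) ^+ 2.
    by rewrite ler_sqr ?nnegrE ?divr_ge0// mulr_ge0// ltW.
  by rewrite exprMn; lra.
have h4 : 0 <= 2 * c ^+ 2 * a by rewrite !mulr_ge0 ?sqr_ge0 ?ltW.
have e1 : 2 * c * (p%:R * (pi / 2) - (c * b)^-1) = X * (pi / 2) - 2 / b.
  by rewrite e; field; rewrite ?lt0r_neq0.
have e2 : 2 * c * (p%:R ^+ 2 * (c * a)) = X ^+ 2 * a / 2 by rewrite e; field.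
have c2 : 0 <= 2 * c by rewrite mulr_ge0// ltW.
have := ler_wpM2l c2 h1; have := ler_wpM2l c2 h2; rewrite e1 e2; lra.
Qed.

End Integral.

(** * Gaussian integrals *)

Section Gauss.
Local Open Scope classical_set_scope.
Variable R : realType.
Implicit Types (f g F : R -> R) (a b c x y t v w X s : R).

Definition gauss_prim x : R := integ 0 x (fun t => expR (- t ^+ 2)).

Lemma derivable_gauss a b : derivable_on a b (fun t : R => expR (- t ^+ 2)).
Proof. by move=> x _; apply: drv_derivable; drv. Qed.

Lemma drv_gauss_prim x : 0 < x -> drv gauss_prim x (expR (- x ^+ 2)).
Proof.
move=> x0.
have [] := @continuous_FTC1 R (fun t => expR (- t ^+ 2)) (BLeft 0) x (x + 1)
  (ltr_pwDr ltr01 (lexx x)) (derivable_on_integrable (@derivable_gauss 0 (x + 1)))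
  (x0 : (_ < _)%O) (@continuous_gauss_fun R x).
rewrite -/gauss_prim derive1E => dF F'.
exact: (DeriveDef dF F').
Qed.

Lemma gauss_prim_ge0 x : 0 <= gauss_prim x.
Proof. by apply: integ_ge0 => y _; exact: expR_ge0. Qed.

Lemma gauss_prim_le x : 0 <= x -> gauss_prim x <= x.
Proof.
move=> x0; have h : derivable_on 0 x (fun=> 1) by move=> y _; apply: drv_derivable; drv.
rewrite [leRHS](_ : _ = integ 0 x (fun=> 1)); last first.
  by rewrite (@FTC R 0 x (fun=> 1) id)// ?subr0// => y _; exact: drv_id.
apply: le_integ => // y _.
by rewrite -expR0 ler_expR oppr_le0 sqr_ge0.
Qed.

Lemma gauss_prim_incr x y : 0 <= x -> x <= y ->
  gauss_prim x <= gauss_prim y.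
Proof.
move=> x0 xy; rewrite /gauss_prim (@integ_split _ 0 x y) ?x0//.
by rewrite lerDl; apply: integ_ge0 => ? _; exact: expR_ge0.
Qed.

Lemma gauss_prim_tail x y : 0 < x -> x <= y ->
  gauss_prim y <= gauss_prim x + (2 * x)^-1.
Proof.
move=> x0 xy.
rewrite /gauss_prim (@integ_split _ 0 x y) ?(ltW x0)//.
have h : derivable_on x y (fun t => t / x * expR (- t ^+ 2)).
  by move=> z _; apply: drv_derivable; drv.
rewrite lerD2l (@le_trans _ _ (integ x y (fun t => t / x * expR (- t ^+ 2))))//.
  apply: le_integ; [exact: derivable_gauss|exact: h|].
  move=> t /andP[xt _]; rewrite -[leLHS]mul1r ler_wpM2r ?expR_ge0//.
  by rewrite ler_pdivlMr// mul1r.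
rewrite (@FTC R x y _ (fun t => - (expR (- t ^+ 2) / (2 * x))))//; last first.
  move=> t _; apply: drv_eq; first by drv.
  by rewrite /=; field; rewrite lt0r_neq0.
rewrite opprK addrC; have h1 : expR (- x ^+ 2) <= 1 :> R.
  by rewrite -expR0 ler_expR oppr_le0 sqr_ge0.
have i0 : 0 <= (2 * x)^-1 by rewrite invr_ge0 mulr_ge0// ltW.
have := ler_wpM2r i0 h1.
by have := mulr_ge0 (expR_ge0 (- y ^+ 2)) i0; lra.
Qed.

Lemma sqr_gauss_prim_cvg : (gauss_prim x) ^+ 2 @[x --> +oo] --> (pi / 4 : R).
Proof. exact: gauss_integral_proof.cvg_integral0_gauss_sqr. Qed.

(** Only the limit of the square of [gauss_prim] is at hand, whence the squares. *)
Lemma gauss_prim_bounds x : 0 < x ->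
  Num.sqrt pi / 2 - (2 * x)^-1 <= gauss_prim x <= Num.sqrt pi / 2.
Proof.
move=> x0; have i0 : 0 <= (2 * x)^-1 by rewrite invr_ge0 mulr_ge0// ltW.
have e : (Num.sqrt pi / 2) ^+ 2 = pi / 4 :> R.
  by rewrite exprMn sqr_sqrtr ?pi_ge0//; field.
have s0 : 0 <= Num.sqrt pi / 2 :> R by rewrite divr_ge0.
apply/andP; split.
  rewrite lerBlDr -ler_sqr ?nnegrE ?addr_ge0 ?gauss_prim_ge0// e.
  apply: (cvgr_to_le sqr_gauss_prim_cvg); near=> y.
  rewrite ler_sqr ?nnegrE ?addr_ge0 ?gauss_prim_ge0//.
  by apply: gauss_prim_tail => //; near: y; apply: nbhs_pinfty_ge; rewrite num_real.
rewrite -ler_sqr ?nnegrE ?gauss_prim_ge0// e.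
apply: (cvgr_to_ge sqr_gauss_prim_cvg); near=> y.
rewrite ler_sqr ?nnegrE ?gauss_prim_ge0//; apply: gauss_prim_incr; first exact: ltW.
by near: y; apply: nbhs_pinfty_ge; rewrite num_real.
Unshelve. all: by end_near. Qed.

Definition gauss_kernel s t : R := (1 - expR (- (s * t) ^+ 2)) / t ^+ 2.

Lemma derivable_gauss_kernel s a b : 0 < a -> derivable_on a b (gauss_kernel s).
Proof.
move=> a0 x /andP[ax _]; have x0 : x != 0 by rewrite gt_eqF// (lt_le_trans a0).
by apply: drv_derivable; rewrite /gauss_kernel; drv; rewrite expf_neq0.
Qed.

(** An integration by parts reduces the integral to [gauss_prim]. *)
Lemma integ_gauss_kernel s a b : 0 < s -> 0 < a <= b ->
  s * Num.sqrt pi - 2 * s ^+ 2 * a - 2 / b <= integ a b (gauss_kernel s)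
    <= s * Num.sqrt pi + s ^+ 2 * a.
Proof.
move=> s0 /andP[a0 ab]; have b0 : 0 < b by apply: lt_le_trans ab.
have dk : derivable_on a b (gauss_kernel s) by exact: derivable_gauss_kernel.
have dF x : a <= x <= b -> drv (fun t => 2 * s * gauss_prim (s * t) -
    (1 - expR (- (s * t) ^+ 2)) / t) x (gauss_kernel s x).
  move=> /andP[ax _]; have x0 : 0 < x by apply: lt_le_trans ax.
  have h := @drv_gauss_prim (s * x) (mulr_gt0 s0 x0).
  apply: drv_eq; first by drv; [apply: drv_comp; drv | rewrite lt0r_neq0].
  by rewrite /gauss_kernel /=; field; rewrite lt0r_neq0.
rewrite (FTC ab dk dF).
have /andP[h1 h2] := gauss_prim_bounds (mulr_gt0 s0 b0).
have h3 := gauss_prim_le (ltW (mulr_gt0 s0 a0)).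
have h4 := gauss_prim_ge0 (s * a).
have e1 : 2 * s * (2 * (s * b))^-1 = b^-1 by field; rewrite ?lt0r_neq0.
have h5 : 0 <= (1 - expR (- (s * a) ^+ 2)) / a <= s ^+ 2 * a.
  have le1 : expR (- (s * a) ^+ 2) <= 1 :> R.
    by rewrite -expR0 ler_expR oppr_le0 sqr_ge0.
  rewrite divr_ge0 ?subr_ge0 ?(ltW a0)//= ler_pdivrMr//.
  by have := expR_ge1Dx (- (s * a) ^+ 2); lra.
have h6 : 0 <= (1 - expR (- (s * b) ^+ 2)) / b <= b^-1.
  have le1 : expR (- (s * b) ^+ 2) <= 1 :> R.
    by rewrite -expR0 ler_expR oppr_le0 sqr_ge0.
  rewrite divr_ge0 ?subr_ge0 ?(ltW b0)//= ler_pdivrMr// mulVf; last by rewrite gt_eqF.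
  by rewrite lerBlDr lerDl expR_ge0.
have s2 : 0 <= 2 * s by rewrite mulr_ge0// ltW.
move: (ler_wpM2l s2 h1) (ler_wpM2l s2 h2) (ler_wpM2l s2 h3) (mulr_ge0 s2 h4).
rewrite mulrBr e1; move: h5 h6 => /andP[? ?] /andP[? ?] ? ? ? ?; apply/andP; split; lra.
Qed.

Definition gauss_tail t : R := expR (- (t ^+ 2 / 2)) / t ^+ 2.

(** With [q = 43/100], this says that [exp (- t^2 / 4)] stays above [q] up to
[t = 183/100]. Any [q] between the largest later value of [|J0|], about 0.403, and
about 0.445, beyond which the room left by the walk with two steps is exceeded,
would do. *)
Lemma expR_num : 43 / 100 <= expR (- (183 / 100) ^+ 2 / 4) :> R.
Proof.
have -> : - (183 / 100) ^+ 2 / 4 = - (183 / 100) ^+ 2 / 8 + - (183 / 100) ^+ 2 / 8 :> R by field.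
rewrite expRD -expr2.
have h := @expRN_ge3 R ((183 / 100) ^+ 2 / 8); rewrite -mulNr in h.
have {}h : 656 / 1000 <= expR (- (183 / 100) ^+ 2 / 8) :> R by apply: le_trans (h _); lra.
move: (expR _) h => e h; apply: (@le_trans _ _ ((656 / 1000) ^+ 2)); first lra.
by apply: lerXn2r; rewrite ?nnegrE; lra.
Qed.

(** The integrand is below the derivative of [- exp (- t^2 / 2) / (t^3 + a * t)] as
soon as [(3 - a) * t^2 >= a * (a - 1)]; the choice [a = 11/5] is close to the
largest one allowed by [t >= 183/100]. *)
Lemma integ_gauss_tail b : 183 / 100 <= b ->
  integ (183 / 100) b gauss_tail <= 186 / 100 / 100.
Proof.
move=> ab; set a := 183 / 100 in ab *.
have a0 : 0 < a by rewrite /a; lra.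
pose q t := t ^+ 3 + 11 / 5 * t.
pose g t := expR (- (t ^+ 2 / 2)) * (t / q t + (3 * t ^+ 2 + 11 / 5) / q t ^+ 2).
have q0 t : a <= t -> 0 < q t.
  by move=> /(lt_le_trans a0) t0; rewrite /q addr_gt0 ?exprn_gt0 ?mulr_gt0//; lra.
have dg : derivable_on a b g.
  move=> t /andP[/q0 qt _]; apply: drv_derivable; rewrite /g /q; drv.
    by rewrite lt0r_neq0.
  by rewrite expf_neq0// lt0r_neq0.
apply: (@le_trans _ _ (integ a b g)).
  apply: le_integ; [|exact: dg|].
    move=> t /andP[at_ _]; have t0 : t != 0 by rewrite gt_eqF// (lt_le_trans a0).
    by apply: drv_derivable; rewrite /gauss_tail; drv; rewrite expf_neq0.
  move=> t /andP[at_ _]; rewrite /gauss_tail /g ler_wpM2l ?expR_ge0//.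
  have t0 : 0 < t by apply: lt_le_trans at_.
  have q2 : 0 < t ^+ 2 * (t ^+ 2 + 11 / 5) ^+ 2 by apply: mulr_gt0; rewrite exprn_gt0// addr_gt0 ?exprn_gt0//; lra.
  have -> : t / q t + (3 * t ^+ 2 + 11 / 5) / q t ^+ 2 =
     (t ^+ 4 + (11 / 5 + 3) * t ^+ 2 + 11 / 5) / (t ^+ 2 * (t ^+ 2 + 11 / 5) ^+ 2).
    have := q0 _ at_; rewrite /q => /lt0r_neq0 ?.
    have t2 : 0 < t ^+ 2 by rewrite exprn_gt0.
    have t3 : 0 < t ^+ 3 by rewrite exprn_gt0.
    by field; apply/and3P; split; apply: lt0r_neq0; lra.
  rewrite ler_pdivlMr// mulrA mulVf ?mul1r ?expf_neq0 ?lt0r_neq0//.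
  have : a ^+ 2 <= t ^+ 2 by apply: lerXn2r; rewrite ?nnegrE// ltW.
  by rewrite /a; lra.
have dF t : a <= t <= b -> drv (fun t => - (expR (- (t ^+ 2 / 2)) / q t)) t (g t).
  move=> /andP[/q0 qt _]; apply: drv_eq; first by rewrite /q; drv; rewrite lt0r_neq0.
  rewrite /g /=; rewrite /q in qt *; field.
  by apply: lt0r_neq0; lra.
rewrite (FTC ab dg dF).
rewrite opprK addrC.
have h1 : 0 <= expR (- (b ^+ 2 / 2)) / q b by rewrite divr_ge0 ?expR_ge0// ltW// q0.
have h2 : expR (- (a ^+ 2 / 2)) / q a <= 186 / 100 / 100.
  rewrite ler_pdivrMr ?q0//.
  have -> : - (a ^+ 2 / 2) = 4 * - (a ^+ 2 / 8) :> R by field.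
  rewrite expRM_natl.
  have h := @expRN_le4 R (a ^+ 2 / 8).
  have {}h : expR (- (a ^+ 2 / 8)) <= 659 / 1000 :> R by apply: le_trans (h _) _; rewrite /a; lra.
  apply: (@le_trans _ _ ((659 / 1000) ^+ 4)); last by rewrite /q /a; lra.
  by apply: lerXn2r; rewrite ?nnegrE; [exact: expR_ge0|lra|exact: h].
lra.
Qed.
End Gauss.

(** * A quadrature of the Bessel function J0 *)

Section Bessel.
Variable R : realType.
Implicit Types (f g F : R -> R) (a b c x y t v w X s : R).

Definition angle (N k : nat) : R := 2 * pi * k%:R / N%:R.

Definition avg (N : nat) (f : R -> R) : R := N%:R^-1 * \sum_(k < N) f (angle N k).

Lemma eq_avg N f g : f =1 g -> avg N f = avg N g.
Proof. by move=> fg; rewrite /avg; congr (_ * _); apply: eq_bigr => k _; rewrite fg. Qed.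

Lemma avgD N f g : avg N (fun x => f x + g x) = avg N f + avg N g.
Proof. by rewrite /avg big_split mulrDr. Qed.

Lemma avgZ N c f : avg N (fun x => c * f x) = c * avg N f.
Proof. by rewrite /avg -mulr_sumr mulrCA. Qed.

Lemma avgN N f : avg N (fun x => - f x) = - avg N f.
Proof. by rewrite /avg sumrN mulrN. Qed.

Lemma avg_cst N c : (0 < N)%N -> avg N (fun=> c) = c.
Proof.
move=> N0; rewrite /avg sumr_const card_ord -[c *+ N]mulr_natl mulrA mulVf ?mul1r//.
by rewrite pnatr_eq0 -lt0n.
Qed.

Lemma le_avg N f g : (forall x, f x <= g x) -> avg N f <= avg N g.
Proof. by move=> fg; rewrite ler_wpM2l ?invr_ge0//; apply: ler_sum => k _. Qed.

(** Multiplied by the sine of half the step, the sum telescopes. Thus the mean over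
the [N]-th roots of unity integrates exactly every trigonometric polynomial of
degree less than [N]. *)
Lemma avg_cos_multiple N p : (0 < p < N)%N -> avg N (fun x => cos (p%:R * x)) = 0.
Proof.
move=> /andP[p0 pN]; have N0 : N%:R != 0 :> R by rewrite pnatr_eq0 -lt0n (leq_trans p0) 1?ltnW.
have Np : 0 < N%:R :> R by rewrite lt_neqAle eq_sym N0 ler0n.
pose h : R := pi * p%:R / N%:R.
have sh : sin h != 0.
  rewrite lt0r_neq0// sin_gt0_pi// /h; apply/andP; split.
    by rewrite divr_gt0// mulr_gt0 ?pi_gt0// ltr0n.
  by rewrite ltr_pdivrMr// ltr_pM2l ?pi_gt0// ltr_nat.
rewrite /avg; suff -> : \sum_(k < N) cos (p%:R * angle N k) = 0 by rewrite mulr0.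
apply: (mulfI (mulf_neq0 (_ : 2 != 0 :> R) sh)); first by rewrite pnatr_eq0.
rewrite mulr0 mulr_sumr.
rewrite (eq_bigr (fun k : 'I_N => sin ((2 * k.+1%:R - 1) * h) - sin ((2 * k%:R - 1) * h))); last first.
  move=> k _; rewrite /angle.
  have -> : p%:R * (2 * pi * k%:R / N%:R) = 2 * k%:R * h by rewrite /h; field.
  have -> : (2 * k.+1%:R - 1) * h = 2 * k%:R * h + h by rewrite -[k.+1%:R]natr1; ring.
  have -> : (2 * k%:R - 1) * h = 2 * k%:R * h - h by ring.
  by rewrite sinD sinB; ring.
rewrite -(big_mkord xpredT (fun k => sin ((2 * k.+1%:R - 1) * h) - sin ((2 * k%:R - 1) * h))).
rewrite telescope_sumr//.
have -> : (2 * N%:R - 1) * h = - h + pi *+ 2 *+ p.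
  by rewrite -(mulr_natl (pi *+ 2)) -(mulr_natl pi) /h; field.
by rewrite periodicn; [rewrite mulr0 sub0r mulN1r subrr | exact: sinD2pi].
Qed.

Lemma cos_cheb x p : cos (p.+2%:R * x) = 2 * cos x * cos (p.+1%:R * x) - cos (p%:R * x).
Proof.
have -> : p.+2%:R * x = p.+1%:R * x + x by rewrite -[p.+2%:R]natr1; ring.
have -> : p%:R * x = p.+1%:R * x - x by rewrite -[p.+1%:R]natr1; ring.
by rewrite cosD cosB; ring.
Qed.

Lemma cos_mul2 x : cos (2 * x) = 2 * cos x ^+ 2 - 1.
Proof. by rewrite mulr_natl cos_mulr2n -mulr_natl. Qed.

Lemma avg_cos_even N p : (p.+1.*2 < N)%N -> avg N (fun x => cos (p.+1%:R * (2 * x))) = 0.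
Proof.
move=> pN; rewrite -(@avg_cos_multiple N p.+1.*2) ?pN ?andbT//.
by apply: eq_avg => x; rewrite -muln2 natrM mulrA.
Qed.

Lemma avg_cos2 N : (10 < N)%N -> avg N (fun x => cos x ^+ 2) = 1 / 2.
Proof.
move=> N10; rewrite (eq_avg N (g := fun x => 1 / 2 + 1 / 2 * cos (1%:R * (2 * x)))); last first.
  by move=> x; rewrite !mul1r cos_mul2; field.
by rewrite avgD avg_cst ?avgZ ?avg_cos_even ?(leq_trans _ N10)// mulr0 addr0.
Qed.

Lemma avg_cos4 N : (10 < N)%N -> avg N (fun x => cos x ^+ 4) = 3 / 8.
Proof.
move=> N10; rewrite (eq_avg N (g := fun x => 3 / 8 +
  (1 / 2 * cos (1%:R * (2 * x)) + 1 / 8 * cos (2 * (2 * x))))); last first.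
  by move=> x; move: (2 * x) (cos_mul2 x) => y e; rewrite !cos_cheb mul0r cos0 !mul1r e; field.
rewrite avgD avg_cst ?avgD ?avgZ ?avg_cos_even ?(leq_trans _ N10)//.
by field.
Qed.

Lemma avg_cos6 N : (10 < N)%N -> avg N (fun x => cos x ^+ 6) = 5 / 16.
Proof.
move=> N10; rewrite (eq_avg N (g := fun x => 5 / 16 +
  (15 / 32 * cos (1%:R * (2 * x)) + (6 / 32 * cos (2 * (2 * x)) + 1 / 32 * cos (3 * (2 * x)))))); last first.
  by move=> x; move: (2 * x) (cos_mul2 x) => y e; rewrite !cos_cheb mul0r cos0 !mul1r e; field.
rewrite avgD avg_cst ?avgD ?avgZ ?avg_cos_even ?(leq_trans _ N10)//.
by field.
Qed.

Lemma avg_cos8 N : (10 < N)%N -> avg N (fun x => cos x ^+ 8) = 35 / 128.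
Proof.
move=> N10; rewrite (eq_avg N (g := fun x => 35 / 128 +
  (56 / 128 * cos (1%:R * (2 * x)) + (28 / 128 * cos (2 * (2 * x)) + (8 / 128 * cos (3 * (2 * x))
  + 1 / 128 * cos (4 * (2 * x))))))); last first.
  by move=> x; move: (2 * x) (cos_mul2 x) => y e; rewrite !cos_cheb mul0r cos0 !mul1r e; field.
rewrite avgD avg_cst ?avgD ?avgZ ?avg_cos_even ?(leq_trans _ N10)//.
by field.
Qed.

Lemma avg_cos10 N : (10 < N)%N -> avg N (fun x => cos x ^+ 10) = 63 / 256.
Proof.
move=> N10; rewrite (eq_avg N (g := fun x => 63 / 256 +
  (210 / 512 * cos (1%:R * (2 * x)) + (120 / 512 * cos (2 * (2 * x)) + (45 / 512 * cos (3 * (2 * x))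
  + (10 / 512 * cos (4 * (2 * x)) + 1 / 512 * cos (5 * (2 * x)))))))); last first.
  by move=> x; move: (2 * x) (cos_mul2 x) => y e; rewrite !cos_cheb mul0r cos0 !mul1r e; field.
rewrite avgD avg_cst ?avgD ?avgZ ?avg_cos_even ?(leq_trans _ N10)//.
by field.
Qed.

(** The quadrature of [J0 t] with [N] nodes. *)
Definition bessel N t : R := avg N (fun x => cos (t * cos x)).

Definition bessel' N t : R := - avg N (fun x => cos x * sin (t * cos x)).

Lemma drv_bessel N t : drv (bessel N) t (bessel' N t).
Proof.
rewrite /bessel /avg; apply: drv_eq; first by drv.
rewrite /= [X in _ + X]mulr0 addr0 /bessel' /avg -mulrN -sumrN; congr (_ * _).
by apply: eq_bigr => k _; ring.
Qed.

Definition bessel'' N t : R := - avg N (fun x => cos x ^+ 2 * cos (t * cos x)).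

Lemma drv_bessel' N t : drv (bessel' N) t (bessel'' N t).
Proof.
rewrite /bessel' /avg; apply: drv_eq; first by drv.
rewrite /= [X in - (_ + X)]mulr0 addr0 /bessel'' /avg; congr (- (_ * _)).
by apply: eq_bigr => k _; ring.
Qed.

(** The mean of the Taylor bounds of the cosine: the moments involved being exact,
these are the Taylor bounds of [J0]. *)
Lemma bessel_le N t : (10 < N)%N -> bessel N t <= (1 - t ^+ 2 / 8) ^+ 2.
Proof.
move=> N10; apply: (@le_trans _ _ (avg N (fun x => 1 +
    (- (t ^+ 2 / 2) * cos x ^+ 2 + t ^+ 4 / 24 * cos x ^+ 4)))).
  apply: le_avg => x; apply: le_trans (cos_le4 _) _; rewrite !exprMn; lra.
rewrite !avgD !avgZ avg_cst ?(leq_trans _ N10)// avg_cos2 ?avg_cos4//.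
by rewrite le_eqVlt; apply/orP; left; apply/eqP; field.
Qed.

Lemma bessel_ge N t : (10 < N)%N ->
  1 - t ^+ 2 / 4 + t ^+ 4 / 64 - t ^+ 6 / (48 * 48) <= bessel N t.
Proof.
move=> N10; apply: (@le_trans _ _ (avg N (fun x => 1 +
    (- (t ^+ 2 / 2) * cos x ^+ 2 + (t ^+ 4 / 24 * cos x ^+ 4 + - (t ^+ 6 / 720) * cos x ^+ 6))))).
  rewrite !avgD !avgZ avg_cst ?(leq_trans _ N10)// avg_cos2 ?avg_cos4 ?avg_cos6//.
  by rewrite le_eqVlt; apply/orP; left; apply/eqP; field.
apply: le_avg => x; apply: le_trans (cos_ge6 _); rewrite !exprMn; lra.
Qed.

Lemma bessel_ge10 N t : (10 < N)%N ->
  1 - t ^+ 2 / 4 + t ^+ 4 / 64 - t ^+ 6 / (48 * 48) + t ^+ 8 / (384 * 384)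
   - t ^+ 10 / (3840 * 3840) <= bessel N t.
Proof.
move=> N10; apply: (@le_trans _ _ (avg N (fun x => 1 +
    (- (t ^+ 2 / 2) * cos x ^+ 2 + (t ^+ 4 / 24 * cos x ^+ 4 + (- (t ^+ 6 / 720) * cos x ^+ 6
     + (t ^+ 8 / (56 * 720) * cos x ^+ 8 + - (t ^+ 10 / (90 * 56 * 720)) * cos x ^+ 10))))))).
  rewrite !avgD !avgZ avg_cst ?(leq_trans _ N10)// avg_cos2 ?avg_cos4 ?avg_cos6 ?avg_cos8 ?avg_cos10//.
  by rewrite le_eqVlt; apply/orP; left; apply/eqP; field.
apply: le_avg => x; apply: le_trans (cos_ge10 _); rewrite !exprMn; lra.
Qed.

Lemma bessel'_ge N t : (10 < N)%N ->
  - (t ^+ 2 / 2 - t ^+ 4 / 16 + t ^+ 6 / 384 - t ^+ 8 / (384 * 48)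
    + t ^+ 10 / (384 * 3840)) <= t * bessel' N t.
Proof.
move=> N10; rewrite /bessel' mulrN lerN2 -avgZ.
apply: (@le_trans _ _ (avg N (fun x => t ^+ 2 * cos x ^+ 2 +
    (- (t ^+ 4 / 6) * cos x ^+ 4 + (t ^+ 6 / 120 * cos x ^+ 6
     + (- (t ^+ 8 / (7 * 720)) * cos x ^+ 8 + t ^+ 10 / (504 * 720) * cos x ^+ 10)))))).
  apply: le_avg => x; rewrite mulrA; apply: le_trans (mul_sin_le10 _) _; rewrite !exprMn; lra.
rewrite !avgD !avgZ avg_cos2 ?avg_cos4 ?avg_cos6 ?avg_cos8 ?avg_cos10//.
by rewrite le_eqVlt; apply/orP; left; apply/eqP; field.
Qed.

Lemma bessel'_le N t : (10 < N)%N ->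
  t * bessel' N t <= - (t ^+ 2 / 2 - t ^+ 4 / 16 + t ^+ 6 / 384 - t ^+ 8 / (384 * 48)).
Proof.
move=> N10; rewrite /bessel' mulrN lerN2 -avgZ.
apply: (@le_trans _ _ (avg N (fun x => t ^+ 2 * cos x ^+ 2 +
    (- (t ^+ 4 / 6) * cos x ^+ 4 + (t ^+ 6 / 120 * cos x ^+ 6
     + - (t ^+ 8 / (7 * 720)) * cos x ^+ 8))))).
  rewrite !avgD !avgZ avg_cos2 ?avg_cos4 ?avg_cos6 ?avg_cos8//.
  by rewrite le_eqVlt; apply/orP; left; apply/eqP; field.
apply: le_avg => x; rewrite mulrA; apply: le_trans (mul_sin_ge8 _); rewrite !exprMn; lra.
Qed.

Lemma sqr_le_sqr x c : - c <= x <= c -> x ^+ 2 <= c ^+ 2.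
Proof.
move=> /andP[h1 h2]; rewrite -subr_ge0 subr_sqr mulr_ge0//; first by rewrite subr_ge0.
by rewrite addrC -lerBlDr sub0r.
Qed.

(** The point [sqrt 10] is far enough for the energy to have dropped below
[(43 / 100)^2], and close enough for Taylor polynomials of degree 10. *)
Lemma energy_start N t : (10 < N)%N -> t ^+ 2 = 10 ->
  bessel N t ^+ 2 + bessel' N t ^+ 2 <= 175 / 1000.
Proof.
move=> N10 t2.
have t4 : t ^+ 4 = 10 ^+ 2 by rewrite -t2 -exprM.
have t6 : t ^+ 6 = 10 ^+ 3 by rewrite -t2 -exprM.
have t8 : t ^+ 8 = 10 ^+ 4 by rewrite -t2 -exprM.
have t10 : t ^+ 10 = 10 ^+ 5 by rewrite -t2 -exprM.
have h1 : bessel N t ^+ 2 <= (312 / 1000) ^+ 2.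
  apply: sqr_le_sqr; have := bessel_ge10 t N10; have := bessel_le t N10.
  by rewrite t2 t4 t6 t8 t10 => *; apply/andP; split; lra.
have h2 : 10 * bessel' N t ^+ 2 <= (880 / 1000) ^+ 2.
  rewrite -t2 -exprMn; apply: sqr_le_sqr; have := bessel'_ge t N10; have := bessel'_le t N10.
  by rewrite t2 t4 t6 t8 t10 => *; apply/andP; split; lra.
lra.
Qed.

Lemma angleS N k : angle N k.+1 = angle N k + angle N 1.
Proof. by rewrite /angle -[k.+1%:R]natr1; ring. Qed.

(** A Riemann sum over a full period of the derivative of a periodic function
telescopes, up to the error made on each step. *)
Lemma avg_derivative N f f' L : (0 < N)%N -> (forall x, f (x + 2 * pi) = f x) ->
  (forall x, drv f x (f' x)) ->
  (forall x y, `|f' x - f' y| <= L * `|x - y|) ->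
  `|avg N f'| <= L * (2 * pi) / N%:R.
Proof.
move=> N0 per df lip.
have Nr : 0 < N%:R :> R by rewrite ltr0n.
have pi0 := @pi_gt0 R.
pose h := angle N 1.
have h0 : 0 < h by rewrite /h /angle mulr1 divr_gt0// mulr_gt0.
have step k : `|f (angle N k.+1) - f (angle N k) - h * f' (angle N k)| <= L * h * h.
  rewrite angleS -/h; set a := angle N k.
  have bound x : a <= x <= a + h -> `|f' x - f' a| <= L * h.
    move=> /andP[ax xh]; apply: le_trans (lip _ _) _.
    have L0 : 0 <= L by have := lip 1 0; rewrite subr0 normr1 mulr1; apply: le_trans.
    by rewrite ler_wpM2l// ger0_norm; lra.
  rewrite ler_norml; apply/andP; split.
    have := @ler_of_derive R (fun x => (f' a - L * h) * x) f (fun=> f' a - L * h) f' a (a + h).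
    have ah : a <= a + h by lra.
    move=> /(_ ah); have -> : (f' a - L * h) * (a + h) - (f' a - L * h) * a = h * f' a - L * h * h by ring.
    move=> H; rewrite lerBrDr; apply: le_trans (H _ _ _) => //.
    - by rewrite addrC.
    - by move=> x _; apply: drv_eq; [drv|rewrite /=; ring].
    - by move=> x /bound; rewrite ler_norml => /andP[? ?]; lra.
  have := @ler_of_derive R f (fun x => (f' a + L * h) * x) f' (fun=> f' a + L * h) a (a + h).
  have ah : a <= a + h by lra.
  move=> /(_ ah); have -> : (f' a + L * h) * (a + h) - (f' a + L * h) * a = h * f' a + L * h * h by ring.
  move=> H; rewrite lerBlDl; apply: (H _ _ _) => //.
  - by move=> x _; apply: drv_eq; [drv|rewrite /=; ring].
  - by move=> x /bound; rewrite ler_norml => /andP[? ?]; lra.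
have tel : \sum_(k < N) (f (angle N k.+1) - f (angle N k)) = 0.
  rewrite -(big_mkord xpredT (fun k => f (angle N k.+1) - f (angle N k))) telescope_sumr//.
  have -> : angle N N = angle N 0 + 2 * pi.
    by rewrite /angle mulr0 mul0r add0r mulfK// lt0r_neq0.
  by rewrite per subrr.
have e : h * (N%:R * avg N f') = - \sum_(k < N) (f (angle N k.+1) - f (angle N k) - h * f' (angle N k)).
  rewrite sumrB tel sub0r opprK -mulr_sumr /avg (mulrA N%:R) divff ?mul1r//.
  by rewrite lt0r_neq0.
have H : `|h * (N%:R * avg N f')| <= N%:R * (L * h * h).
  rewrite e normrN; apply: le_trans (ler_norm_sum _ _ _) _.
  apply: (@le_trans _ _ (\sum_(k < N) L * h * h)); first by apply: ler_sum => k _; exact: step.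
  by rewrite sumr_const card_ord mulr_natl.
have eh : L * (2 * pi) / N%:R = L * h by rewrite /h /angle -mulrA mulr1.
rewrite eh -(ler_pM2l Nr) -(ler_pM2l h0).
have -> : h * (N%:R * (L * h)) = N%:R * (L * h * h) by ring.
have nE x : `|h * (N%:R * x)| = h * (N%:R * `|x|).
  by rewrite (normrM h) (normrM N%:R) (gtr0_norm h0) (gtr0_norm Nr).
by rewrite -nE.
Qed.

(** The left hand side of Bessel's equation is minus the mean of the derivative of
the periodic function [sin x * sin (t * cos x)]. *)
Lemma bessel_ode N t : (0 < N)%N -> 0 <= t ->
  `|t * bessel'' N t + bessel' N t + t * bessel N t| <=
  (1 + 3 * t + t ^+ 2) * (2 * pi) / N%:R.
Proof.
move=> N0 t0.
pose f x : R := sin x * sin (t * cos x).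
pose f' x : R := cos x * sin (t * cos x) - t * (sin x ^+ 2 * cos (t * cos x)).
pose f'' x : R := - (sin x * sin (t * cos x)) - 3 * t * (sin x * cos x * cos (t * cos x))
  - t ^+ 2 * (sin x ^+ 3 * sin (t * cos x)).
have -> : t * bessel'' N t + bessel' N t + t * bessel N t = - avg N f'.
  rewrite /bessel'' /bessel' /bessel mulrN -avgN -!avgZ -avgN -avgN -!avgD; apply: eq_avg => x.
  by rewrite /f' -[sin x ^+ 2](addrK (cos x ^+ 2)) addrC (addrC (sin x ^+ 2)) cos2Dsin2; ring.
have df x : drv f x (f' x).
  by apply: drv_eq; [rewrite /f; drv | rewrite /f' /=; ring].
have df' x : drv f' x (f'' x).
  by apply: drv_eq; [rewrite /f'; drv | rewrite /f'' /=; ring].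
rewrite normrN; apply: (avg_derivative (f := f)) => // [x|].
  have e : 2 * pi = pi *+ 2 :> R by rewrite mulr_natl.
  by rewrite /f e sinD2pi cosD2pi.
have bnd x : `|f'' x| <= 1 + 3 * t + t ^+ 2.
  have s1 y := sin_max y; have c1 y := cos_max y.
  have p2 (u v : R) : `|u| <= 1 -> `|v| <= 1 -> `|u * v| <= 1.
    by move=> u1 v1; rewrite normrM mulr_ile1.
  rewrite /f'' -opprD -opprD normrN; apply: le_trans (ler_normD _ _) _.
  apply: lerD; [apply: le_trans (ler_normD _ _) _; apply: lerD; first exact: p2 |].
    by rewrite normrM ger0_norm ?mulr_ge0// ler_piMr ?mulr_ge0// p2// p2.
  rewrite normrM ger0_norm ?sqr_ge0// ler_piMr ?sqr_ge0//.
  by rewrite p2// exprS p2// expr2 p2.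
have lip x y : x <= y -> `|f' y - f' x| <= (1 + 3 * t + t ^+ 2) * (y - x).
  move=> xy; set L := 1 + 3 * t + t ^+ 2 in bnd *.
  have h1 := @ler_of_derive R f' (fun z => L * z) f'' (fun=> L) x y xy.
  have h2 := @ler_of_derive R (fun z => - L * z) f' (fun=> - L) f'' x y xy.
  have dL c z : drv (fun z => c * z) z c.
    by apply: drv_eq; [drv | rewrite /=; ring].
  rewrite ler_norml; apply/andP; split.
    rewrite mulrBr opprB addrC -mulNr -[X in _ + X]opprK -mulNr; apply: h2 => // z _.
    by have := bnd z; rewrite ler_norml => /andP[].
  rewrite mulrBr; apply: h1 => // z _.
  by have := bnd z; rewrite ler_norml => /andP[].
move=> x y; have [xy|yx] := leP x y.
  by rewrite distrC [`|x - y|]distrC [X in _ <= _ * X]ger0_norm ?subr_ge0// lip.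
by rewrite [X in _ <= _ * X]ger0_norm ?subr_ge0 ?lip// ltW.
Qed.

Lemma bessel'_norm N t : (0 < N)%N -> `|bessel' N t| <= 1.
Proof.
move=> N0; rewrite /bessel' normrN.
have h x : `|cos x * sin (t * cos x)| <= 1.
  by rewrite normrM mulr_ile1 ?cos_max ?sin_max.
have e1 := avg_cst 1 N0; rewrite ler_norml; apply/andP; split.
  by rewrite -[X in - X]e1 -avgN; apply: le_avg => x; have := h x; rewrite ler_norml => /andP[].
by rewrite -[leRHS]e1; apply: le_avg => x; have := h x; rewrite ler_norml => /andP[].
Qed.

(** By Bessel's equation the derivative of the energy [J^2 + J'^2] is
[- 2 * J'^2 / t], up to the quadrature error. *)
Lemma energy_decr N t0 M : (0 < N)%N -> 1 <= t0 -> t0 <= M ->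
  bessel N M ^+ 2 + bessel' N M ^+ 2 <=
  bessel N t0 ^+ 2 + bessel' N t0 ^+ 2 +
    2 * ((1 + 3 * M + M ^+ 2) * (2 * pi) / N%:R) * (M - t0).
Proof.
move=> N0 t1 tM; set e := (_ * (2 * pi) / _).
have pi0 := @pi_gt0 R.
have Nr : 0 < N%:R :> R by rewrite ltr0n.
rewrite -lerBlDl mulrBr.
apply: (@ler_of_derive R (fun t => bessel N t ^+ 2 + bessel' N t ^+ 2) (fun t => 2 * e * t)
  (fun t => 2 * bessel' N t * (bessel N t + bessel'' N t)) (fun=> 2 * e) t0 M tM).
- move=> t _; have h1 := drv_bessel N t; have h2 := drv_bessel' N t.
  by apply: drv_eq; [drv | rewrite /=; ring].
- by move=> t _; apply: drv_eq; [drv | rewrite /=; ring].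
move=> t /andP[t0t tM'].
have tt1 : 1 <= t by lra.
have tge0 : 0 <= t by lra.
have := bessel_ode N0 tge0; set o := (X in `|X|) => ho.
have ho' : `|o| <= e.
  apply: le_trans ho _; rewrite ler_wpM2r ?invr_ge0 ?ler0n// ler_wpM2r ?mulr_ge0 ?pi_ge0//.
  by have := lerXn2r 2 tge0 (le_trans tge0 tM') tM'; lra.
have hb := bessel'_norm t N0.
have h3 : `|bessel' N t * o| <= e.
  rewrite normrM -[leRHS]mul1r; apply: ler_pM => //.
have e0 : 0 <= e by apply: le_trans ho'.
have h4 : bessel' N t * (t * (bessel N t + bessel'' N t)) <= e * t.
  have -> : bessel' N t * (t * (bessel N t + bessel'' N t)) = bessel' N t * o - bessel' N t ^+ 2.
    by rewrite /o; ring.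
  move: h3; rewrite ler_norml => /andP[_ h3].
  have := sqr_ge0 (bessel' N t); have := ler_wpM2l e0 tt1; lra.
rewrite -mulrA ler_pM2l// -(ler_pM2r (lt_le_trans ltr01 tt1)).
by rewrite -mulrA (mulrC _ t).
Qed.

Lemma bessel_near N t : (10 < N)%N -> 0 <= t <= 183 / 100 ->
  0 <= bessel N t <= expR (- (t ^+ 2 / 4)) /\ 43 / 100 <= expR (- (t ^+ 2 / 4)).
Proof.
move=> N10 /andP[t0 ta].
have t2 : 0 <= t ^+ 2 <= (183 / 100) ^+ 2.
  by rewrite sqr_ge0 /=; apply: sqr_le_sqr; apply/andP; split; lra.
case/andP: t2 => t20 t2; split; last first.
  apply: le_trans (expR_num R) _; rewrite ler_expR; lra.
apply/andP; split.
  apply: le_trans (bessel_ge t N10).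
  have -> : t ^+ 4 = (t ^+ 2) ^+ 2 by rewrite -exprM.
  have -> : t ^+ 6 = (t ^+ 2) ^+ 3 by rewrite -exprM.
  move: (t ^+ 2) t20 t2 => s s0 s1.
  have s2 : 0 <= s ^+ 2 by rewrite sqr_ge0.
  have h : s ^+ 2 * (16 / 10) <= s ^+ 2 * (4 * 9) by rewrite ler_wpM2l//; lra.
  have : s ^+ 3 <= 36 * s ^+ 2.
    by rewrite exprSr mulrC ler_wpM2r//; lra.
  lra.
apply: le_trans (bessel_le t N10) _.
have -> : - (t ^+ 2 / 4) = - (t ^+ 2 / 8) + - (t ^+ 2 / 8) by field.
rewrite expRD -expr2; apply: sqr_le_sqr.
have := expR_ge1Dx (- (t ^+ 2 / 8)) => h.
by apply/andP; split; lra.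
Qed.

(** Up to [sqrt 10] by the Taylor bounds, and from there on because the energy
does not increase. *)
Lemma bessel_far M : exists N0 : nat, forall N t, (N0 <= N)%N ->
  183 / 100 <= t <= M -> `|bessel N t| <= 43 / 100.
Proof.
have pi0 := @pi_gt0 R.
(* this many nodes keep the increase of the energy below 5 / 1000 *)
pose X : R := 4 * pi * (1 + 3 * M + M ^+ 2) * M * 200.
exists ((Num.truncn X).+1 + 11)%N => N t hN /andP[ta tM].
have N10 : (10 < N)%N by apply: leq_trans hN; rewrite leq_addl.
have N0 : (0 < N)%N by apply: leq_trans N10.
have t0 : 0 <= t by lra.
have [t10|t10] := leP (t ^+ 2) 10.
  have ta2 : (183 / 100) ^+ 2 <= t ^+ 2.
    by apply: sqr_le_sqr; apply/andP; split; lra.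
  rewrite ler_norml; apply/andP; split.
    apply: le_trans (bessel_ge t N10).
    have -> : t ^+ 4 = (t ^+ 2) ^+ 2 by rewrite -exprM.
    have -> : t ^+ 6 = (t ^+ 2) ^+ 3 by rewrite -exprM.
    move: (t ^+ 2) t10 ta2 => s s10 sa.
    have s0 : 0 <= s by lra.
    have s2 : 0 <= s ^+ 2 by rewrite sqr_ge0.
    (* the Taylor polynomial minus its value at 10, multiplied by [48 ^ 2] *)
    have h : 0 <= (10 - s) * (s ^+ 2 - 26 * s + 316).
      apply: mulr_ge0; first lra.
      by have := sqr_ge0 (s - 13); lra.
    lra.
  apply: le_trans (bessel_le t N10) _.
  apply: (@le_trans _ _ ((6 / 10) ^+ 2)); last lra.
  by apply: sqr_le_sqr; apply/andP; split; lra.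
pose u : R := Num.sqrt 10.
have u2 : u ^+ 2 = 10 by rewrite sqr_sqrtr// ler0n.
have u0 : 0 <= u by apply: sqrtr_ge0.
have ut : u <= t.
  by rewrite -ler_sqr ?nnegrE// u2 ltW.
have u1 : 1 <= u.
  by rewrite -ler_sqr ?nnegrE// u2 expr1n ler1n.
have h1 := energy_start N10 u2.
have h2 := energy_decr N0 u1 ut.
have Nr : 0 < N%:R :> R by rewrite ltr0n.
have h3 : 2 * ((1 + 3 * t + t ^+ 2) * (2 * pi) / N%:R) * (t - u) <= 5 / 1000.
  have b0 : 0 <= (1 + 3 * t + t ^+ 2) by have := sqr_ge0 t; lra.
  have M0 : 0 <= M by lra.
  have bM : (1 + 3 * t + t ^+ 2) <= (1 + 3 * M + M ^+ 2).
    have : t ^+ 2 <= M ^+ 2 by apply: sqr_le_sqr; apply/andP; split; lra.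
    lra.
  have BM : (1 + 3 * t + t ^+ 2) * (t - u) <= (1 + 3 * M + M ^+ 2) * M.
    apply: ler_pM => //; lra.
  have -> : 2 * ((1 + 3 * t + t ^+ 2) * (2 * pi) / N%:R) * (t - u) =
     4 * pi * ((1 + 3 * t + t ^+ 2) * (t - u)) / N%:R by ring.
  rewrite ler_pdivrMr//.
  have XN : X <= N%:R.
    apply: (@le_trans _ _ (Num.truncn X).+1%:R); first by rewrite ltW// truncnS_gt.
    by rewrite ler_nat; apply: leq_trans hN; rewrite leq_addr.
  have p4 : 0 <= 4 * pi :> R by lra.
  have := ler_wpM2l p4 BM.
  rewrite /X in XN; lra.
have h4 : bessel N t ^+ 2 <= (43 / 100) ^+ 2.
  have := sqr_ge0 (bessel' N t); lra.
by rewrite -(@ler_pXn2r _ 2) ?nnegrE ?real_normK ?num_real//; lra.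
Qed.

End Bessel.

(** * Equidistant samples of the absolute value of the cosine *)

Section AbsCos.
Variable R : realType.
Implicit Types (a b c x y t v w phi : R).

Definition half_sum (K : nat) phi : R := \sum_(k < K) `|cos (phi + k%:R * (pi / K%:R))|.

Lemma norm_cosDpi x : `|cos (x + pi)| = `|cos x| :> R.
Proof. by rewrite cosDpi normrN. Qed.

Lemma half_sum_shift K phi : (0 < K)%N -> half_sum K (phi + pi / K%:R) = half_sum K phi.
Proof.
case: K => // K _; set h := pi / _.
rewrite /half_sum -/h big_ord_recr [RHS]big_ord_recl /= mul0r addr0 [LHS]addrC; congr (_ + _).
  rewrite -[RHS]norm_cosDpi; congr `|cos _|.
  rewrite -addrA; congr (_ + _).
  have : K.+1%:R != 0 :> R by rewrite pnatr_eq0.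
  by rewrite /h -[K.+1%:R]natr1 => ?; field.
by apply: eq_bigr => k _; rewrite /bump /= add1n -[k.+1%:R]natr1; congr `|cos _|; ring.
Qed.

Lemma half_sum_shiftz K phi (m : int) : (0 < K)%N ->
  half_sum K (phi + m%:~R * (pi / K%:R)) = half_sum K phi.
Proof.
move=> K0.
have nat_case psi (k : nat) : half_sum K (psi + k%:R * (pi / K%:R)) = half_sum K psi.
  elim: k => [|k IH]; first by rewrite mul0r addr0.
  by rewrite -IH -[RHS]half_sum_shift// -[k.+1%:R]natr1; congr half_sum; ring.
case: m => k; first exact: nat_case.
rewrite NegzE -[LHS](nat_case _ k.+1); congr half_sum.
by rewrite mulrNz mulNr subrK.
Qed.

(** All cosines are nonnegative here, and their sum telescopes. *)
Lemma half_sum_base K phi : (0 < K)%N -> - (pi / 2) <= phi <= - (pi / 2) + pi / K%:R ->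
  half_sum K phi = cos (phi + pi / 2 - pi / (2 * K%:R)) / sin (pi / (2 * K%:R)).
Proof.
move=> K0 /andP[p1 p2].
have Kr : 0 < K%:R :> R by rewrite ltr0n.
have pi0 := @pi_gt0 R.
pose y : R := pi / (2 * K%:R).
have y0 : 0 < y by rewrite divr_gt0// mulr_gt0.
have hy : pi / K%:R = 2 * y by rewrite /y; field; rewrite lt0r_neq0.
have yK : 2 * y * K%:R = pi by rewrite /y; field; rewrite lt0r_neq0.
have ypi : y < pi.
  rewrite /y ltr_pdivrMr ?mulr_gt0// ltr_pMr//.
  have : 1 <= K%:R :> R by rewrite ler1n.
  lra.
have sy : 0 < sin y by apply: sin_gt0_pi; rewrite y0.
rewrite -/y; apply: (mulfI (lt0r_neq0 sy)).
rewrite [RHS]mulrC divfK ?lt0r_neq0//.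
have -> : half_sum K phi = \sum_(k < K) cos (phi + k%:R * (2 * y)).
  rewrite /half_sum hy; apply: eq_bigr => k _; rewrite ger0_norm//.
  have k1 : k%:R + 1 <= K%:R :> R by rewrite natr1 ler_nat.
  have k0 : 0 <= k%:R :> R by rewrite ler0n.
  have hk : k%:R * (2 * y) + 2 * y <= pi.
    by have : 0 <= 2 * y * (K%:R - (k%:R + 1)); [rewrite mulr_ge0; lra | rewrite mulrBr yK; lra].
  have hk0 : 0 <= k%:R * (2 * y) by rewrite mulr_ge0//; lra.
  by apply: cos_ge0_pihalf; rewrite hy in p2; apply/andP; split; lra.
have H : 2 * (sin y * \sum_(k < K) cos (phi + k%:R * (2 * y))) =
    \sum_(k < K) (sin (phi - y + k.+1%:R * (2 * y)) - sin (phi - y + k%:R * (2 * y))).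
  rewrite mulrA mulr_sumr; apply: eq_bigr => k _.
  have -> : phi - y + k.+1%:R * (2 * y) = (phi + k%:R * (2 * y)) + y.
    by rewrite -[k.+1%:R]natr1; ring.
  have -> : phi - y + k%:R * (2 * y) = (phi + k%:R * (2 * y)) - y by ring.
  by rewrite sinD sinB; ring.
rewrite -(big_mkord xpredT (fun k => sin (phi - y + k.+1%:R * (2 * y)) - sin (phi - y + k%:R * (2 * y)))) telescope_sumr// in H.
rewrite (mulrC K%:R) yK mul0r addr0 sinDpi in H.
have -> : phi + pi / 2 - y = (phi - y) + pi / 2 by ring.
by rewrite cosDpihalf; lra.
Qed.

(** [half_sum K] has period [pi / K], so that [half_sum_base] applies after a
translation. *)
Lemma half_sum_bounds K phi : (0 < K)%N ->
  cos (pi / (2 * K%:R)) / sin (pi / (2 * K%:R)) <= half_sum K phi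
    <= (sin (pi / (2 * K%:R)))^-1.
Proof.
move=> K0.
have Kr : 0 < K%:R :> R by rewrite ltr0n.
have pi0 := @pi_gt0 R.
pose h : R := pi / K%:R; have h0 : 0 < h by rewrite divr_gt0.
pose m := Num.floor ((phi + pi / 2) / h).
have /andP[m1 m2] := floor_itv ((phi + pi / 2) / h).
have e : half_sum K phi = half_sum K (phi - m%:~R * h).
  by rewrite -[RHS](half_sum_shiftz _ m K0) -/h subrK.
have p0 : - (pi / 2) <= phi - m%:~R * h <= - (pi / 2) + h.
  move: m1 m2; rewrite -/m ler_pdivlMr// ltr_pdivrMr//.
  have -> : (m + 1)%:~R = m%:~R + 1 :> R by rewrite intrD.
  by move=> *; apply/andP; split; lra.
rewrite e half_sum_base//; set psi := phi - _ in p0 *.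
set y : R := pi / (2 * K%:R).
have hy : h = 2 * y by rewrite /h /y; field; rewrite lt0r_neq0.
have y0 : 0 < y by lra.
have ypi : y < pi.
  rewrite /y ltr_pdivrMr ?mulr_gt0// ltr_pMr//.
  have : 1 <= K%:R :> R by rewrite ler1n.
  lra.
have sy : 0 < sin y by apply: sin_gt0_pi; rewrite y0.
rewrite ler_pM2r ?invr_gt0// -[X in _ && (_ <= X)]mul1r ler_pM2r ?invr_gt0// cos_le1 andbT.
case/andP: p0; rewrite hy => p1 p2.
rewrite -(cos_norm (psi + _ - _)).
have d : `|psi + pi / 2 - y| <= y by rewrite ler_norml; apply/andP; split; lra.
have := @ltr_cos R y `|psi + pi / 2 - y|.
rewrite !in_itv/= normr_ge0 (ltW y0) (ltW ypi) (le_trans d (ltW ypi))/= => /(_ isT isT) H.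
by rewrite leNgt H -leNgt.
Qed.

Lemma two_div_pi x c : x != 0 -> c != 0 -> 2 / x = (x / (2 * c) * c)^-1 :> R.
Proof. by move=> x0 c0; field; apply/andP. Qed.

Lemma half_sum_ge K phi : (0 < K)%N ->
  (2 / pi) * (1 - (pi / (2 * K%:R)) ^+ 2 / 2) <= half_sum K phi / K%:R.
Proof.
move=> K0.
have Kr : 0 < K%:R :> R by rewrite ltr0n.
have pi0 := @pi_gt0 R.
have /andP[+ _] := half_sum_bounds phi K0.
set y : R := pi / (2 * K%:R) => H.
have [c0|c0] := ltP (1 - y ^+ 2 / 2) 0.
  apply: (@le_trans _ _ 0); first by rewrite nmulr_lle0// divr_ge0// ltW.
  by rewrite divr_ge0// sumr_ge0.
have y0 : 0 < y by rewrite divr_gt0// mulr_gt0.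
have ypi : y < pi.
  rewrite /y ltr_pdivrMr ?mulr_gt0// ltr_pMr//.
  have : 1 <= K%:R :> R by rewrite ler1n.
  lra.
have sy : 0 < sin y by apply: sin_gt0_pi; rewrite y0.
rewrite ler_pdivlMr//; apply: le_trans H.
have -> : 2 / pi * (1 - y ^+ 2 / 2) * K%:R = (1 - y ^+ 2 / 2) / y.
  rewrite (two_div_pi (lt0r_neq0 pi0) (lt0r_neq0 Kr)) -/y.
  move: (lt0r_neq0 y0) (lt0r_neq0 Kr); move: (y) (K%:R : R) => u k *.
  by field; apply/andP.
have c1 : 1 - y ^+ 2 / 2 <= cos y.
  have := cos_taylor_sign 1 y; rewrite /cos_taylor /= !big_cons big_nil /= !factS fact0 !natrM.
  by rewrite !mulr1n; lra.
rewrite ler_pdivrMr// (mulrAC (cos y)) ler_pdivlMr//.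
by apply: ler_pM => //; [exact: ltW|exact: sin_le (ltW y0)].
Qed.

Lemma half_sum_le K phi : (1 < K)%N ->
  (1 - (pi / (2 * K%:R)) ^+ 2 / 6) * (half_sum K phi / K%:R) <= 2 / pi.
Proof.
move=> K1; have K0 : (0 < K)%N by apply: ltn_trans K1.
have Kr : 0 < K%:R :> R by rewrite ltr0n.
have pi0 := @pi_gt0 R.
have /andP[_] := half_sum_bounds phi K0.
set y : R := pi / (2 * K%:R) => H.
have y0 : 0 < y by rewrite divr_gt0// mulr_gt0.
have ypi : y < pi.
  rewrite /y ltr_pdivrMr ?mulr_gt0// ltr_pMr//.
  have : 1 <= K%:R :> R by rewrite ler1n.
  lra.
have sy : 0 < sin y by apply: sin_gt0_pi; rewrite y0.
have S0 : 0 <= half_sum K phi by apply: sumr_ge0.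
rewrite (two_div_pi (lt0r_neq0 pi0) (lt0r_neq0 Kr)) -/y.
rewrite mulrA ler_pdivrMr// invfM mulfVK ?lt0r_neq0//.
have h := sin_ge (ltW y0).
rewrite -(ler_pM2l y0) mulfV ?lt0r_neq0//.
have : sin y * half_sum K phi <= 1.
  by apply: le_trans (ler_wpM2l (ltW sy) H) _; rewrite mulfV ?lt0r_neq0.
apply: le_trans; rewrite mulrA ler_wpM2r//; apply: le_trans h.
by rewrite le_eqVlt; apply/orP; left; apply/eqP; field.
Qed.

End AbsCos.

(** * Random walks with steps in the roots of unity *)

Section Expi.
Variable R : realType.
Implicit Types (a b c x y t v w phi : R).

Definition expi x : R[i] := (cos x +i* sin x)%C.

Lemma expiD x y : expi (x + y) = expi x * expi y.
Proof.
by apply/eqP; rewrite eq_complex /= sinD cosD; apply/andP; split; apply/eqP; ring.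
Qed.

Lemma expi0 : expi 0 = 1.
Proof. by rewrite /expi cos0 sin0. Qed.

Lemma normc_expi x : normc (expi x) = 1.
Proof. by rewrite /normc /expi cos2Dsin2 sqrtr1. Qed.

Lemma expi_sum (I : Type) (r : seq I) (F : I -> R) :
  expi (\sum_(i <- r) F i) = \prod_(i <- r) expi (F i).
Proof. by rewrite (big_morph expi expiD expi0). Qed.

Lemma expi2pi (k : nat) x : expi (x + 2 * pi * k%:R) = expi x.
Proof.
have e : 2 * pi * k%:R = pi *+ 2 *+ k :> R by rewrite mulr_natr mulr_natl.
rewrite /expi e; congr (_ +i* _)%C; apply: periodicn.
  exact: cosD2pi.
exact: sinD2pi.
Qed.

Lemma complex_sum (I : Type) (r : seq I) (F G : I -> R) :
  \sum_(i <- r) (F i +i* G i)%C = ((\sum_(i <- r) F i) +i* (\sum_(i <- r) G i))%C.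
Proof.
elim: r => [|i r IH]; first by rewrite !big_nil.
by rewrite !big_cons IH.
Qed.

(** The argument comes from the phases of a one-entry pattern. *)
Lemma polar (z : R[i]) : exists phi, z = (normc z * cos phi +i* (normc z * sin phi))%C.
Proof.
have [->|z0] := eqVneq z 0.
  by exists 0; rewrite normc0 !mul0r.
have nz : normc z != 0 by apply: contra_neq z0 => /eq0_normc.
pose a (j : multi_index (fun _ : 'I_0 => 0%N)) : R[i] := z / (normc z)%:C%C.
have [|t _ ta] := @pattern_phase R 0 _ a.
  move=> j; rewrite /a normcM normcV.
  have -> : normc (normc z)%:C%C = normc z.
    by rewrite {1}/normc /= expr0n addr0 sqrtr_sqr ger0_norm// /normc; case: (z) => u v; exact: sqrtr_ge0.
  by rewrite mulfV.
have j : multi_index (fun _ : 'I_0 => 0%N) by apply: finfun => -[].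
exists (t j); have : phase_pattern t j = z / (normc z)%:C%C by rewrite ta.
move=> /(congr1 (fun u : R[i] => u * (normc z)%:C%C)); rewrite mulfVK; last first.
  by rewrite eq_complex /= eqxx andbT.
move=> e; rewrite -{1}e /phase_pattern; move: (normc z) => s.
by apply/eqP; rewrite eq_complex /=; apply/andP; split; apply/eqP; ring.
Qed.

End Expi.

Section Favg.
Variables (R : realType) (T : finType).
Implicit Types F G : T -> R.

Definition favg F : R := #|T|%:R^-1 * \sum_t F t.

Lemma eq_favg F G : F =1 G -> favg F = favg G.
Proof. by move=> FG; rewrite /favg; congr (_ * _); apply: eq_bigr => t _. Qed.

Lemma favgZ c F : favg (fun t => c * F t) = c * favg F.
Proof. by rewrite /favg -mulr_sumr mulrCA. Qed.

Lemma favgD F G : favg (fun t => F t + G t) = favg F + favg G.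
Proof. by rewrite /favg big_split mulrDr. Qed.

Lemma le_favg F G : (forall t, F t <= G t) -> favg F <= favg G.
Proof. by move=> FG; rewrite ler_wpM2l ?invr_ge0//; apply: ler_sum => t _. Qed.

Lemma favg_ge0 F : (forall t, 0 <= F t) -> 0 <= favg F.
Proof. by move=> F0; rewrite mulr_ge0 ?invr_ge0 ?sumr_ge0. Qed.

Lemma favg_cst c : (0 < #|T|)%N -> favg (fun=> c) = c.
Proof.
move=> T0; rewrite /favg sumr_const -[c *+ _]mulr_natl mulrA mulVf ?mul1r//.
by rewrite pnatr_eq0 -lt0n.
Qed.

Lemma favg_sum (I : Type) (r : seq I) (F : I -> T -> R) :
  favg (fun t => \sum_(i <- r) F i t) = \sum_(i <- r) favg (F i).
Proof. by rewrite /favg exchange_big mulr_sumr. Qed.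

Lemma favg_reindex (h : T -> T) F : injective h -> favg (fun t => F (h t)) = favg F.
Proof. by move=> hi; rewrite /favg [in RHS](reindex_inj hi). Qed.

Lemma favg_exists F c : (0 < #|T|)%N -> c <= favg F -> exists t, c <= F t.
Proof.
move=> T0 cF; apply/not_existsP => h.
have : favg F < favg (fun=> c).
  rewrite /favg ltr_pM2l ?invr_gt0 ?ltr0n//.
  case/card_gt0P: T0 => t0 _.
  apply: ltr_sum => [|t _]; first by apply/hasP; exists t0; rewrite ?mem_index_enum.
  by rewrite ltNge; apply/negP/h.
by rewrite favg_cst// ltNge cF.
Qed.

End Favg.

Section Walk.
Variables (R : realType) (N' n : nat).
Local Notation N := N'.+1.
Local Notation walk := {ffun 'I_n -> 'I_N}.

Definition walk_re (w : walk) : R := \sum_j cos (angle R N (w j)).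
Definition walk_im (w : walk) : R := \sum_j sin (angle R N (w j)).
Definition walk_end (w : walk) : R[i] := \sum_j expi (angle R N (w j)).

Lemma walk_endE w : walk_end w = (walk_re w +i* walk_im w)%C.
Proof. by rewrite /walk_end /expi complex_sum. Qed.

Lemma expi_angleD (a b : 'I_N) : expi (angle R N (a + b)%R) = expi (angle R N a) * expi (angle R N b).
Proof.
rewrite -expiD /=.
have -> : angle R N a + angle R N b = angle R N ((a + b) %% N)%N + 2 * pi * ((a + b) %/ N)%N%:R.
  have N0 : N%:R != 0 :> R by rewrite pnatr_eq0.
  have -> : angle R N a + angle R N b = angle R N (a + b)%N by rewrite /angle natrD; ring.
  rewrite {1}(divn_eq (a + b) N) /angle natrD natrM mulrDr mulrDl addrC; congr (_ + _).
  by field.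
by rewrite expi2pi.
Qed.

Lemma walk_end_rot (w : walk) (k : 'I_N) :
  walk_end (w + [ffun=> k]) = walk_end w * expi (angle R N k).
Proof.
rewrite /walk_end mulr_suml; apply: eq_bigr => j _.
by rewrite !ffunE expi_angleD.
Qed.

(** As the steps are independent, the sum of the exponentials over all walks is a
product. *)
Lemma favg_cos_walk K t : N = (K + K)%N ->
  favg (fun w : walk => cos (t * walk_re w)) = bessel N t ^+ n.
Proof.
move=> NK.
have K0 : (0 < K)%N by case: K NK.
have Nr : N%:R != 0 :> R by rewrite pnatr_eq0.
have s0 : \sum_(k < N) sin (t * cos (angle R N k)) = 0.
  have -> : \sum_(k < N) sin (t * cos (angle R N k)) =
     \sum_(k < K + K) sin (t * cos (angle R N k)).
    by rewrite -!(big_mkord xpredT (fun k => sin (t * cos (angle R N k)))) NK.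
  rewrite big_split_ord /= -big_split big1// => k _ /=.
  have -> : angle R N (K + k)%N = angle R N k + pi.
    rewrite /angle natrD mulrDr mulrDl addrC; congr (_ + _).
    rewrite NK natrD in Nr *; have K1 : K%:R != 0 :> R by rewrite pnatr_eq0 -lt0n.
    by field.
  by rewrite cosDpi mulrN sinN subrr.
have c0 : \sum_(k < N) cos (t * cos (angle R N k)) = N%:R * bessel N t.
  by rewrite /bessel /avg mulrA mulfV// mul1r.
have H : \sum_(w : walk) expi (t * walk_re w) = ((N%:R * bessel N t) ^+ n)%:C%C.
  transitivity (\sum_(w : walk) \prod_j expi (t * cos (angle R N (w j)))).
    by apply: eq_bigr => w _; rewrite /walk_re mulr_sumr expi_sum.
  rewrite -(bigA_distr_bigA (fun (j : 'I_n) (k : 'I_N) => expi (t * cos (angle R N k)))).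
  by rewrite prodr_const card_ord /expi complex_sum c0 s0; exact: (esym (rmorphXn (real_complex R) n _)).
move: H; rewrite /expi complex_sum => -[H _].
rewrite /favg H card_ffun !card_ord natrX exprMn mulrA mulVf ?mul1r//.
Qed.

Lemma card_walk_gt0 : (0 < #|{: walk}|)%N.
Proof. by rewrite card_ffun !card_ord expn_gt0. Qed.

Lemma favg_shift (k : walk) (F : walk -> R) : favg (fun w : walk => F (w + k)) = favg F.
Proof. exact: (favg_reindex F (addIr k)). Qed.

Definition mean_re : R := favg (fun w : walk => `|walk_re w|).
Definition mean_dist : R := favg (fun w : walk => normc (walk_end w)).

(** Rotating a walk by a root of unity is a bijection on walks, so the modulus of the
real part may be averaged over all these rotations first. *)
Lemma mean_reE K : N = (K + K)%N -> exists phi : walk -> R,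
  mean_re = favg (fun w => normc (walk_end w) * (half_sum K (phi w) / K%:R)).
Proof.
move=> NK; have K0 : (0 < K)%N by case: K NK.
have /choice[phi hphi] : forall w : walk, exists p,
    walk_end w = (normc (walk_end w) * cos p +i* (normc (walk_end w) * sin p))%C.
  by move=> w; exact: polar.
have hre (w : walk) (k : 'I_N) :
    walk_re (w + [ffun=> k]) = normc (walk_end w) * cos (phi w + angle R N k).
  have := walk_end_rot w k; rewrite walk_endE {1}hphi /expi => /eqP.
  by rewrite eq_complex /= => /andP[/eqP -> _]; rewrite cosD; ring.
exists phi; have Nr : N%:R != 0 :> R by rewrite pnatr_eq0.
have Kr : K%:R != 0 :> R by rewrite pnatr_eq0 -lt0n.
have step (w : walk) : normc (walk_end w) * (half_sum K (phi w) / K%:R) =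
    N%:R^-1 * \sum_(k < N) `|walk_re (w + [ffun=> k])|.
  have -> : \sum_(k < N) `|walk_re (w + [ffun=> k])| =
      \sum_(k < N) normc (walk_end w) * `|cos (phi w + angle R N k)|.
    apply: eq_bigr => k _; rewrite hre normrM; congr (_ * _).
    by rewrite ger0_norm//; case: (walk_end w) => u v; exact: sqrtr_ge0.
  rewrite -mulr_sumr [RHS]mulrCA; congr (_ * _).
  have -> : \sum_(k < N) `|cos (phi w + angle R N k)| =
      \sum_(k < K + K) `|cos (phi w + angle R N k)|.
    by rewrite -!(big_mkord xpredT (fun k => `|cos (phi w + angle R N k)|)) NK.
  have aE (k : nat) : angle R N k = k%:R * (pi / K%:R).
    rewrite /angle NK natrD; move: (pi : R) (K%:R : R) (k%:R : R) Kr => p x y x0.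
    by rewrite (_ : x + x = 2 * x); [field|ring].
  rewrite big_split_ord /=.
  rewrite [X in _ * (_ + X)](_ : _ = half_sum K (phi w)); last first.
    apply: eq_bigr => k _; rewrite aE natrD mulrDl (mulrC _ (pi / _)) mulfVK//.
    by rewrite [X in phi w + X]addrC addrA norm_cosDpi.
  rewrite [X in _ * (X + _)](_ : _ = half_sum K (phi w)); last first.
    by apply: eq_bigr => k _; rewrite aE.
  rewrite NK natrD; move: (half_sum _ _) (K%:R : R) Kr => p x x0.
  by rewrite (_ : x + x = 2 * x); [field|ring].
rewrite (eq_favg step) favgZ favg_sum.
rewrite (eq_bigr (fun=> mean_re)); last by move=> k _; rewrite (favg_shift _ (fun w => `|walk_re w|)).
by rewrite sumr_const card_ord -[mean_re *+ _]mulr_natl mulrA mulVf// mul1r.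
Qed.

Lemma mean_re_ge K : N = (K + K)%N ->
  2 / pi * (1 - (pi / (2 * K%:R)) ^+ 2 / 2) * mean_dist <= mean_re.
Proof.
move=> NK; have K0 : (0 < K)%N by case: K NK.
have [phi ->] := mean_reE NK; rewrite /mean_dist -favgZ; apply: le_favg => w.
rewrite mulrC ler_wpM2l//; last exact: half_sum_ge.
by case: (walk_end w) => u v; exact: sqrtr_ge0.
Qed.

Lemma mean_re_le K : (1 < K)%N -> N = (K + K)%N ->
  (1 - (pi / (2 * K%:R)) ^+ 2 / 6) * mean_re <= 2 / pi * mean_dist.
Proof.
move=> K1 NK; have [phi ->] := mean_reE NK.
rewrite /mean_dist -!favgZ; apply: le_favg => w.
rewrite mulrCA [leRHS]mulrC ler_wpM2l//; last exact: half_sum_le.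
by case: (walk_end w) => u v; exact: sqrtr_ge0.
Qed.

End Walk.

(** * Comparison of the characteristic function with a Gaussian *)

Section Transfer.
Variable (R : realType).
Implicit Types (a b c x y t v X s q : R).

Lemma integ_cos_kernel X a b : 0 < a <= b ->
  `|X| * (pi / 2) - X ^+ 2 * a / 2 - 3 / b <= integ a b (cos_kernel X) <= `|X| * (pi / 2).
Proof.
move=> ab; have /andP[a0 ab'] := ab.
have -> : integ a b (cos_kernel X) = integ a b (cos_kernel `|X|).
  apply: eq_integ => t _; rewrite /cos_kernel.
  have [X0|X0] := leP 0 X; first by rewrite ger0_norm.
  by rewrite ltr0_norm// mulNr cosN.
rewrite le_integ_cos_kernel// andbT -(real_normK (num_real X)).
have := normr_ge0 X; rewrite le_eqVlt => /predU1P[<-|X0]; last exact: ge_integ_cos_kernel.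
rewrite expr0n !mul0r !sub0r oppr0 add0r; apply: (@le_trans _ _ 0).
  by rewrite oppr_le0 divr_ge0// (le_trans (ltW a0)).
by apply: integ_ge0 => t _; rewrite /cos_kernel divr_ge0 ?sqr_ge0// subr_ge0 cos_le1.
Qed.

Definition bessel_kernel N n t : R := (1 - bessel N t ^+ n) / t ^+ 2.

Lemma derivable_bessel_kernel N n a b : 0 < a -> derivable_on a b (bessel_kernel N n).
Proof.
move=> a0 x /andP[ax _]; have x0 : x != 0 by rewrite gt_eqF// (lt_le_trans a0).
have h := drv_bessel N x.
by apply: drv_derivable; rewrite /bessel_kernel; drv; rewrite expf_neq0.
Qed.

(** Both sides are finite means over the walks, and [favg_cos_walk] turns the mean of
[cos_kernel] into [bessel_kernel]. *)
Lemma integ_bessel_kernel N' n K a b : N'.+1 = (K + K)%N -> 0 < a <= b ->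
  mean_re R N' n * (pi / 2) - n%:R ^+ 2 * a / 2 - 3 / b
    <= integ a b (bessel_kernel N'.+1 n) <= mean_re R N' n * (pi / 2).
Proof.
move=> NK ab; have /andP[a0 ab'] := ab; set N := N'.+1.
have W0 := card_walk_gt0 N' n.
have dk X : derivable_on a b (cos_kernel X) by exact: derivable_cos_kernel.
have e : integ a b (bessel_kernel N n) =
    favg (fun w : {ffun 'I_n -> 'I_N} => integ a b (cos_kernel (walk_re R w))).
  have [dS eS] := integ_sum (index_enum {: {ffun 'I_n -> 'I_N}})
    (fun w => dk (walk_re R w)).
  rewrite /favg -eS -integZ//; apply: eq_integ => t _.
  rewrite /bessel_kernel -(favg_cos_walk n t NK) /favg.
  rewrite /cos_kernel -mulr_suml mulrA; congr (_ / _).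
  rewrite sumrB mulrBr; congr (_ - _).
    by have := favg_cst (1 : R) W0.
  by congr (_ * _); apply: eq_bigr => w _; rewrite mulrC.
have wn (w : {ffun 'I_n -> 'I_N}) : walk_re R w ^+ 2 <= n%:R ^+ 2.
  apply: sqr_le_sqr; rewrite -ler_norml; apply: le_trans (ler_norm_sum _ _ _) _.
  apply: (@le_trans _ _ (\sum_(j < n) 1)); first by apply: ler_sum => j _; exact: cos_max.
  by rewrite sumr_const card_ord.
rewrite e; apply/andP; split.
  apply: (@le_trans _ _ (favg (fun w : {ffun 'I_n -> 'I_N} =>
     (pi / 2) * `|walk_re R w| + (- (n%:R ^+ 2 * a / 2) - 3 / b)))).
    by rewrite favgD favgZ favg_cst// -/(mean_re R N' n); lra.
  apply: le_favg => w; have /andP[h _] := integ_cos_kernel (walk_re R w) ab.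
  by have := ler_wpM2r (ltW a0) (wn w); lra.
rewrite mulrC /mean_re -favgZ; apply: le_favg => w.
by have /andP[_ h] := integ_cos_kernel (walk_re R w) ab; rewrite mulrC.
Qed.

(** From one power to the next, the gap is multiplied by [A >= q] and then
increased by [J^(m+2) * (A - J)]. *)
Lemma pow_gap_near A J q m : 0 <= J <= A -> 0 <= q <= A ->
  q ^+ m * (A ^+ 2 - J ^+ 2) <= A ^+ m.+2 - J ^+ m.+2.
Proof.
move=> /andP[J0 JA] /andP[q0 qA]; have A0 := le_trans q0 qA.
elim: m => [|m IH]; first by rewrite mul1r.
have g0 : 0 <= A ^+ m.+2 - J ^+ m.+2 by rewrite subr_ge0 lerXn2r ?nnegrE.
rewrite exprS -mulrA; apply: (@le_trans _ _ (q * (A ^+ m.+2 - J ^+ m.+2))).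
  by rewrite ler_wpM2l.
apply: (@le_trans _ _ (A * (A ^+ m.+2 - J ^+ m.+2))); first by rewrite ler_wpM2r.
rewrite mulrBr -exprS lerD2l lerN2 exprS ler_wpM2r// exprn_ge0//.
Qed.

Lemma pow_gap_far A J q m : 0 <= A -> `|J| <= q ->
  - (q ^+ m * J ^+ 2) <= A ^+ m.+2 - J ^+ m.+2.
Proof.
move=> A0 Jq; have := exprn_ge0 m.+2 A0.
have : J ^+ m.+2 <= q ^+ m * J ^+ 2.
  apply: le_trans (ler_norm _) _; rewrite normrX -addn2 exprD real_normK ?num_real//.
  by rewrite ler_wpM2r ?sqr_ge0// lerXn2r ?nnegrE// (le_trans _ Jq).
lra.
Qed.

(** The comparison between [n] steps and a Gaussian is at least [q^(n-2)] times the
one for two steps, up to the Gaussian tail which the latter also contains. *)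
Lemma transfer N m a b : (10 < N)%N -> 0 < a <= 183 / 100 -> 183 / 100 <= b ->
  (forall t, 183 / 100 <= t <= b -> `|bessel N t| <= 43 / 100) ->
  integ a b (gauss_kernel (Num.sqrt m.+2%:R / 2)) +
  (43 / 100) ^+ m * (integ a b (bessel_kernel N 2) -
     integ a b (gauss_kernel (Num.sqrt 2 / 2)) - integ (183 / 100) b (@gauss_tail R))
  <= integ a b (bessel_kernel N m.+2).
Proof.
move=> N10 /andP[a0 ac] cb far; set c := 183 / 100 in ac cb far *; set q := 43 / 100 in far *.
have acb : a <= c <= b by rewrite ac.
have c0 : 0 < c by apply: lt_le_trans ac.
have q0 : 0 <= q by rewrite /q; lra.
pose A t := expR (- (t ^+ 2 / 4)).
have near t : 0 <= t <= c -> 0 <= bessel N t <= A t /\ q <= A t by exact: bessel_near.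
clearbody q c.
have gE n t : gauss_kernel (Num.sqrt n%:R / 2) t = (1 - A t ^+ n) / t ^+ 2.
  rewrite /gauss_kernel /A -expRM_natl; congr ((1 - expR _) / _).
  by rewrite !exprMn sqr_sqrtr ?ler0n//; field.
have tE t : gauss_tail t = A t ^+ 2 / t ^+ 2.
  by rewrite /gauss_tail /A -expRM_natl; congr (expR _ / _); field.
have A0 t : 0 <= A t by exact: expR_ge0.
clearbody A.
have dg s x y : 0 < x -> derivable_on x y (gauss_kernel s) by exact: derivable_gauss_kernel.
have db n x y : 0 < x -> derivable_on x y (bessel_kernel N n) by exact: derivable_bessel_kernel.
have dt x y : 0 < x -> derivable_on x y (@gauss_tail R).
  move=> x0 t /andP[xt _]; have t0 : t != 0 by rewrite gt_eqF// (lt_le_trans x0).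
  by apply: drv_derivable; rewrite /gauss_tail; drv; rewrite expf_neq0.
pose s1 : R := Num.sqrt m.+2%:R / 2; pose s2 : R := Num.sqrt 2 / 2.
rewrite -/s1 -/s2.
have dsub x y f g : derivable_on x y f -> derivable_on x y g -> derivable_on x y (fun t => f t - g t).
  by move=> df dg' t tx; apply: derivableB; [exact: df|exact: dg'].
have dadd x y f g : derivable_on x y f -> derivable_on x y g -> derivable_on x y (fun t => f t + g t).
  by move=> df dg' t tx; apply: derivableD; [exact: df|exact: dg'].
have dmul x y k f : derivable_on x y f -> derivable_on x y (fun t => k * f t).
  by move=> df t tx; apply: derivableZ; exact: df.
have near_part : integ a c (gauss_kernel s1) + q ^+ m *
    (integ a c (bessel_kernel N 2) - integ a c (gauss_kernel s2))
    <= integ a c (bessel_kernel N m.+2).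
  rewrite -integB -?integZ -?integD; try solve [auto 10].
  apply: le_integ; [solve [auto 10]|solve [auto 10]|].
  move=> t /andP[at_ tc]; have t0 : 0 < t by apply: lt_le_trans at_.
  rewrite /s1 /s2 !gE /bessel_kernel -mulrBl mulrA -mulrDl ler_wpM2r ?invr_ge0 ?sqr_ge0//.
  have [|JA qA] := near t; first by rewrite (ltW t0).
  have qA' : 0 <= q <= A t by rewrite q0.
  have := pow_gap_near m JA qA'; rewrite !mulrBr mulr1.
  by move: (A t ^+ m.+2) (bessel N t ^+ m.+2) (q ^+ m * A t ^+ 2) (q ^+ m * bessel N t ^+ 2) (q ^+ m) => *; lra.
have far_part : integ c b (gauss_kernel s1) + q ^+ m *
    (integ c b (bessel_kernel N 2) - integ c b (gauss_kernel s2) - integ c b (@gauss_tail R))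
    <= integ c b (bessel_kernel N m.+2).
  rewrite -!integB -?integZ -?integD; try solve [auto 10].
  apply: le_integ; [solve [auto 10]|solve [auto 10]|].
  move=> t /andP[ct tb]; have t0 : 0 < t by apply: lt_le_trans ct.
  rewrite tE /s1 /s2 !gE /bessel_kernel -!mulrBl mulrA -mulrDl ler_wpM2r ?invr_ge0 ?sqr_ge0//.
  clear near_part; have tcb : c <= t <= b by rewrite ct.
  have := pow_gap_far m (A0 t) (far t tcb); rewrite !mulrBr mulr1.
  by move: (A t ^+ m.+2) (bessel N t ^+ m.+2) (q ^+ m * A t ^+ 2) (q ^+ m * bessel N t ^+ 2) (q ^+ m) => *; lra.
rewrite (integ_split acb (dg s1 _ _ a0)) (integ_split acb (db 2 _ _ a0)).
rewrite (integ_split acb (dg s2 _ _ a0)) (integ_split acb (db m.+2 _ _ a0)).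
move: near_part far_part.
move: (integ a c (gauss_kernel s1)) (integ c b (gauss_kernel s1)) (integ a c (gauss_kernel s2))
  (integ c b (gauss_kernel s2)) (integ a c (bessel_kernel N m.+2)) (integ c b (bessel_kernel N m.+2))
  (integ a c (bessel_kernel N 2)) (integ c b (bessel_kernel N 2)) (integ c b (@gauss_tail R)) (q ^+ m).
by move=> *; lra.
Qed.

Lemma normc_expiD x y : normc (expi x + expi y) = 2 * `|cos ((x - y) / 2)|.
Proof.
have -> : expi x + expi y = expi ((x + y) / 2) * ((2 * cos ((x - y) / 2)) +i* 0)%C.
  have -> : expi x = expi ((x + y) / 2) * expi ((x - y) / 2) by rewrite -expiD; congr expi; field.
  have -> : expi y = expi ((x + y) / 2) * expi (- ((x - y) / 2)) by rewrite -expiD; congr expi; field.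
  rewrite -mulrDr /expi cosN sinN; congr (_ * _).
  by apply/eqP; rewrite eq_complex /= subrr eqxx andbT; apply/eqP; ring.
by rewrite normcM normc_expi mul1r /normc /= expr0n addr0 sqrtr_sqr normrM ger0_norm.
Qed.

(** Rotating the first step alone makes the two steps form all angles; their sum has
modulus twice the absolute value of a cosine. *)
Lemma mean_dist2_ge N' :
  2 * (2 / pi * (1 - (pi / (2 * N'.+1%:R)) ^+ 2 / 2)) <= mean_dist R N' 2.
Proof.
pose kappa (k : 'I_N'.+1) : {ffun 'I_2 -> 'I_N'.+1} := [ffun j => if j == ord0 then k else 0].
have -> : mean_dist R N' 2 = favg (fun w : {ffun 'I_2 -> 'I_N'.+1} =>
   N'.+1%:R^-1 * \sum_(k < N'.+1) normc (walk_end R (w + kappa k))).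
  rewrite favgZ favg_sum (eq_bigr (fun=> mean_dist R N' 2)); last first.
    by move=> k _; rewrite (favg_shift _ (fun w => normc (walk_end R w))).
  by rewrite sumr_const card_ord -[mean_dist _ _ _ *+ _]mulr_natl mulrA mulVf ?mul1r// pnatr_eq0.
rewrite -(favg_cst (2 * _) (card_walk_gt0 N' 2)); apply: le_favg => w.
pose x := angle R N'.+1 (w ord0); pose y := angle R N'.+1 (w (lift ord0 ord0)).
have -> : \sum_(k < N'.+1) normc (walk_end R (w + kappa k)) = 2 * half_sum N'.+1 ((x - y) / 2).
  rewrite /half_sum mulr_sumr; apply: eq_bigr => k _.
  rewrite /walk_end !big_ord_recl big_ord0 addr0 !ffunE eqxx.
  rewrite (_ : (lift ord0 ord0 == ord0 :> 'I_2) = false)// expi_angleD addr0 -expiD normc_expiD.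
  congr (2 * `|cos _|); rewrite -/x -/y /angle; move: (pi : R) (x) (y) => p u v.
  have : N'.+1%:R != 0 :> R by rewrite pnatr_eq0.
  by move: (N'.+1%:R : R) (k%:R : R) => * ; field.
by rewrite [leRHS]mulrCA ler_wpM2l// [leRHS]mulrC half_sum_ge.
Qed.

End Transfer.

(** * The mean distance reached by a random walk *)

Section RandomWalk.
Variable (R : realType).
Implicit Types (a b c x y t v X s q e : R).

Lemma sqrt_pi_le2 : Num.sqrt pi <= 2 :> R.
Proof.
rewrite -(@ler_pXn2r _ 2) ?nnegrE// sqr_sqrtr ?pi_ge0//.
have := pi_lt R; lra.
Qed.

(** The mean distance [4 / pi] of the walk with two steps exceeds the Gaussian value
by about 0.0199, the Gaussian tail of [integ_gauss_tail] being less than 0.0186. *)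
Lemma slack_gt0 : 0 < 4 / pi - Num.sqrt 2 / 2 * Num.sqrt pi - 186 / 100 / 100 :> R.
Proof.
have p1 := pi_lt R; have p0 := @pi_gt0 R.
have h1 : 14 / 11 <= 4 / pi :> R.
  by rewrite ler_pdivlMr//; lra.
have h2 : Num.sqrt 2 / 2 * Num.sqrt pi <= 1567 / 1250 :> R.
  have -> : Num.sqrt 2 / 2 * Num.sqrt pi = Num.sqrt (pi / 2) :> R.
    have -> : pi / 2 = (2 / 4) * pi :> R by field.
    rewrite sqrtrM ?divr_ge0// sqrtrM// sqrtrV// (_ : 4 = 2 ^+ 2); last by ring.
    by rewrite sqrtr_sqr ger0_norm.
  have u0 : 0 <= 1567 / 1250 :> R by lra.
  have ph : 0 <= pi / 2 :> R by lra.
  rewrite -(@ler_pXn2r _ 2) ?nnegrE ?sqrtr_ge0// sqr_sqrtr//.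
  by lra.
by move: (4 / pi) (_ * Num.sqrt pi) h1 h2 => u v; clear; lra.
Qed.

Lemma mean_re_le_steps N' n : mean_re R N' n <= n%:R.
Proof.
rewrite -(favg_cst (n%:R : R) (card_walk_gt0 N' n)); apply: le_favg => w.
apply: le_trans (ler_norm_sum _ _ _) _.
apply: (@le_trans _ _ (\sum_(j < n) 1)); first by apply: ler_sum => j _; exact: cos_max.
by rewrite sumr_const card_ord.
Qed.

Lemma mean_dist1 N' : mean_dist R N' 1 = 1.
Proof.
rewrite -[RHS](favg_cst (1 : R) (card_walk_gt0 N' 1)); apply: eq_favg => w.
by rewrite /walk_end big_ord_recl big_ord0 addr0 normc_expi.
Qed.

Lemma mean_re2_ge N' K : N'.+1 = (K + K)%N -> (pi / (2 * K%:R)) ^+ 2 <= 1 :> R ->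
  4 / pi - 2 * (pi / (2 * K%:R)) ^+ 2 <= mean_re R N' 2 * (pi / 2).
Proof.
move=> NK; have K0 : (0 < K)%N by case: K NK.
have Kr : 0 < K%:R :> R by rewrite ltr0n.
have p0 := @pi_gt0 R; have p2 := @pi_ge2 R.
set z := (pi / (2 * K%:R)) ^+ 2 => z1.
have z0 : 0 <= z by rewrite sqr_ge0.
have h1 := @mean_re_ge R N' 2 K NK; rewrite -/z in h1.
have h2 := mean_dist2_ge R N'; rewrite NK natrD in h2.
have z' : (pi / (2 * (K%:R + K%:R))) ^+ 2 <= z :> R.
  have KK : 0 < 2 * (K%:R + K%:R) :> R by lra.
  have K2 : 0 < 2 * K%:R :> R by lra.
  have le : pi / (2 * (K%:R + K%:R)) <= pi / (2 * K%:R) :> R.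
    by apply: ler_wpM2l; [exact: ltW|rewrite lef_pV2 ?posrE//; lra].
  have ge : 0 <= pi / (2 * (K%:R + K%:R)) :> R by rewrite divr_ge0// ltW.
  by apply: lerXn2r; rewrite ?nnegrE// (le_trans ge).
move: z' h2; set z'' := (_ / _) ^+ 2 => z' h2.
have q0 : 0 <= 2 / pi :> R by rewrite divr_ge0// ltW.
have c0 : 0 <= 1 - z / 2 by lra.
have h3 : 2 * (2 / pi * (1 - z / 2)) <= mean_dist R N' 2.
  by apply: le_trans h2; rewrite ler_pM2l// ler_wpM2l//; lra.
have h4 := ler_wpM2l (mulr_ge0 q0 c0) h3.
have h5 := le_trans h4 h1.
have ph : 0 <= pi / 2 :> R by rewrite divr_ge0// ltW.
apply: le_trans (ler_wpM2r ph h5).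
have -> : 2 / pi * (1 - z / 2) * (2 * (2 / pi * (1 - z / 2))) * (pi / 2) = 4 / pi * (1 - z / 2) ^+ 2.
  by move: (lt0r_neq0 p0); move: (pi : R) z {z1 z0 h1 z' q0 c0 h3 h4 h5} => p z pn; field.
have q1 : 4 / pi <= 2 :> R by rewrite ler_pdivrMr//; lra.
have q2 : 0 <= 4 / pi :> R by rewrite divr_ge0// ltW.
move: (4 / pi) q1 q2 => q q1 q2.
have : 0 <= q * z ^+ 2 by rewrite mulr_ge0// sqr_ge0.
have : 0 <= (2 - q) * z by rewrite mulr_ge0// subr_ge0.
clear; lra.
Qed.

(** One step is trivial as [pi <= 4]; otherwise the integrals are cut off at [tau] and
[2 / tau], with [tau] and then the mesh of the roots of unity small compared with
the slack and with [e]. *)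
Theorem mean_dist_ge n e : (0 < n)%N -> 0 < e -> exists K0 : nat, forall K N',
  (K0 <= K)%N -> N'.+1 = (K + K)%N ->
  Num.sqrt n%:R / 2 * Num.sqrt pi - e <= mean_dist R N' n.
Proof.
move=> n0 e0; case: n n0 => // -[_|m _].
  exists 0%N => K N' _ _; rewrite mean_dist1 sqrtr1.
  by have := sqrt_pi_le2; lra.
set n := m.+2; have p0 := @pi_gt0 R.
pose sigma : R := 4 / pi - Num.sqrt 2 / 2 * Num.sqrt pi - 186 / 100 / 100.
have sg0 : 0 < sigma by exact: slack_gt0.
have nr : 0 < n%:R :> R by rewrite ltr0n.
pose tau : R := Num.min 1 (Num.min (sigma / 10) (e / (2 * n%:R + 4))).
have tau0 : 0 < tau by rewrite !lt_min ltr01 !divr_gt0// ?addr_gt0 ?mulr_gt0.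
have tau1 : tau <= 1 by rewrite ge_min lexx.
have tau2 : tau <= sigma / 10 by rewrite !ge_min lexx orbT.
have tau3 : tau <= e / (2 * n%:R + 4) by rewrite !ge_min lexx !orbT.
pose b : R := 2 / tau.
have b2 : 2 <= b by rewrite ler_pdivlMr//; lra.
have b0 : 0 < b by lra.
have cb : 183 / 100 <= b by lra.
have ac : 0 < tau <= 183 / 100 by rewrite tau0/=; lra.
have tab : 0 < tau <= b by rewrite tau0 /=; lra.
have bV : b^-1 = tau / 2 by rewrite /b invf_div.
have [N1 far] := bessel_far b.
(* [kap] will bound the square of a quarter of the mesh *)
pose kap : R := Num.min 1 (Num.min (sigma / 4) (e / (2 * n%:R))).
have kap0 : 0 < kap by rewrite !lt_min ltr01 !divr_gt0// ?addr_gt0 ?mulr_gt0.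
have kap1 : kap <= 1 by rewrite ge_min lexx.
have kap2 : kap <= sigma / 4 by rewrite !ge_min lexx orbT.
have kap3 : kap <= e / (2 * n%:R) by rewrite !ge_min lexx !orbT.
exists (N1 + 11 + (Num.truncn (4 / kap)).+1)%N => K N' hK NK.
have hK1 : (N1 <= N'.+1)%N.
  by rewrite NK; apply: leq_trans (leq_addr _ _); apply: leq_trans hK; rewrite -addnA leq_addr.
have hK2 : (10 < N'.+1)%N.
  rewrite NK; apply: leq_trans (leq_addr _ _); apply: leq_trans hK.
  by rewrite addnAC leq_addl.
have hK3 : (1 < K)%N.
  by apply: leq_trans hK; rewrite addnAC; apply: leq_trans (leq_addl _ _).
have Kr : 0 < K%:R :> R by rewrite ltr0n (ltn_trans _ hK3).
pose z : R := (pi / (2 * K%:R)) ^+ 2.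
have zk : z <= kap.
  have K4 : 4 / kap <= K%:R.
    apply: (@le_trans _ _ (Num.truncn (4 / kap)).+1%:R); first by rewrite ltW// truncnS_gt.
    by rewrite ler_nat (leq_trans _ hK)// leq_addl.
  have K1 : 1 <= K%:R :> R by rewrite ler1n (ltn_trans _ hK3).
  have y2 : pi / (2 * K%:R) <= 2 / K%:R :> R.
    have -> : 2 / K%:R = 4 / (2 * K%:R) :> R by field; rewrite lt0r_neq0.
    apply: ler_wpM2r; first by rewrite invr_ge0 mulr_ge0// ltW.
    by have := pi_lt R; lra.
  apply: (@le_trans _ _ ((2 / K%:R) ^+ 2)).
    by apply: lerXn2r; rewrite ?nnegrE ?divr_ge0 ?mulr_ge0 ?(ltW p0) ?(ltW Kr).
  rewrite expr_div_n ler_pdivrMr ?exprn_gt0//; move: K4; rewrite ler_pdivrMr// => K4.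
  rewrite (_ : 2 ^+ 2 = 4); last by ring.
  apply: le_trans K4 _; rewrite mulrC ler_wpM2l ?(ltW kap0)// expr2 ler_peMl// ltW.
have z0 : 0 <= z by rewrite sqr_ge0.
have B2 := @integ_bessel_kernel R N' 2 K tau b NK tab.
have Bn := @integ_bessel_kernel R N' n K tau b NK tab.
have s0 k : 0 < Num.sqrt k.+1%:R / 2 :> R by rewrite divr_gt0// sqrtr_gt0 ltr0n.
have G2 := integ_gauss_kernel (s0 1%N) tab.
have Gn := integ_gauss_kernel (s0 m.+1) tab.
have T := integ_gauss_tail cb.
have Tr := @transfer R N'.+1 m tau b hK2 ac cb (fun t => far N'.+1 t hK1).
have M2 : 4 / pi - 2 * z <= mean_re R N' 2 * (pi / 2).
  by apply: mean_re2_ge => //; apply: le_trans kap1.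
have sq k : (Num.sqrt k%:R / 2) ^+ 2 = k%:R / 4 :> R.
  by rewrite exprMn sqr_sqrtr ?ler0n//; field.
rewrite !sq in G2 Gn.
have Q0 : 0 <= (43 / 100) ^+ m :> R by rewrite exprn_ge0// divr_ge0.
rewrite bV in B2 Bn G2 Gn.
move: Tr; rewrite -/n; set i1 := integ _ _ (gauss_kernel _) in Gn *.
set i2 := integ _ _ (bessel_kernel _ 2) in B2 *.
set i3 := integ _ _ (gauss_kernel _) in G2 *.
set i4 := integ _ _ _ in T *; set i5 := integ _ _ _ in Bn * => Tr.
have brk : 0 <= i2 - i3 - i4.
  clear Tr; case/andP: B2 => B2 _; case/andP: G2 => _ G2.
  move: B2 G2 T M2 zk tau2 kap2 sg0; rewrite /sigma.
  move: i2 i3 i4 (mean_re R N' 2 * (pi / 2)) (Num.sqrt 2 / 2 * Num.sqrt pi) (4 / pi).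
  clear => *; lra.
have h1 := mulr_ge0 Q0 brk.
have h2 : i1 <= i5 by apply: le_trans Tr; rewrite lerDl.
case/andP: Gn => Gn _; case/andP: Bn => _ Bn.
have h3 := @mean_re_le R N' n K hK3 NK; rewrite -/z in h3.
have h4 := mean_re_le_steps N' n.
have h5 : (1 - z / 6) * (mean_re R N' n * (pi / 2)) <= mean_dist R N' n.
  have ph : 0 <= pi / 2 :> R by rewrite divr_ge0// ltW.
  have -> : mean_dist R N' n = pi / 2 * (2 / pi * mean_dist R N' n).
    move: (lt0r_neq0 p0); move: (mean_dist _ _ _) (pi : R); clear => d p pn.
    by field.
  by rewrite [leLHS](_ : _ = pi / 2 * ((1 - z / 6) * mean_re R N' n)) ?ler_wpM2l//; ring.
have h6 : mean_re R N' n * (pi / 2) <= 2 * n%:R.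
  have pp : pi / 2 <= 2 :> R by have := pi_lt R; clear; lra.
  rewrite mulrC; apply: ler_pM => //; first by rewrite divr_ge0// ltW.
  by apply: favg_ge0.
have h7 : z * (mean_re R N' n * (pi / 2)) <= e.
  apply: le_trans (ler_wpM2l z0 h6) _; apply: le_trans (_ : kap * (2 * n%:R) <= _).
    by rewrite ler_wpM2r// mulr_ge0.
  by move: kap3; rewrite ler_pdivlMr// mulr_gt0.
have h8 : (2 * n%:R + 4) * tau <= e.
  by move: tau3; rewrite ler_pdivlMr ?addr_gt0 ?mulr_gt0// mulrC.
move: h2 Gn Bn h5 h7 h8; rewrite mulrBl mul1r.
clear Tr brk h1; move: (mean_re R N' n * (pi / 2)) (mean_dist R N' n) (Num.sqrt n%:R / 2 * Num.sqrt pi) i1 i5.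
by move: (n%:R : R) e0 tau0; clear => *; lra.
Qed.

End RandomWalk.

(** * Weighted walks *)

Section Khinchin.
Variable (R : realType).
Implicit Types (x y t c e : R) (z u v : R[i]).

Lemma normc_ge0 z : 0 <= normc z.
Proof. by case: z => x y; exact: sqrtr_ge0. Qed.

Lemma normc_real x : 0 <= x -> normc x%:C%C = x.
Proof. by move=> x0; rewrite /normc /= expr0n addr0 sqrtr_sqr ger0_norm. Qed.

Lemma normc_expiB x y : normc (expi x - expi y) <= `|x - y|.
Proof.
have -> : - expi y = expi (y + pi).
  by rewrite /expi cosDpi sinDpi.
rewrite normc_expiD.
have -> : (x - (y + pi)) / 2 = (x - y) / 2 - pi / 2 by move: (pi : R) => p; field.
rewrite cosBpihalf; set d := (x - y) / 2.
have -> : `|x - y| = 2 * `|d|.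
  by rewrite /d normrM [`|2^-1|]ger0_norm ?invr_ge0// mulrC divfK ?pnatr_eq0.
have main (f : R) : 0 <= f -> `|sin f| <= f.
  move=> f0; rewrite ler_norml sin_le// andbT.
  have [f2|f2] := leP f pi.
    by apply: le_trans (_ : 0 <= _); [rewrite oppr_le0|apply: sin_ge0_pi; rewrite f0].
  by have := pi_ge2 R; have := sin_geN1 f; lra.
rewrite ler_pM2l//; have [d0|d0] := leP 0 d; first by rewrite (ger0_norm d0); exact: main.
by rewrite (ltr0_norm d0) -normrN -sinN; apply: main; rewrite oppr_ge0 ltW.
Qed.

Lemma expi_angle_mod N' (m : nat) : expi (angle R N'.+1 (m %% N'.+1)) = expi (angle R N'.+1 m).
Proof.
rewrite [in RHS](divn_eq m N'.+1).
have -> : angle R N'.+1 (m %/ N'.+1 * N'.+1 + m %% N'.+1)%N =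
   angle R N'.+1 (m %% N'.+1) + 2 * pi * (m %/ N'.+1)%:R.
  rewrite /angle natrD natrM mulrDr mulrDl addrC; congr (_ + _).
  by rewrite mulrA mulfK// pnatr_eq0.
by rewrite expi2pi.
Qed.

Lemma normcB_ge z u : normc z - normc (z - u) <= normc u.
Proof.
have := le_normcD (z - u) u; rewrite subrK; lra.
Qed.

(** The integer part of the argument, in units of [2 * pi / N], gives the root. *)
Lemma root_approx N' z : exists k : 'I_N'.+1,
  normc (z - (normc z)%:C%C * expi (angle R N'.+1 k)) <= normc z * (2 * pi / N'.+1%:R).
Proof.
have [phi0 hz0] := polar z.
have p0 := @pi_gt0 R.
pose phi : R := phi0 + 2 * pi * (Num.truncn `|phi0|).+1%:R.
have ph0 : 0 <= phi.
  have h := @truncnS_gt R `|phi0|; have := ler_norm (- phi0); rewrite normrN => h2.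
  have p2 := pi_ge2 R.
  have : 1 * (Num.truncn `|phi0|).+1%:R <= 2 * pi * (Num.truncn `|phi0|).+1%:R :> R.
    by apply: ler_wpM2r => //; lra.
  rewrite /phi; lra.
have hz : z = (normc z)%:C%C * expi phi.
  rewrite /phi expi2pi {1}hz0; move: (normc z) => s.
  by apply/eqP; rewrite eq_complex /=; apply/andP; split; apply/eqP; ring.
pose h : R := 2 * pi / N'.+1%:R.
have h0 : 0 < h by rewrite divr_gt0// mulr_gt0.
pose m := Num.truncn (phi / h).
have /andP[m1 m2] : m%:R <= phi / h < m.+1%:R by apply: truncn_itv; rewrite divr_ge0// ltW.
exists (Ordinal (ltn_pmod m (ltn0Sn N'))) => /=.
rewrite expi_angle_mod {1}hz -mulrBr normcM normc_real ?normc_ge0//.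
rewrite ler_wpM2l ?normc_ge0//; apply: le_trans (normc_expiB _ _) _.
have -> : angle R N'.+1 m = m%:R * h by rewrite /angle /h; ring.
move: m1 m2; rewrite ler_pdivlMr// ltr_pdivrMr// -[m.+1%:R]natr1 mulrDl mul1r => m1 m2.
by rewrite -/h ger0_norm; lra.
Qed.

Variables (N' n' : nat).
Local Notation N := N'.+1.
Local Notation n := n'.+1.
Local Notation walk := {ffun 'I_n -> 'I_N}.

Definition weighted_walk (r : 'I_n -> R[i]) (w : walk) : R[i] :=
  \sum_j r j * expi (angle R N (w j)).

(** Averaging over the cyclic shifts of the weights replaces them by their mean,
by convexity; hence equal weights are the worst ones. *)
Lemma equal_weights_worst (r : 'I_n -> R) :
  (\sum_j r j) * mean_dist R N' n <= n%:R * favg (fun w : walk => normc (weighted_walk (fun j => (r j)%:C%C) w)).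
Proof.
have shift (c : 'I_n) : favg (fun w : walk => normc (weighted_walk (fun j => (r (j + c)%R)%:C%C) w)) =
    favg (fun w : walk => normc (weighted_walk (fun j => (r j)%:C%C) w)).
  pose h (w : walk) : walk := [ffun j => w (j + c)].
  have hi : injective h.
    move=> w1 w2 /ffunP e; apply/ffunP => j.
    by have := e (j - c); rewrite !ffunE subrK.
  rewrite -(favg_reindex _ hi); apply: eq_favg => w; congr normc.
  rewrite /weighted_walk [RHS](reindex_inj (addIr c)); apply: eq_bigr => j _.
  by rewrite ffunE.
have -> : n%:R * favg (fun w : walk => normc (weighted_walk (fun j => (r j)%:C%C) w)) =
   favg (fun w : walk => \sum_(c : 'I_n) normc (weighted_walk (fun j => (r (j + c)%R)%:C%C) w)).
  rewrite favg_sum (eq_bigr _ (fun (c : 'I_n) _ => shift c)) sumr_const card_ord.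
  by rewrite -[RHS]mulr_natl.
have [S0|S0] := leP 0 (\sum_j r j); last first.
  apply: (@le_trans _ _ 0).
    by rewrite nmulr_rle0//; apply: favg_ge0 => w; exact: normc_ge0.
  by apply: favg_ge0 => w; apply: sumr_ge0 => c _; exact: normc_ge0.
rewrite -favgZ; apply: le_favg => w.
apply: le_trans (normc_sum _).
rewrite /weighted_walk exchange_big /=.
have -> : \sum_(j < n) \sum_(i < n) (r (j + i)%R)%:C%C * expi (angle R N (w j)) =
   (\sum_j r j)%:C%C * walk_end R w.
  rewrite /walk_end mulr_sumr; apply: eq_bigr => j _.
  rewrite -mulr_suml; congr (_ * _).
  rewrite rmorph_sum /= [RHS](reindex_inj (addrI j)) /=; by [].
by rewrite normcM normc_real.
Qed.

(** The phases of [b] are first rounded to roots of unity, which the shift of the walk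
absorbs. *)
Lemma weighted_walk_ge (b : 'I_n -> R[i]) :
  (\sum_j normc (b j)) * (mean_dist R N' n / n%:R - 2 * pi / N%:R) <=
  favg (fun w : walk => normc (weighted_walk b w)).
Proof.
have /choice[kap hk] : forall j : 'I_n, exists k : 'I_N,
    normc (b j - (normc (b j))%:C%C * expi (angle R N k)) <= normc (b j) * (2 * pi / N%:R).
  by move=> j; exact: root_approx.
have n0 : 0 < n%:R :> R by rewrite ltr0n.
have H := equal_weights_worst (fun j => normc (b j)).
rewrite -(favg_shift [ffun j => kap j] (fun w => normc (weighted_walk (fun j => (normc (b j))%:C%C) w))) in H.
rewrite mulrBr mulrA lerBlDr ler_pdivrMr//.
apply: le_trans H _; rewrite mulrC ler_pM2r//.
rewrite -(favg_cst ((\sum_j normc (b j)) * (2 * pi / N%:R)) (card_walk_gt0 N' n)) -favgD.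
apply: le_favg => w.
apply: le_trans (_ : normc (weighted_walk b w) + \sum_j normc (b j) * (2 * pi / N%:R) <= _); last first.
  by rewrite -mulr_suml addrC.
set W := weighted_walk _ _.
have -> : W = weighted_walk (fun j => (normc (b j))%:C%C * expi (angle R N (kap j))) w.
  by apply: eq_bigr => j _; rewrite !ffunE addrC expi_angleD mulrA.
clear W; have := normcB_ge (weighted_walk (fun j => (normc (b j))%:C%C * expi (angle R N (kap j))) w) (weighted_walk b w).
rewrite lerBlDr => h; apply: le_trans h _; rewrite lerD2l.
rewrite /weighted_walk -sumrB; apply: le_trans (normc_sum _) _; apply: ler_sum => j _.
rewrite -mulrBl normcM normc_expi mulr1.
by apply: le_trans (hk j); rewrite -[leRHS]normcN opprB.
Qed.

End Khinchin.

(** * Contraction of arrays and the lower bound *)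

Section Greedy.
Variable (R : realType).
Implicit Types (c e : R).

(** A value of the walk that is at least as good as the mean. *)
Lemma khinchin_choice n c : (0 < n)%N -> c < Num.sqrt pi / 2 ->
  forall (I : finType) (b : I -> 'I_n -> R[i]),
  exists2 x : 'I_n -> R[i], (forall j, normc (x j) = 1) &
    c / Num.sqrt n%:R * (\sum_i \sum_j normc (b i j)) <=
    \sum_i normc (\sum_j b i j * x j).
Proof.
case: n => // n' _ cpi I b; set n := n'.+1.
have p0 := @pi_gt0 R; have p1 := pi_lt R.
pose s : R := Num.sqrt n%:R.
have nr : 0 < n%:R :> R by rewrite ltr0n.
have s0 : 0 < s by rewrite sqrtr_gt0.
have ss : s ^+ 2 = n%:R by rewrite sqr_sqrtr// ltW.
pose g : R := Num.sqrt pi / 2 - c.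
have g0 : 0 < g by rewrite subr_gt0.
have e0 : 0 < g * s / 2 by rewrite divr_gt0// mulr_gt0.
have [K0 hK0] := mean_dist_ge (ltn0Sn n') e0.
pose K := (K0 + (Num.truncn (8 * s / g)).+1)%N.
have K1 : (0 < K)%N by rewrite /K addnS.
have Kr : 0 < K%:R :> R by rewrite ltr0n.
have hK : 8 * s / g <= K%:R.
  apply: (@le_trans _ _ (Num.truncn (8 * s / g)).+1%:R); first by rewrite ltW// truncnS_gt.
  by rewrite ler_nat /K leq_addl.
pose N' := (K + K).-1.
have NK : N'.+1 = (K + K)%N by rewrite /N' prednK// addn_gt0 K1.
have := hK0 K N' (leq_addr _ _) NK; rewrite -/n -/s => hm.
have main : c / s <= mean_dist R N' n / n%:R - 2 * pi / N'.+1%:R.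
  have -> : 2 * pi / N'.+1%:R = pi / K%:R :> R.
    rewrite NK natrD; move: (lt0r_neq0 Kr) (pi : R); move: (K%:R : R); clear => k k0 p.
    by rewrite (_ : k + k = 2 * k); [field|ring].
  have h1 : pi / K%:R <= g / (2 * s) :> R.
    rewrite ler_pdivrMr// mulrAC ler_pdivlMr ?mulr_gt0//.
    move: hK; rewrite ler_pdivrMr// => hK.
    have : 0 <= (4 - pi) * s by rewrite mulr_ge0 ?(ltW s0)// subr_ge0; clear -p1; lra.
    by move: hK; clear; lra.
  have h2 : (s / 2 * Num.sqrt pi - g * s / 2) / n%:R <= mean_dist R N' n / n%:R.
    by rewrite ler_wpM2r// invr_ge0 ltW.
  have e : (s / 2 * Num.sqrt pi - g * s / 2) / n%:R = c / s + g / (2 * s).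
    rewrite -ss /g; move: (lt0r_neq0 s0); move: (s) (Num.sqrt pi); clear => s p s0.
    by field.
  by move: h1 h2; rewrite e; clear; lra.
have S0 : 0 <= \sum_i \sum_j normc (b i j).
  by apply: sumr_ge0 => i _; apply: sumr_ge0 => j _; exact: normc_ge0.
have [w hw] : exists w : {ffun 'I_n -> 'I_N'.+1},
    c / s * (\sum_i \sum_j normc (b i j)) <= \sum_i normc (weighted_walk (b i) w).
  apply: favg_exists; first exact: card_walk_gt0.
  rewrite favg_sum mulr_sumr; apply: ler_sum => i _.
  apply: le_trans (weighted_walk_ge N' (b i)); rewrite mulrC ler_wpM2l//.
  by apply: sumr_ge0 => j _; exact: normc_ge0.
by exists (fun j => expi (angle R N'.+1 (w j))) => // j; exact: normc_expi.
Qed.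

End Greedy.

Section Contraction.
Variables (R : realType) (m : nat) (n : 'I_m -> nat).
Local Notation idx := (multi_index n).
Implicit Types (j : idx) (P : {set 'I_m}) (F : idx -> R[i]) (k : 'I_m).

Definition upd j k (l : 'I_(n k)) : idx := finfun (@eqtype.dfwith _ (fun k => 'I_(n k)) (fun k => j k) k l).

Lemma updE j k (l : 'I_(n k)) : upd j l k = l.
Proof. by rewrite /upd ffunE eqtype.dfwith_in. Qed.

Lemma upd_neq j k k' (l : 'I_(n k)) : k' != k -> upd j l k' = j k'.
Proof. by move=> kk; rewrite /upd ffunE eqtype.dfwith_out// eq_sym. Qed.

Lemma idxP j j' : (forall k, j k = j' k) -> j = j'.
Proof. by move=> h; apply/ffunP. Qed.

(** The exchange of [l] with the coordinate [k] of [j] is an involution of the pairs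
[(j, l)]. *)
Lemma sum_upd k (G : idx -> R) :
  \sum_j \sum_(l < n k) G (upd j l) = (n k)%:R * \sum_j G j.
Proof.
rewrite pair_big /=.
pose h (p : idx * 'I_(n k)) := (upd p.1 p.2, p.1 k).
have hK : involutive h.
  move=> [j l]; rewrite /h /= updE; congr (_, _); apply: idxP => k'.
  have [->|kk] := eqVneq k' k; first by rewrite updE.
  by rewrite !upd_neq.
rewrite (reindex_inj (inv_inj hK)) /=.
rewrite (eq_bigr (fun p => G p.1)); last first.
  move=> [j l] _ /=; congr G; apply: idxP => k'.
  have [->|kk] := eqVneq k' k; first by rewrite updE.
  by rewrite !upd_neq.
rewrite -(pair_big predT predT (fun j (_ : 'I_(n k)) => G j)) /=.
rewrite mulr_sumr; apply: eq_bigr => j _.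
by rewrite sumr_const card_ord mulr_natl.
Qed.

Definition partial_sum F P j : R[i] :=
  \sum_(j' : idx | [forall k, (k \notin P) ==> (j' k == j k)]) F j'.

Lemma partial_sum0 F j : partial_sum F finset.set0 j = F j.
Proof.
rewrite /partial_sum (big_pred1 j)// => j'; apply/forallP/eqP => [h|-> k]; last by rewrite eqxx implybT.
by apply: idxP => k; apply/eqP; have := h k; rewrite inE.
Qed.

Lemma partial_sumT F P j : (forall k, k \in P) -> partial_sum F P j = \sum_j' F j'.
Proof. by move=> hP; apply: eq_bigl => j'; apply/forallP => k; rewrite hP. Qed.

Lemma eq_partial_sum F P j j' : (forall k, k \notin P -> j k = j' k) -> partial_sum F P j = partial_sum F P j'.
Proof.
move=> h; apply: eq_bigl => i; apply: eq_forallb => k.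
by apply: implyb_id2l => kP; rewrite h.
Qed.

Lemma partial_sumU F P k (x : 'I_(n k) -> R[i]) j : k \notin P ->
  partial_sum (fun j => F j * x (j k)) (k |: P) j = \sum_(l < n k) partial_sum F P (upd j l) * x l.
Proof.
move=> kP.
transitivity (\sum_(l < n k) \sum_(j' : idx | [forall k', (k' \notin P) ==> (j' k' == upd j l k')]) F j' * x l);
  last by apply: eq_bigr => l _; rewrite mulr_suml.
rewrite (exchange_big_dep predT) //= [RHS](bigID (fun j' : idx => [forall k', (k' \notin k |: P) ==> (j' k' == j k')])) /=.
rewrite [X in _ = _ + X]big1 ?addr0; last first.
  move=> j' nj; rewrite big_pred0// => l; apply: contraNF nj => /forallP h.
  apply/forallP => k'; apply/implyP; rewrite !inE negb_or => /andP[kk k'P].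
  by have := h k'; rewrite k'P upd_neq.
apply: eq_bigr => j' /forallP hj.
rewrite (big_pred1 (j' k))// => l; apply/forallP/eqP => [h|-> k'].
  by have := h k; rewrite kP updE => /eqP.
apply/implyP => k'P; have [->|kk] := eqVneq k' k; first by rewrite updE.
by have := hj k'; rewrite !inE negb_or kk k'P upd_neq.
Qed.

Lemma partial_sumU1 F P k j : k \notin P ->
  partial_sum F (k |: P) j = \sum_(l < n k) partial_sum F P (upd j l).
Proof.
move=> kP; transitivity (partial_sum (fun j => F j * 1) (k |: P) j).
  by apply: eq_bigr => i _; rewrite mulr1.
by rewrite (@partial_sumU F P k (fun=> 1))//; apply: eq_bigr => l _; rewrite mulr1.
Qed.

Definition knob_prod (x : knob_setting R n) (P : {set 'I_m}) j : R[i] := \prod_(k in P) x k (j k).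

(** The contracted array stays indexed by all of [idx], being constant along the
coordinates in [P]: this avoids changing the type of the indices, and sums over
[idx] count each entry [prod_(k in P) n k] times. *)
Definition contract (a : idx -> R[i]) (x : knob_setting R n) P j : R[i] :=
  partial_sum (fun j => a j * knob_prod x P j) P j.

Lemma contractU a x P k j : k \notin P ->
  contract a x (k |: P) j = \sum_(l < n k) contract a x P (upd j l) * x k l.
Proof.
move=> kP; rewrite /contract -partial_sumU//; apply: eq_bigr => i _.
by rewrite /knob_prod big_setU1//= [x k _ * _]mulrC mulrA.
Qed.

Lemma eq_contract a x y P j : (forall k, k \in P -> x k =1 y k) ->
  contract a x P j = contract a y P j.
Proof.
move=> xy; apply: eq_bigr => i _; congr (_ * _); apply: eq_bigr => k kP.
by rewrite xy.
Qed.

Lemma contract_setT a x P j : (forall k, k \in P) -> contract a x P j = rotated_sum a x.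
Proof.
move=> hP; rewrite /contract partial_sumT//; apply: eq_bigr => i _; congr (_ * _).
by apply: eq_bigl => k; rewrite hP.
Qed.

(** Contracting the coordinate [k] gains [c / sqrt (n k)] by [khinchin_choice] and
[n k] by the repeated counting of entries. *)
Lemma contract_greedy (c : R) (s : seq 'I_m) a : 0 <= c -> c < Num.sqrt pi / 2 ->
  (forall k, (0 < n k)%N) -> uniq s ->
  exists2 x, unimodular x &
    c ^+ size s * (\prod_(k <- s) Num.sqrt (n k)%:R) * (\sum_j normc (a j)) <=
    \sum_j normc (contract a x [set k in s] j).
Proof.
move=> c0 cpi n0; elim: s => [_|k s IH /= /andP[ks us]].
  exists (fun _ _ => 1); first exact: unimodular1.
  rewrite big_nil expr0 !mul1r; apply: ler_sum => j _; rewrite /contract.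
  have -> : [set k in [::]] = finset.set0 :> {set 'I_m} by apply/setP => k; rewrite !inE.
  by rewrite partial_sum0 /knob_prod big_set0 mulr1.
have [x xU hx] := IH us.
set P := [set k0 in s] in hx.
have kP : k \notin P by rewrite inE.
have [y yU hy] := khinchin_choice (n0 k) cpi (fun j (l : 'I_(n k)) => contract a x P (upd j l)).
pose x' : knob_setting R n := @eqtype.dfwith _ (fun k => 'I_(n k) -> R[i]) x k y.
have x'k : x' k = y by rewrite /x' eqtype.dfwith_in.
have x'P k' : k' != k -> x' k' = x k' by move=> kk; rewrite /x' eqtype.dfwith_out// eq_sym.
exists x'.
  move=> k'; have [->|kk] := eqVneq k' k; first by rewrite x'k.
  by rewrite x'P//; exact: xU.
have -> : [set k0 in k :: s] = k |: P by apply/setP => k0; rewrite !inE.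
have e j : contract a x' (k |: P) j = \sum_(l < n k) contract a x P (upd j l) * y l.
  rewrite contractU// x'k; apply: eq_bigr => l _; congr (_ * _).
  apply: eq_contract => k' k'P l'; rewrite x'P//.
  by apply: contraNneq kP => <-.
rewrite [leRHS](eq_bigr (fun j => normc (\sum_(l < n k) contract a x P (upd j l) * y l))); last first.
  by move=> j _; rewrite e.
apply: le_trans hy; rewrite (sum_upd k (fun j => normc (contract a x P j))).
have nk : 0 < (n k)%:R :> R by rewrite ltr0n.
have sk : 0 < Num.sqrt (n k)%:R :> R by rewrite sqrtr_gt0.
have -> : c / Num.sqrt (n k)%:R * ((n k)%:R * \sum_j normc (contract a x P j)) =
   c * Num.sqrt (n k)%:R * \sum_j normc (contract a x P j).
  rewrite mulrA; congr (_ * _); rewrite -{2}[(n k)%:R]sqr_sqrtr ?ltW//.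
  by field; rewrite lt0r_neq0.
rewrite big_cons exprS.
have -> : c * c ^+ size s * (Num.sqrt (n k)%:R * \prod_(j <- s) Num.sqrt (n j)%:R) *
   (\sum_j normc (a j)) = c * Num.sqrt (n k)%:R *
   (c ^+ size s * (\prod_(k <- s) Num.sqrt (n k)%:R) * (\sum_j normc (a j))) by ring.
by rewrite ler_wpM2l// mulr_ge0// ltW.
Qed.

Lemma unimodular_conj (z : R[i]) : exists2 u : R[i], normc u = 1 & z * u = (normc z)%:C%C.
Proof.
have [phi hz] := polar z; exists (expi (- phi)); first exact: normc_expi.
rewrite {1}hz /expi cosN sinN; move: (normc z) => s; have h := cos2Dsin2 phi.
apply/eqP; rewrite eq_complex /=; apply/andP; split; apply/eqP; last by ring.
by rewrite -[RHS]mulr1 -h; ring.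
Qed.

Lemma sum_card_idx : \sum_(j : idx) 1 = \prod_k (n k)%:R :> R.
Proof.
rewrite sumr_const -natr_prod; congr (_%:R).
by rewrite card_dep_ffun foldrE big_map big_enum /=; apply: eq_bigr => k _; rewrite card_ord.
Qed.

Lemma knob_sup_ge_const (a : idx -> R[i]) (c : R) k : 0 <= c -> c < Num.sqrt pi / 2 ->
  (forall k, (0 < n k)%N) -> is_pattern a ->
  c ^+ m.-1 * (Num.sqrt (\prod_k (n k)%:R) * Num.sqrt (n k)%:R) <= knob_sup a.
Proof.
move=> c0 cpi n0 aP.
pose s := rem k (enum 'I_m).
have us : uniq s by rewrite rem_uniq// enum_uniq.
have ss : size s = m.-1 by rewrite size_rem ?mem_enum// size_enum_ord.
have [x xU] := contract_greedy a c0 cpi n0 us.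
set P := [set k0 in s].
have memP k' : (k' \in P) = (k' != k) by rewrite inE mem_rem_uniq ?enum_uniq// !inE mem_enum andbT.
have kP : k \notin P by rewrite memP eqxx.
have e1 : \sum_j normc (a j) = \prod_k (n k)%:R.
  by rewrite -sum_card_idx; apply: eq_bigr => j _; exact: aP.
rewrite ss e1 => hx.
pose j0 : idx := finfun (fun k' => Ordinal (n0 k')).
have /choice[y hy] : forall l : 'I_(n k), exists u, normc u = 1 /\
    contract a x P (upd j0 l) * u = (normc (contract a x P (upd j0 l)))%:C%C.
  by move=> l; have [u u1 u2] := unimodular_conj (contract a x P (upd j0 l)); exists u.
pose x' : knob_setting R n := @eqtype.dfwith _ (fun k => 'I_(n k) -> R[i]) x k y.
have x'k : x' k = y by rewrite /x' eqtype.dfwith_in.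
have x'P k' : k' != k -> x' k' = x k' by move=> kk; rewrite /x' eqtype.dfwith_out// eq_sym.
have x'U : unimodular x'.
  move=> k'; have [->|kk] := eqVneq k' k; first by move=> l; rewrite x'k; case: (hy l).
  by rewrite x'P//; exact: xU.
have S0 : 0 <= \sum_(l < n k) normc (contract a x P (upd j0 l)).
  by apply: sumr_ge0 => l _; exact: normc_ge0.
apply: le_trans (knob_sup_ub a x'U).
have -> : normc (rotated_sum a x') = \sum_(l < n k) normc (contract a x P (upd j0 l)).
  rewrite -(@contract_setT a x' (k |: P) j0); last by move=> k'; rewrite finset.in_setU1 memP orbN.
  rewrite contractU// x'k -[RHS]normc_real// rmorph_sum /=; congr normc.
  apply: eq_bigr => l _; have [_ <-] := hy l; congr (_ * _).
  by apply: eq_contract => k' k'P l'; rewrite x'P// -memP.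
have N0 : 0 < \prod_k (n k)%:R :> R by apply: prodr_gt0 => k' _; rewrite ltr0n.
have hV : (n k)%:R * (\sum_j normc (contract a x P j)) =
   (\prod_k (n k)%:R) * \sum_(l < n k) normc (contract a x P (upd j0 l)).
  rewrite -(sum_upd k (fun j => normc (contract a x P j))) -sum_card_idx mulr_suml.
  apply: eq_bigr => j _; rewrite mul1r; apply: eq_bigr => l _; congr normc.
  apply: eq_partial_sum => k'; rewrite memP negbK => /eqP ->; by rewrite !updE.
rewrite -(ler_pM2l N0) -hV.
have nk : 0 < (n k)%:R :> R by rewrite ltr0n.
apply: le_trans (ler_wpM2l (ltW nk) hx).
rewrite le_eqVlt; apply/orP; left; apply/eqP.
have -> : Num.sqrt (\prod_k (n k)%:R) = Num.sqrt (n k)%:R * \prod_(k0 <- s) Num.sqrt (n k0)%:R :> R.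
  have -> : Num.sqrt (\prod_k (n k)%:R) = \prod_k Num.sqrt (n k)%:R :> R.
    suff [] : 0 <= \prod_k (n k)%:R :> R /\
        Num.sqrt (\prod_k (n k)%:R) = \prod_k Num.sqrt (n k)%:R :> R by [].
    elim/big_ind2: _ => [|u1 u2 v1 v2 [h1 <-] [h2 <-]|k' _].
    - by rewrite sqrtr1.
    - by rewrite sqrtrM// mulr_ge0.
    - by rewrite ler0n.
  by rewrite -[LHS]big_enum /= (perm_big _ (perm_to_rem (mem_enum _ k))) big_cons.
have e2 : Num.sqrt (n k)%:R * Num.sqrt (n k)%:R = (n k)%:R :> R.
  by rewrite -expr2 sqr_sqrtr// ltW.
rewrite -[X in _ = X * _]e2.
by move: (Num.sqrt _) (\prod_(k0 <- s) _) (\prod_k0 _) (c ^+ _) => u v w z; ring.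
Qed.

End Contraction.

(** * Chained Fourier matrices and the upper bound *)

Section Fourier.
Variable (R : realType).
Implicit Types (x y : R) (z : R[i]).

Lemma sqr_normcE z : (normc z ^+ 2)%:C%C = z * conjc z.
Proof.
case: z => a b; rewrite /normc sqr_sqrtr ?addr_ge0 ?sqr_ge0//.
by apply/eqP; rewrite eq_complex /=; apply/andP; split; apply/eqP; ring.
Qed.

Lemma conjc_expi x : conjc (expi x) = expi (- x).
Proof. by rewrite /expi cosN sinN. Qed.

Lemma conjcM z z' : conjc (z * z') = conjc z * conjc z'.
Proof. exact: rmorphM. Qed.

Lemma conjc_sum (I : Type) (r : seq I) (F : I -> R[i]) :
  conjc (\sum_(i <- r) F i) = \sum_(i <- r) conjc (F i).
Proof. exact: rmorph_sum. Qed.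

(** Otherwise the sine of [x / 2] would vanish. *)
Lemma expi_neq1 x : - (2 * pi) < x < 2 * pi -> x != 0 -> expi x != 1.
Proof.
move=> /andP[x1 x2] x0; apply/negP => /eqP; rewrite /expi => -[c1 _].
have p0 := @pi_gt0 R.
have : sin (x / 2) != 0.
  have [xp|xn|xe] := ltgtP 0 x; last by rewrite -xe eqxx in x0.
    by rewrite lt0r_neq0// sin_gt0_pi//; apply/andP; split; lra.
  by rewrite -oppr_eq0 -sinN lt0r_neq0// sin_gt0_pi//; apply/andP; split; lra.
move/eqP; apply; apply/eqP; rewrite -sqrf_eq0.
have := sqr_half_sin (x / 2); rewrite mulrC divfK ?pnatr_eq0// c1 subrr => /esym/eqP.
by rewrite mulf_eq0 pnatr_eq0.
Qed.

(** Multiplying the geometric sum by its ratio, which is not 1, leaves it unchanged. *)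
Lemma sum_roots N (l l' : 'I_N) :
  \sum_(k < N) expi (angle R N (l * k)%N - angle R N (l' * k)%N) = (if l == l' then N%:R else 0).
Proof.
have [->|ll'] := eqVneq l l'.
  rewrite (eq_bigr (fun=> 1)); last by move=> k _; rewrite subrr expi0.
  by rewrite sumr_const card_ord.
have N0 : (0 < N)%N by case: N l {l' ll'} => // -[].
have Nr : 0 < N%:R :> R by rewrite ltr0n.
have p0 := @pi_gt0 R.
pose x : R := angle R N l - angle R N l'.
have xk k : angle R N (l * k)%N - angle R N (l' * k)%N = k%:R * x.
  by rewrite /x /angle !natrM; ring.
rewrite (eq_bigr (fun k : 'I_N => expi (k%:R * x))); last by move=> k _; rewrite xk.
have ex : expi x != 1.
  have aN (k : 'I_N) : 0 <= angle R N k < 2 * pi.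
    rewrite /angle divr_ge0 ?mulr_ge0 ?(ltW p0)//= ltr_pdivrMr// ltr_pM2l ?mulr_gt0//.
    by rewrite ltr_nat.
  apply: expi_neq1; first by case/andP: (aN l); case/andP: (aN l') => *; rewrite /x; apply/andP; split; lra.
  rewrite /x subr_eq0; apply: contraNneq ll' => e; apply/eqP/val_inj => /=; apply/eqP.
  rewrite -(eqr_nat R); apply/eqP.
  have : 2 * pi / N%:R != 0 :> R by rewrite lt0r_neq0// divr_gt0// mulr_gt0.
  move/mulfI; apply; move: e; rewrite /angle => e.
  by rewrite mulrAC e; ring.
have eN : expi (N%:R * x) = 1.
  rewrite /x mulrBr /angle.
  have h (k : nat) : N%:R * (2 * pi * k%:R / N%:R) = 0 + 2 * pi * k%:R :> R.
    by rewrite add0r mulrC divfK// lt0r_neq0.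
  rewrite !h expiD -conjc_expi !expi2pi conjc_expi -expiD addrN expi0 //.
set S := \sum_(k < N) _; suff : (expi x - 1) * S = 0.
  by move/eqP; rewrite mulf_eq0 subr_eq0 (negbTE ex) => /eqP.
rewrite mulrBl mul1r mulr_sumr -sumrB.
rewrite (eq_bigr (fun k : 'I_N => expi (k.+1%:R * x) - expi (k%:R * x))); last first.
  by move=> k _; rewrite -expiD -[k.+1%:R]natr1; congr (expi _ - _); ring.
rewrite -(big_mkord xpredT (fun k => expi (k.+1%:R * x) - expi (k%:R * x))) telescope_sumr//.
by rewrite eN mul0r expi0 subrr.
Qed.

(** The orthogonality of the characters, [sum_roots], for the first [p] of them. *)
Lemma fourier_isometry N p (pN : (p <= N)%N) (v : 'I_p -> R[i]) :
  \sum_(k < N) normc (\sum_(l < p) v l * expi (angle R N (l * k)%N)) ^+ 2 =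
  N%:R * \sum_(l < p) normc (v l) ^+ 2.
Proof.
suff : (\sum_(k < N) normc (\sum_(l < p) v l * expi (angle R N (l * k)%N)) ^+ 2)%:C%C =
  (N%:R * \sum_(l < p) normc (v l) ^+ 2)%:C%C by case.
rewrite rmorph_sum rmorphM rmorph_sum /= rmorph_nat.
transitivity (\sum_(k < N) \sum_(l < p) \sum_(l' < p) v l * conjc (v l') *
   expi (angle R N (l * k)%N - angle R N (l' * k)%N)).
  apply: eq_bigr => k _; rewrite sqr_normcE conjc_sum mulr_suml; apply: eq_bigr => l _.
  rewrite mulr_sumr; apply: eq_bigr => l' _.
  by rewrite conjcM conjc_expi expiD; ring.
rewrite exchange_big mulr_sumr; apply: eq_bigr => l _ /=.
rewrite exchange_big (bigD1 l)//= [X in _ + X]big1 => [|l' ll'].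
  rewrite addr0 -mulr_sumr -sqr_normcE mulrC; congr (_ * _).
  have := sum_roots (widen_ord pN l) (widen_ord pN l); rewrite eqxx => <-.
  by [].
rewrite -mulr_sumr.
have := sum_roots (widen_ord pN l) (widen_ord pN l').
rewrite (_ : (_ == _) = false); last first.
  by apply: contraNF ll' => /eqP/(congr1 val)/= e; apply/eqP/val_inj.
by move=> /= ->; rewrite mulr0.
Qed.

(** The variance of [f] is nonnegative. *)
Lemma sqr_sum_le p (f : 'I_p -> R) : (\sum_l f l) ^+ 2 <= p%:R * \sum_l f l ^+ 2.
Proof.
case: p f => [f|p' f]; first by rewrite !big_ord0 expr0n mulr0.
set p := p'.+1.
have pr : 0 < p%:R :> R by rewrite ltr0n.
set S := \sum_l f l.
have : 0 <= \sum_l (p%:R * f l - S) ^+ 2 by apply: sumr_ge0 => l _; exact: sqr_ge0.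
have -> : \sum_l (p%:R * f l - S) ^+ 2 = p%:R * (p%:R * (\sum_l f l ^+ 2) - S ^+ 2).
  rewrite (eq_bigr (fun l => p%:R ^+ 2 * f l ^+ 2 + (- (2 * p%:R * S) * f l + S ^+ 2))); last first.
    by move=> l _; ring.
  rewrite !big_split /= -!mulr_sumr sumr_const card_ord -/S -[S *+ _]mulr_natl -/p; ring.
by rewrite pmulr_rge0// subr_ge0.
Qed.

End Fourier.

Section Chain.
Variables (R : realType) (m : nat) (n : 'I_m -> nat).
Local Notation idx := (multi_index n).
Implicit Types (j : idx) (k : 'I_m) (s t : seq 'I_m).

Fixpoint chain s j : R[i] :=
  if s is k :: s' then
    (if s' is k' :: _ then expi (angle R (n k') (j k * j k')%N) else 1) * chain s' j
  else 1.

Lemma chain_cons k k' s j : chain (k :: k' :: s) j =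
  expi (angle R (n k') (j k * j k')%N) * chain (k' :: s) j.
Proof. by []. Qed.

Lemma chain_pattern s : is_pattern (chain s).
Proof.
move=> j; elim: s => [|k s IH]; first exact: normc1.
by rewrite /= normcM IH mulr1; case: s {IH} => [|k' s]; [exact: normc1|exact: normc_expi].
Qed.

Lemma eq_chain s j j' : {in s, forall k, j k = j' k} -> chain s j = chain s j'.
Proof.
elim: s => //= k s IH h; rewrite IH => [|k' k's]; last by apply: h; rewrite inE k's orbT.
case: s IH h => // k' s _ h; rewrite !h ?inE ?eqxx ?orbT//.
Qed.

(** The array contracted along [p] depends, apart from unimodular factors, on the
coordinate [k] alone. Passing from [k] to the next coordinate [k'] applies a
submatrix of the Fourier matrix of size [n k'], which explains the sorting. *)
Lemma chain_prefix p k t (x : knob_setting R n) : unimodular x ->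
  uniq (p ++ k :: t) -> sorted (fun k k' => n k <= n k')%N (p ++ k :: t) ->
  exists2 Phi : 'I_(n k) -> R[i],
    \sum_l normc (Phi l) ^+ 2 <= (n k)%:R * \prod_(k' <- p) (n k')%:R &
    forall j, partial_sum (fun j => chain (p ++ k :: t) j * \prod_k' x k' (j k')) [set k' in p] j =
      Phi (j k) * (chain (k :: t) j * \prod_(k' | k' \notin p) x k' (j k')).
Proof.
move=> xU; elim/last_ind: p k t => [|p k IH] k' t.
  move=> _ _; exists (fun=> 1).
    rewrite big_nil mulr1 (eq_bigr (fun=> 1)); first by rewrite sumr_const card_ord.
    by move=> l _; rewrite normc1 expr1n.
  move=> j.
  have -> : [set k' in [::]] = finset.set0 :> {set 'I_m} by apply/setP => i; rewrite !inE.
  by rewrite partial_sum0 mul1r.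
rewrite cat_rcons => us ss; have [Phi hPhi eqPhi] := IH k (k' :: t) us ss.
have nkk' : (n k <= n k')%N by have [_ /= /andP[]] := cat_sorted2 ss.
have [kp kt] : k \notin p /\ k \notin k' :: t.
  by move: us; rewrite cat_uniq /= => /and3P[_ /norP[-> _] /andP[-> _]].
exists (fun l' => \sum_l (Phi l * x k l) * expi (angle R (n k') (l * l')%N)).
  rewrite (fourier_isometry nkk') ler_wpM2l//.
  rewrite -cats1 big_cat big_cons big_nil /= mulr1 mulrC; apply: le_trans hPhi.
  by rewrite le_eqVlt; apply/orP; left; apply/eqP; apply: eq_bigr => l _; rewrite normcM xU mulr1.
move=> j.
have -> : [set i in rcons p k] = k |: [set i in p].
  by apply/setP => i; rewrite !inE mem_rcons !inE.
set F := (fun j => _ * _) in eqPhi *.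
rewrite partial_sumU1 ?inE// mulr_suml; apply: eq_bigr => l _.
rewrite eqPhi updE.
have ck : chain (k :: k' :: t) (upd j l) = expi (angle R (n k') (l * j k')%N) * chain (k' :: t) j.
  have k'k : k' != k by apply: contraNneq kt => <-; rewrite inE eqxx.
  rewrite chain_cons updE upd_neq//; congr (_ * _); apply: eq_chain => i it.
  by rewrite upd_neq//; apply: contraNneq kt => <-.
rewrite ck (bigD1 k)//= updE.
have -> : \prod_(i < m | (i \notin p) && (i != k)) x i (upd j l i) =
   \prod_(i < m | i \notin rcons p k) x i (j i).
  apply: eq_big => [i|i /andP[_ ik]]; last by rewrite upd_neq.
  by rewrite mem_rcons inE negb_or andbC.
by rewrite !mulrA; congr (_ * _); ring.
Qed.

Lemma chain_bound (x : knob_setting R n) s k : unimodular x ->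
  uniq (rcons s k) -> (forall i, i \in rcons s k) ->
  sorted (fun k k' => n k <= n k')%N (rcons s k) ->
  normc (rotated_sum (chain (rcons s k)) x) <=
    Num.sqrt (\prod_k (n k)%:R) * Num.sqrt (n k)%:R.
Proof.
move=> xU; rewrite -cats1 => us hs ss.
have [Phi hPhi eqPhi] := chain_prefix xU us ss.
set a := chain _ in eqPhi *; set F := (fun j => _ * _) in eqPhi.
have N0 : 0 <= \prod_k (n k)%:R :> R by apply: prodr_ge0 => i _; exact: ler0n.
have eN : \prod_k (n k)%:R = (n k)%:R * \prod_(i <- s) (n i)%:R :> R.
  rewrite -[LHS]big_enum /= (@perm_big _ _ _ _ _ (s ++ [:: k])).
    by rewrite big_cat big_cons big_nil /= mulr1 mulrC.
  by apply: uniq_perm => //; [exact: enum_uniq | move=> i; rewrite mem_enum hs].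
rewrite -sqrtrM// -[leLHS]ger0_norm ?normc_ge0// -sqrtr_sqr ler_wsqrtr//.
have [Z|[j]] : (rotated_sum a x = 0) \/ inhabited idx.
- have [e|/card_gt0P[j _]] := posnP #|idx|; last by right.
  by left; rewrite /rotated_sum big_pred0// => j; have := card0_eq e j; rewrite !inE.
- by rewrite Z normc0 expr0n mulr_ge0.
have -> : rotated_sum a x = \sum_(l < n k) Phi l * x k l.
  transitivity (partial_sum F (k |: [set i in s]) j).
    rewrite partial_sumT// => i; have := hs i; rewrite mem_cat !inE orbC; by [].
  have ks : k \notin s by move: us; rewrite cat_uniq /= orbF => /and3P[].
  rewrite partial_sumU1 ?inE//; apply: eq_bigr => l _.
  rewrite eqPhi updE /= !mul1r; congr (_ * _).
  rewrite (big_pred1 k) ?updE// => i /=.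
  have := hs i; rewrite mem_cat !inE; have [->|] := eqVneq i k; first by rewrite ks.
  by rewrite orbF => _ ->.
apply: (@le_trans _ _ ((\sum_(l < n k) normc (Phi l)) ^+ 2)).
  apply: lerXn2r; rewrite ?nnegrE ?normc_ge0//.
    by apply: sumr_ge0 => l _; exact: normc_ge0.
  apply: le_trans (normc_sum _) _; apply: ler_sum => l _.
  by rewrite normcM xU mulr1.
apply: le_trans (sqr_sum_le _) _; rewrite mulrC eN ler_wpM2r//.
Qed.

Lemma G1_le k0 : (forall k, (0 < n k)%N) ->
  G1 R n <= Num.sqrt (\prod_k (n k)%:R) * \big[Num.max/0]_k Num.sqrt (n k)%:R.
Proof.
move=> n0.
pose e k k' := (n k <= n k')%N.
have [s' [k]] : exists s' k, sort e (enum 'I_m) = rcons s' k.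
  have : k0 \in sort e (enum 'I_m) by rewrite mem_sort mem_enum.
  by case/lastP: (sort _ _) => // s' k _; exists s', k.
move=> es.
have us : uniq (rcons s' k) by rewrite -es sort_uniq enum_uniq.
have hs i : i \in rcons s' k by rewrite -es mem_sort mem_enum.
have ss : sorted e (rcons s' k) by rewrite -es sort_sorted// => i i'; exact: leq_total.
have [b _ [<- min]] := @G1_attained R m n.
apply: le_trans (min _ (chain_pattern (rcons s' k))) _.
apply: (@le_trans _ _ (Num.sqrt (\prod_k (n k)%:R) * Num.sqrt (n k)%:R)).
  apply: ge_sup; first by eexists; exists (fun _ _ => 1); first exact: unimodular1.
  by move=> _ [x xU <-]; apply: chain_bound.
by rewrite ler_wpM2l// le_bigmax.
Qed.

End Chain.

(** * The quotient *)

Section Main.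
Variables (R : realType) (m : nat) (n : 'I_m -> nat).
Local Open Scope classical_set_scope.

(** By continuity, from all constants below [sqrt pi / 2]. *)
Lemma knob_sup_ge (a : multi_index n -> R[i]) k :
  (forall k, (0 < n k)%N) -> is_pattern a ->
  (Num.sqrt pi / 2) ^+ m.-1 * (Num.sqrt (\prod_k (n k)%:R) * Num.sqrt (n k)%:R) <= knob_sup a.
Proof.
move=> n0 aP; set D := _ * Num.sqrt (n k)%:R; set s : R := Num.sqrt pi / 2.
have s0 : 0 < s by rewrite divr_gt0// sqrtr_gt0 pi_gt0.
have cv : c ^+ m.-1 * D @[c --> s^'-] --> s ^+ m.-1 * D.
  apply: cvg_at_left_filter; apply: cvgM; last exact: cvg_cst.
  exact: exprn_continuous.
apply: (cvgr_to_le cv); near=> c; apply: knob_sup_ge_const => //.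
- by near: c; exact: nbhs_left_ge.
Unshelve. all: by end_near. Qed.

Lemma bigmax_sqrt : (0 < m)%N -> exists k,
  \big[Num.max/0]_k Num.sqrt (n k)%:R = Num.sqrt (n k)%:R :> R.
Proof.
move=> m0; pose k0 := Ordinal m0.
have [k _ h] := @eq_bigmax _ _ _ 0 k0 predT (fun k => Num.sqrt (n k)%:R : R) isT (fun k _ => sqrtr_ge0 _).
by exists k.
Qed.

Lemma G1_quotient_bounds : (0 < m)%N -> (forall k, (0 < n k)%N) ->
  (Num.sqrt pi / 2) ^+ m.-1 <= G1_quotient R n <= 1.
Proof.
move=> m0 n0; pose k0 := Ordinal m0; have [k ek] := bigmax_sqrt m0.
have D0 : 0 < Num.sqrt (\prod_k (n k)%:R) * \big[Num.max/0]_k Num.sqrt (n k)%:R :> R.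
  by rewrite ek mulr_gt0// sqrtr_gt0 ?ltr0n//; apply: prodr_gt0 => i _; rewrite ltr0n.
rewrite /G1_quotient ler_pdivlMr// ler_pdivrMr// mul1r (G1_le R k0)// andbT.
by have [a aP [<- _]] := @G1_attained R m n; rewrite ek; apply: knob_sup_ge.
Qed.

End Main.

Lemma G1_quotient_ones (R : realType) : 1 <= G1_quotient R (fun _ : 'I_2 => 1%N).
Proof.
set n := fun _ => _; rewrite /G1_quotient.
have -> : \prod_(k < 2) (n k)%:R = 1 :> R by rewrite big1.
have -> : \big[Num.max/0]_(k < 2) Num.sqrt (n k)%:R = 1 :> R.
  by rewrite !big_ord_recl big_ord0 sqrtr1 (max_l ler01) maxxx.
rewrite sqrtr1 mulr1 divr1.
have [a aP [<- _]] := @G1_attained R 2 n.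
pose j0 : multi_index n := finfun (fun k => ord0 : 'I_(n k)).
apply: le_trans (knob_sup_ub a (@unimodular1 R 2 n)).
rewrite /rotated_sum (big_pred1 j0).
  by rewrite big1 ?mulr1 ?aP.
move=> j /=; apply/esym/eqP; apply: idxP => k.
by rewrite (ord1 (j k)) (ord1 (j0 k)).
Qed.

Theorem theorem4p1 (R : realType) :
  (forall (m : nat) (n : 'I_m -> nat),
     (2 <= m)%N -> (forall k, (1 <= n k)%N) ->
     (Num.sqrt pi / 2) ^+ (m - 1) <= G1_quotient R n <= 1) /\
  ~ (exists2 C : R, C < 1 &
       forall (m : nat) (n : 'I_m -> nat),
         (2 <= m)%N -> (forall k, (1 <= n k)%N) -> G1_quotient R n <= C).
Proof.
split=> [m n m2 n1|[C C1 /(_ 2%N (fun=> 1%N) isT (fun=> isT)) hC]].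
  by rewrite subn1; apply: G1_quotient_bounds => //; apply: leq_trans m2.
by have := le_lt_trans (le_trans (G1_quotient_ones R) hC) C1; rewrite ltxx.
Qed.
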